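(* Let $H$ be a quasi-Hopf algebra over a field $k$, $\mathbb{A}$ an $H$-bicomodule algebra and $C$ an $H$-bimodule coalgebra. Then the category ${}_{\mathbb{A}}\mathcal{YD}(H)^C$ of left-right $(H,\mathbb{A},C)$-Yetter-Drinfeld modules and the category ${}_{\mathbb{A}^2}\mathcal{M}(H^{\rm op}\otimes H)^C$ of left-right $(H^{\rm op}\otimes H,\mathbb{A}^2,C)$-Hopf modules are isomorphic. In particular, ${}_{\mathbb{A}}\mathcal{YD}(H)^C$ is a Grothendieck category, and therefore it has enough injective objects.
   Context: $k$ is a field, $\otimes=\otimes_k$; algebras are associative and unital; summation is implicit. Quasi-bialgebra $(H,\Delta,\varepsilon,\Phi)$: an algebra $H$, algebra maps $\Delta:H\to H\otimes H$, $\varepsilon:H\to k$, an invertible $\Phi\in H^{\otimes3}$ with $(id\otimes\Delta)\Delta(h)=\Phi(\Delta\otimes id)\Delta(h)\Phi^{-1}$, $(id\otimes\varepsilon)\Delta(h)=h=(\varepsilon\otimes id)\Delta(h)$, $(1\otimes\Phi)(id\otimes\Delta\otimes id)(\Phi)(\Phi\otimes1)=(id\otimes id\otimes\Delta)(\Phi)(\Delta\otimes id\otimes id)(\Phi)$, $(id\otimes\varepsilon\otimes id)(\Phi)=1\otimes1$. Write $\Delta(h)=h_1\otimes h_2$, $\Phi=X^1\otimes X^2\otimes X^3$, $\Phi^{-1}=x^1\otimes x^2\otimes x^3$. A quasi-Hopf algebra has in addition an algebra anti-automorphism $S$ and $\alpha,\beta\in H$ with $S(h_1)\alpha h_2=\varepsilon(h)\alpha$,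 $h_1\beta S(h_2)=\varepsilon(h)\beta$, $X^1\beta S(X^2)\alpha X^3=1$, $S(x^1)\alpha x^2\beta S(x^3)=1$; convention: $\varepsilon(\alpha)=\varepsilon(\beta)=1$, $\varepsilon\circ S=\varepsilon$. Drinfeld twist: $f=f^1\otimes f^2=(S\otimes S)(\Delta^{\rm cop}(x^1))\,\gamma\,\Delta(x^2\beta S(x^3))\in H\otimes H$, an invertible element, where $\gamma=S(A^2)\alpha A^3\otimes S(A^1)\alpha A^4$ with $A^1\otimes A^2\otimes A^3\otimes A^4=(\Phi\otimes1)(\Delta\otimes id\otimes id)(\Phi^{-1})$, and $\Delta^{\rm cop}(h)=h_2\otimes h_1$. It satisfies $f\Delta(S(h))f^{-1}=(S\otimes S)(\Delta^{\rm cop}(h))$. $H^{\rm op}$ is $H$ with opposite multiplication, same $\Delta,\varepsilon$, and reassociator $\Phi^{-1}$; $H^{\rm op}\otimes H$ is the tensor product quasi-bialgebra, with componentwise structure and reassociator $(x^1\otimes X^1)\otimes(x^2\otimes X^2)\otimes(x^3\otimes X^3)$. Left $H$-comodule algebra $(\mathfrak{B},\lambda,\Phi_\lambda)$: algebra $\mathfrak{B}$, algebra map $\lambda:\mathfrak{B}\to H\otimes\mathfrak{B}$, invertible $\Phi_\lambda\in H\otimes H\otimes\mathfrak{B}$ with $(id\otimes\lambda)(\lambda(b))\Phi_\lambda=\Phi_\lambda(\Delta\otimes id)(\lambda(b))$, $(1_H\otimes\Phi_\lambda)(id\otimes\Delta\otimes id)(\Phi_\lambda)(\Phi\otimes1)=(id\otimes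 id\otimes\lambda)(\Phi_\lambda)(\Delta\otimes id\otimes id)(\Phi_\lambda)$, $(\varepsilon\otimes id)\lambda=id$, $(id\otimes\varepsilon\otimes id)(\Phi_\lambda)=(\varepsilon\otimes id\otimes id)(\Phi_\lambda)=1\otimes1$. Right $H$-comodule algebra $(\mathfrak{A},\rho,\Phi_\rho)$: algebra $\mathfrak{A}$, algebra map $\rho:\mathfrak{A}\to\mathfrak{A}\otimes H$, invertible $\Phi_\rho\in\mathfrak{A}\otimes H\otimes H$ with $\Phi_\rho(\rho\otimes id)(\rho(a))=(id\otimes\Delta)(\rho(a))\Phi_\rho$, $(1\otimes\Phi)(id\otimes\Delta\otimes id)(\Phi_\rho)(\Phi_\rho\otimes1_H)=(id\otimes id\otimes\Delta)(\Phi_\rho)(\rho\otimes id\otimes id)(\Phi_\rho)$, $(id\otimes\varepsilon)\rho=id$, $(id\otimes\varepsilon\otimes id)(\Phi_\rho)=(id\otimes id\otimes\varepsilon)(\Phi_\rho)=1\otimes1$. Notation: $\lambda(u)=u_{[-1]}\otimes u_{[0]}$, $\rho(u)=u_{\langle0\rangle}\otimes u_{\langle1\rangle}$, $\Phi_\lambda=\tilde X^1_\lambda\otimes\tilde X^2_\lambda\otimes\tilde X^3_\lambda$, $\Phi_\lambda^{-1}=\tilde x^1_\lambda\otimes\tilde x^2_\lambda\otimes\tilde x^3_\lambda$, similarly for $\Phi_\rho^{\pm1}$. $H$-bicomodule algebra $(\mathbb{A},\lambda,\rho,\Phi_\lambda,\Phi_\rho,\Phi_{\lambda,\rho})$: $(\mathbb{A},\lambda,\Phi_\lambda)$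 is a left and $(\mathbb{A},\rho,\Phi_\rho)$ a right $H$-comodule algebra, and $\Phi_{\lambda,\rho}=\Theta^1\otimes\Theta^2\otimes\Theta^3\in H\otimes\mathbb{A}\otimes H$ is invertible, with inverse $\theta^1\otimes\theta^2\otimes\theta^3$, such that $\Phi_{\lambda,\rho}(\lambda\otimes id)(\rho(u))=(id\otimes\rho)(\lambda(u))\Phi_{\lambda,\rho}$, $(1_H\otimes\Phi_{\lambda,\rho})(id\otimes\lambda\otimes id)(\Phi_{\lambda,\rho})(\Phi_\lambda\otimes1_H)=(id\otimes id\otimes\rho)(\Phi_\lambda)(\Delta\otimes id\otimes id)(\Phi_{\lambda,\rho})$, $(1_H\otimes\Phi_\rho)(id\otimes\rho\otimes id)(\Phi_{\lambda,\rho})(\Phi_{\lambda,\rho}\otimes1_H)=(id\otimes id\otimes\Delta)(\Phi_{\lambda,\rho})(\lambda\otimes id\otimes id)(\Phi_\rho)$. $\mathbb{A}^2=(\mathbb{A},\rho_2,\Phi_{\rho_2})$ is the right $H^{\rm op}\otimes H$-comodule algebra with $\rho_2(u)=u_{[0]_{\langle0\rangle}}\otimes(S^{-1}(u_{[-1]})\otimes u_{[0]_{\langle1\rangle}})$ and $\Phi_{\rho_2}=(\tilde x^3_\lambda)_{\langle0\rangle}\tilde X^1_\rho\Theta^2_{\langle0\rangle}\otimes\big(S^{-1}(f^2\tilde x^2_\lambda\Theta^1)\otimes(\tilde x^3_\lambda)_{\langle1\rangle_1}\tilde X^2_\rho\Theta^2_{\langle1\rangle}\big)\otimes\big(S^{-1}(f^1\tilde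 x^1_\lambda)\otimes(\tilde x^3_\lambda)_{\langle1\rangle_2}\tilde X^3_\rho\Theta^3\big)$. $H$-bimodule coalgebra $C$: an $(H,H)$-bimodule with $\underline\Delta:C\to C\otimes C$, $\underline\Delta(c)=c_{\underline1}\otimes c_{\underline2}$, and $\underline\varepsilon:C\to k$ such that $\Phi\cdot(\underline\Delta\otimes id)(\underline\Delta(c))\cdot\Phi^{-1}=(id\otimes\underline\Delta)(\underline\Delta(c))$, $\underline\Delta(h\cdot c)=h_1\cdot c_{\underline1}\otimes h_2\cdot c_{\underline2}$, $\underline\Delta(c\cdot h)=c_{\underline1}\cdot h_1\otimes c_{\underline2}\cdot h_2$, $(\underline\varepsilon\otimes id)\underline\Delta=(id\otimes\underline\varepsilon)\underline\Delta=id$, $\underline\varepsilon(h\cdot c)=\varepsilon(h)\underline\varepsilon(c)$, $\underline\varepsilon(c\cdot h)=\underline\varepsilon(c)\varepsilon(h)$. Left $H$-module coalgebras are defined likewise (left $H$-modules, with $\Phi\cdot(\underline\Delta\otimes id)\underline\Delta(c)=(id\otimes\underline\Delta)\underline\Delta(c)$). An $H$-bimodule coalgebra $C$ is viewed as a left $H^{\rm op}\otimes H$-module coalgebra via $(h\otimes h')\cdot c=h'\cdot c\cdot h$. Left-right $(H,\mathfrak{A},C)$-Hopf module (for $H$ a quasi-bialgebra, $\mathfrak{A}$ a right $H$-comodule algebra, $C$ a left $H$-module coalgebra): a left $\mathfrak{A}$-module $M$ with a linear map $\rho_M:M\to M\otimes C$, $\rho_M(m)=m_{(0)}\otimes m_{(1)}$,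 such that $\Phi_\rho\cdot(\rho_M\otimes id_C)(\rho_M(m))=(id_M\otimes\underline\Delta)(\rho_M(m))$, $(id_M\otimes\underline\varepsilon)(\rho_M(m))=m$, $\rho_M(a\cdot m)=a_{\langle0\rangle}\cdot m_{(0)}\otimes a_{\langle1\rangle}\cdot m_{(1)}$. ${}_{\mathfrak{A}}\mathcal{M}(H)^C$ is the category of these, with left $\mathfrak{A}$-linear right $C$-colinear maps. Left-right $(H,\mathbb{A},C)$-Yetter-Drinfeld module: a left $\mathbb{A}$-module $M$ with a linear map $\rho_M:M\to M\otimes C$, $\rho_M(m)=m_{(0)}\otimes m_{(1)}$, such that $\underline\varepsilon(m_{(1)})m_{(0)}=m$, $(\theta^2\cdot m_{(0)})_{(0)}\otimes(\theta^2\cdot m_{(0)})_{(1)}\cdot\theta^1\otimes\theta^3\cdot m_{(1)}=\tilde x^1_\rho\cdot(\tilde x^3_\lambda\cdot m)_{(0)}\otimes\tilde x^2_\rho\cdot(\tilde x^3_\lambda\cdot m)_{(1)_{\underline1}}\cdot\tilde x^1_\lambda\otimes\tilde x^3_\rho\cdot(\tilde x^3_\lambda\cdot m)_{(1)_{\underline2}}\cdot\tilde x^2_\lambda$, and $u_{\langle0\rangle}\cdot m_{(0)}\otimes u_{\langle1\rangle}\cdot m_{(1)}=(u_{[0]}\cdot m)_{(0)}\otimes(u_{[0]}\cdot m)_{(1)}\cdot u_{[-1]}$ for all $u\in\mathbb{A}$, $m\in M$. Morphisms preserve the $\mathbb{A}$-action and the $C$-coaction. *)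

(* Defs.v *)
From HB Require Import structures.
From mathcomp Require Import all_boot all_algebra.
From mathcomp Require Import generic_quotient boolp classical_sets.

Set Implicit Arguments.
Unset Strict Implicit.
Unset Printing Implicit Defensive.

Import GRing.Theory.
Local Open Scope ring_scope.
Local Open Scope quotient_scope.

(** * Tensor product of vector spaces

   Formal sums of pairs, modulo the congruence generated by the bilinearity
   relations; [tsum_pure] and [tsum_linear] give the universal property. *)

Section TensorDef.
Variables (k : fieldType) (V W : lmodType k).

Inductive tensor_eq : seq (V * W) -> seq (V * W) -> Prop :=
| tensor_eq_refl s : tensor_eq s s
| tensor_eq_sym s t : tensor_eq s t -> tensor_eq t s
| tensor_eq_trans s t u : tensor_eq s t -> tensor_eq t u -> tensor_eq s u
| tensor_eq_cat s s' t t' :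
    tensor_eq s s' -> tensor_eq t t' -> tensor_eq (s ++ t) (s' ++ t')
| tensor_eq_comm s t : tensor_eq (s ++ t) (t ++ s)
| tensor_eq_zero w : tensor_eq [:: (0, w)] [::]
| tensor_eq_addl v v' w : tensor_eq [:: (v + v', w)] [:: (v, w); (v', w)]
| tensor_eq_addr v w w' : tensor_eq [:: (v, w + w')] [:: (v, w); (v, w')]
| tensor_eq_scale (a : k) v w : tensor_eq [:: (a *: v, w)] [:: (v, a *: w)].

Definition tensor_rel (s t : seq (V * W)) : bool := `[< tensor_eq s t >].

Lemma tensor_rel_refl : reflexive tensor_rel.
Proof. by move=> s; apply/asboolP; apply: tensor_eq_refl. Qed.

Lemma tensor_rel_sym : symmetric tensor_rel.
Proof.
by move=> s t; apply/idP/idP => /asboolP st; apply/asboolP; apply: tensor_eq_sym.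
Qed.

Lemma tensor_rel_trans : transitive tensor_rel.
Proof.
by move=> t s u /asboolP st /asboolP tu; apply/asboolP; apply: tensor_eq_trans tu.
Qed.

Canonical tensor_equiv :=
  EquivRel tensor_rel tensor_rel_refl tensor_rel_sym tensor_rel_trans.

Definition tensor : Type := {eq_quot tensor_rel}.

HB.instance Definition _ := Choice.on tensor.

Definition tpi (s : seq (V * W)) : tensor := \pi_{eq_quot tensor_rel} s.
Definition trepr (t : tensor) : seq (V * W) :=
  repr (t : {eq_quot tensor_rel}).

Lemma treprK : cancel trepr tpi. Proof. exact: reprK. Qed.

Lemma tpiP s t : tpi s = tpi t <-> tensor_eq s t.
Proof.
by split=> [/eqP|st]; [rewrite /tpi eqmodE => /asboolP|
  apply/eqP; rewrite /tpi eqmodE; apply/asboolP].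
Qed.

Lemma trepr_pi s : tensor_eq (trepr (tpi s)) s.
Proof. by apply/tpiP; rewrite treprK. Qed.

Definition tadd (x y : tensor) := tpi (trepr x ++ trepr y).
Definition tzero := tpi [::].
Definition tscale (a : k) (x : tensor) :=
  tpi [seq (a *: p.1, p.2) | p <- trepr x].
Definition topp (x : tensor) := tscale (-1) x.

Lemma tadd_pi s t : tadd (tpi s) (tpi t) = tpi (s ++ t).
Proof. by apply/tpiP; apply: tensor_eq_cat; apply: trepr_pi. Qed.

Lemma tensor_eq_map (a : k) s t : tensor_eq s t ->
  tensor_eq [seq (a *: p.1, p.2) | p <- s] [seq (a *: p.1, p.2) | p <- t].
Proof.
elim=> {s t} [s|s t _|s t u _ + _|s s' t t' _ hs _ ht|s t|w|v v' w|v w w'|b v w];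
  rewrite ?map_cat /=.
- exact: tensor_eq_refl.
- exact: tensor_eq_sym.
- exact: tensor_eq_trans.
- exact: tensor_eq_cat.
- exact: tensor_eq_comm.
- by rewrite scaler0; apply: tensor_eq_zero.
- by rewrite scalerDr; apply: tensor_eq_addl.
- exact: tensor_eq_addr.
- by rewrite scalerA mulrC -scalerA; apply: tensor_eq_scale.
Qed.

Lemma tscale_pi a s : tscale a (tpi s) = tpi [seq (a *: p.1, p.2) | p <- s].
Proof. by apply/tpiP; apply: tensor_eq_map; apply: trepr_pi. Qed.

Lemma taddA : associative tadd.
Proof.
move=> x y z; rewrite -(treprK x) -(treprK y) -(treprK z).
by rewrite !tadd_pi catA.
Qed.

Lemma taddC : commutative tadd.
Proof.
move=> x y; rewrite -(treprK x) -(treprK y) !tadd_pi.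
by apply/tpiP; apply: tensor_eq_comm.
Qed.

Lemma tadd0 : left_id tzero tadd.
Proof. by move=> x; rewrite -(treprK x) tadd_pi. Qed.

Lemma tscaleDl x : {morph tscale^~ x : a b / a + b >-> tadd a b}.
Proof.
move=> a b; rewrite -(treprK x) !tscale_pi tadd_pi; apply/tpiP.
elim: (trepr x) => [|[v w] s IHs] /=; first exact: tensor_eq_refl.
rewrite scalerDl -cat1s.
apply: tensor_eq_trans (tensor_eq_cat (tensor_eq_addl _ _ _) IHs) _.
set u := map _ s; set u' := map _ s.
have -> : (a *: v, w) :: u ++ (b *: v, w) :: u' =
    [:: (a *: v, w)] ++ ((u ++ [:: (b *: v, w)]) ++ u') by rewrite -catA.
apply: (@tensor_eq_cat [:: (a *: v, w)]); first exact: tensor_eq_refl.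
apply: (@tensor_eq_cat ([:: (b *: v, w)] ++ u)); last exact: tensor_eq_refl.
exact: tensor_eq_comm.
Qed.

Lemma tscale0 x : tscale 0 x = tzero.
Proof.
rewrite -(treprK x) tscale_pi; apply/tpiP.
elim: (trepr x) => [|[v w] s IHs] /=; first exact: tensor_eq_refl.
rewrite scale0r -cat1s -[[::]]cat0s.
by apply: tensor_eq_cat; first exact: tensor_eq_zero.
Qed.

Lemma tscale1 : left_id 1 tscale.
Proof.
move=> x; rewrite -[RHS](treprK x) /tscale; congr tpi.
by rewrite -[RHS]map_id; apply: eq_map => -[v w]; rewrite scale1r.
Qed.

Lemma tscaleA a b x : tscale a (tscale b x) = tscale (a * b) x.
Proof.
rewrite -(treprK x) !tscale_pi -map_comp; congr tpi.
by apply: eq_map => -[v w] /=; rewrite scalerA.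
Qed.

Lemma tscaleDr : right_distributive tscale tadd.
Proof.
move=> a x y; rewrite -(treprK x) -(treprK y).
by rewrite tadd_pi !tscale_pi tadd_pi map_cat.
Qed.

Lemma taddN : left_inverse tzero topp tadd.
Proof. by move=> x; rewrite -{2}[x]tscale1 -tscaleDl addNr tscale0. Qed.

HB.instance Definition _ :=
  GRing.isZmodule.Build tensor taddA taddC tadd0 taddN.
HB.instance Definition _ :=
  GRing.Zmodule_isLmodule.Build k tensor tscaleA tscale1 tscaleDr tscaleDl.

Definition tpure (v : V) (w : W) : tensor := tpi [:: (v, w)].

(* Sweedler summation: [tsum t F] is F t_1 t_2, summed over a chosen expression
   of t as a sum of pure tensors.  The value does not depend on this expression
   when F is bilinear, which is the only case in which [tsum] is used below. *)
Definition tsum (U : nmodType) (t : tensor) (F : V -> W -> U) : U :=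
  \sum_(p <- trepr t) F p.1 p.2.

Definition is_bilinear (U : lmodType k) (F : V -> W -> U) : Prop :=
  (forall w, linear (F^~ w)) /\ (forall v, linear (F v)).

End TensorDef.

Arguments tensor {k} (V W)%_type_scope.
Arguments tpure {k V W} & v w.
Arguments tsum {k V W U}.

Notation "V ⊗ W" := (tensor V W) (at level 42, right associativity) : type_scope.
Notation "v ⊗ w" := (tpure v w) (at level 42, right associativity) : ring_scope.
Notation "\tsum_( x ⊗ y := t ) E" := (tsum t (fun x y => E))
  (at level 42, x name, y name, t at level 60, E at level 42,
   format "'[' \tsum_( x  ⊗  y  :=  t ) '/  '  E ']'") : ring_scope.
Notation "\tsum_( x ⊗ y ⊗ z := t ) E" :=
  (tsum t (fun x u => tsum u (fun y z => E)))
  (at level 42, x name, y name, z name, t at level 60, E at level 42,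
   format "'[' \tsum_( x  ⊗  y  ⊗  z  :=  t ) '/  '  E ']'") : ring_scope.
Notation "\tsum_( x ⊗ y ⊗ z ⊗ w := t ) E" :=
  (tsum t (fun x u => tsum u (fun y v => tsum v (fun z w => E))))
  (at level 42, x name, y name, z name, w name, t at level 60, E at level 42,
   format "'[' \tsum_( x  ⊗  y  ⊗  z  ⊗  w  :=  t ) '/  '  E ']'") : ring_scope.

Section TensorTheory.
Variables (k : fieldType).
Implicit Types (V W U : lmodType k).

Lemma tpure_bilinear V W : is_bilinear (@tpure k V W).
Proof.
have scalel a (v : V) (w : W) : (a *: v) ⊗ w = a *: (v ⊗ w).
  by rewrite [RHS]tscale_pi.
have addl (v v' : V) (w : W) : (v + v') ⊗ w = (v ⊗ w) + (v' ⊗ w).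
  by rewrite [RHS]tadd_pi; apply/tpiP; apply: tensor_eq_addl.
split=> [w a v v'|v a w w']; first by rewrite addl scalel.
rewrite -scalel.
transitivity ((v ⊗ (a *: w)) + (v ⊗ w') : tensor V W).
  by rewrite [RHS]tadd_pi; apply/tpiP; apply: tensor_eq_addr.
by congr (_ + _); apply/tpiP; apply: tensor_eq_sym; apply: tensor_eq_scale.
Qed.

Lemma tpureE V W (t : V ⊗ W) : t = \tsum_(v ⊗ w := t) v ⊗ w.
Proof.
rewrite /tsum -{1}[t]treprK; elim: (trepr t) => [|[v w] s IHs].
  by rewrite big_nil.
by rewrite big_cons -IHs [RHS]tadd_pi.
Qed.

Lemma tsum_pi V W U (F : V -> W -> U) s : is_bilinear F ->
  tsum (tpi s) F = \sum_(p <- s) F p.1 p.2.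
Proof.
case=> Fl Fr; rewrite /tsum; have := trepr_pi s; move: (trepr _) => t.
elim=> {s t} [s|s t _|s t u _ + _|s s' t t' _ hs _ ht|s t|w|v v' w|v w w'|b v w] //.
- by move=> ->.
- by rewrite !big_cat hs ht.
- by rewrite !big_cat /= addrC.
- rewrite big_seq1 big_nil /=.
  by have := Fl w (-1) 0 0; rewrite scaler0 addr0 scaleN1r addNr.
- rewrite big_seq1 !big_cons big_nil addr0 /=.
  by have := Fl w 1 v v'; rewrite !scale1r.
- rewrite big_seq1 !big_cons big_nil addr0 /=.
  by have := Fr v 1 w w'; rewrite !scale1r.
- rewrite !big_seq1 /=.
  have F0w : F 0 w = 0.
    by have := Fl w (-1) 0 0; rewrite scaler0 addr0 scaleN1r addNr.
  have Fv0 : F v 0 = 0.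
    by have := Fr v (-1) 0 0; rewrite scaler0 addr0 scaleN1r addNr.
  have := Fl w b v 0; have := Fr v b w 0.
  by rewrite !addr0 F0w Fv0 !addr0 => -> ->.
Qed.

Lemma tsum_pure V W U (F : V -> W -> U) v w : is_bilinear F ->
  tsum (v ⊗ w) F = F v w.
Proof. by move=> /tsum_pi ->; rewrite big_seq1. Qed.

Lemma tsum_linear V W U (F : V -> W -> U) : is_bilinear F ->
  linear (fun t => tsum t F).
Proof.
move=> Fb a x y; have [Fl _] := Fb.
rewrite -(treprK x) -(treprK y).
have -> : a *: tpi (trepr x) + tpi (trepr y) =
    tpi ([seq (a *: p.1, p.2) | p <- trepr x] ++ trepr y).
  by rewrite -tadd_pi -tscale_pi.
rewrite !tsum_pi // big_cat big_map /= scaler_sumr; congr (_ + _).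
apply: eq_bigr => -[v w] _ /=.
have F0w : F 0 w = 0.
  by have := Fl w (-1) 0 0; rewrite scaler0 addr0 scaleN1r addNr.
by have := Fl w a v 0; rewrite !addr0 F0w addr0.
Qed.

Lemma tsumD V W U (F : V -> W -> U) s t : is_bilinear F ->
  tsum (s + t) F = tsum s F + tsum t F.
Proof. by move=> /tsum_linear/(_ 1 s t); rewrite !scale1r. Qed.

Lemma tsum0 V W U (F : V -> W -> U) : is_bilinear F -> tsum 0 F = 0.
Proof. by move=> Fb; rewrite [0]/(tpi [::]) tsum_pi // big_nil. Qed.

Lemma tsumZ V W U (F : V -> W -> U) a t : is_bilinear F ->
  tsum (a *: t) F = a *: tsum t F.
Proof. by move=> Fb; have := tsum_linear Fb a t 0; rewrite tsum0 // !addr0. Qed.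

Lemma eq_tsum V W (U : nmodType) (F G : V -> W -> U) t :
  (forall v w, F v w = G v w) -> tsum t F = tsum t G.
Proof. by move=> FG; apply: eq_bigr. Qed.

Lemma linear_tsum V W U U' (f : U -> U') (F : V -> W -> U) t : linear f ->
  f (tsum t F) = \tsum_(v ⊗ w := t) f (F v w).
Proof.
move=> fl.
have f0 : f 0 = 0 by have := fl (-1) 0 0; rewrite scaler0 addr0 scaleN1r addNr.
rewrite /tsum; apply: (big_morph f) => // x y.
by have := fl 1 x y; rewrite !scale1r.
Qed.

Lemma tensor_ind V W (P : V ⊗ W -> Prop) :
  P 0 -> (forall s t, P s -> P t -> P (s + t)) -> (forall v w, P (v ⊗ w)) ->
  forall t, P t.
Proof.
move=> P0 PD Pp t; rewrite (tpureE t) /tsum.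
by apply: (big_ind P) => // i _; apply: Pp.
Qed.

End TensorTheory.

(** * Algebras

   [algType k] excludes the zero ring, whereas an associative unital k-algebra
   may be zero; hence this structure, whose multiplication is given on top of
   the vector space structure and then equips the carrier with a [pzRingType]. *)

HB.mixin Record Lmodule_isKAlgebra (k : fieldType) A of GRing.Lmodule k A := {
  kone : A;
  kmul : A -> A -> A;
  kmulA : associative kmul;
  kmul1l : left_id kone kmul;
  kmul1r : right_id kone kmul;
  kmulDl : left_distributive kmul +%R;
  kmulDr : right_distributive kmul +%R;
  kscaleAl : forall (a : k) (x y : A), a *: kmul x y = kmul (a *: x) y;
  kscaleAr : forall (a : k) (x y : A), a *: kmul x y = kmul x (a *: y)
}.

#[short(type="kalgType")]
HB.structure Definition KAlgebra (k : fieldType) :=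
  {A of GRing.Lmodule k A & Lmodule_isKAlgebra k A}.

#[non_forgetful_inheritance]
HB.instance Definition _ (k : fieldType) (A : kalgType k) :=
  GRing.Zmodule_isPzRing.Build (KAlgebra.sort A)
    (@kmulA k A) (@kmul1l k A) (@kmul1r k A) (@kmulDl k A) (@kmulDr k A).

Section OppositeAlgebra.
Variables (k : fieldType) (A : kalgType k).
HB.instance Definition _ := GRing.Lmodule.on (A^c).
HB.instance Definition _ := Lmodule_isKAlgebra.Build k A^c
  (@mulrA A^c) (@mul1r A^c) (@mulr1 A^c) (@mulrDl A^c) (@mulrDr A^c)
  (fun a x y => kscaleAr a (y : A) (x : A))
  (fun a x y => kscaleAl a (y : A) (x : A)).
End OppositeAlgebra.

Section TensorAlgebra.
Variables (k : fieldType) (A B : kalgType k).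

Definition tone : A ⊗ B := 1 ⊗ 1.
Definition tmul (s t : A ⊗ B) : A ⊗ B :=
  \tsum_(a ⊗ b := s) \tsum_(c ⊗ d := t) (a * c) ⊗ (b * d).

Fact mull_lin (x : A) : linear (fun y : A => x * y).
Proof. by move=> a y z; rewrite mulrDr [in RHS]kscaleAr. Qed.
Fact mulr_lin (x : A) : linear (fun y : A => y * x).
Proof. by move=> a y z; rewrite mulrDl [in RHS]kscaleAl. Qed.
End TensorAlgebra.

Section TensorAlgebraTheory.
Variables (k : fieldType) (A B : kalgType k).
Local Notation mul := (@tmul k A B).

Lemma tmul_inner (a : A) (b : B) :
  is_bilinear (fun (c : A) (d : B) => (a * c) ⊗ (b * d) : A ⊗ B).
Proof.
have [pl pr] := tpure_bilinear A B.
split=> [w x y z|w x y z]; first by rewrite mull_lin pl.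
by rewrite mull_lin pr.
Qed.

Lemma tmul_outer (t : A ⊗ B) :
  is_bilinear (fun (a : A) (b : B) => \tsum_(c ⊗ d := t) (a * c) ⊗ (b * d) : A ⊗ B).
Proof.
have [pl pr] := tpure_bilinear A B.
split=> [w x y z|w x y z].
  rewrite /tsum scaler_sumr -big_split /=; apply: eq_bigr => p _.
  by rewrite mulr_lin pl.
rewrite /tsum scaler_sumr -big_split /=; apply: eq_bigr => p _.
by rewrite mulr_lin pr.
Qed.

Lemma tmul_pure a b c d : mul (a ⊗ b) (c ⊗ d) = (a * c) ⊗ (b * d).
Proof.
rewrite /tmul tsum_pure; last exact: tmul_outer.
by rewrite tsum_pure //; apply: tmul_inner.
Qed.

Lemma tmul_linl t : linear (mul^~ t).
Proof. exact: tsum_linear (tmul_outer t). Qed.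

Lemma tmul_linr s : linear (mul s).
Proof.
move=> x u v; rewrite /tmul /tsum scaler_sumr -big_split /=.
by apply: eq_bigr => p _; apply: (tsum_linear (tmul_inner _ _)).
Qed.

Lemma tmulDl : left_distributive mul +%R.
Proof. by move=> s t u; have := tmul_linl u 1 s t; rewrite !scale1r. Qed.
Lemma tmulDr : right_distributive mul +%R.
Proof. by move=> s t u; have := tmul_linr s 1 t u; rewrite !scale1r. Qed.
Lemma tmul0l t : mul 0 t = 0.
Proof. by apply: (addrI (mul 0 t)); rewrite -tmulDl !addr0. Qed.
Lemma tmul0r t : mul t 0 = 0.
Proof. by apply: (addrI (mul t 0)); rewrite -tmulDr !addr0. Qed.

Lemma tmulA : associative mul.
Proof.
move=> s t u; elim/tensor_ind: s => [|s s' IH IH'|a b].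
- by rewrite !tmul0l.
- by rewrite !tmulDl IH IH'.
elim/tensor_ind: t => [|s s' IH IH'|c d].
- by rewrite tmul0l tmul0r tmul0l.
- by rewrite !(tmulDl, tmulDr) IH IH'.
elim/tensor_ind: u => [|s s' IH IH'|e f].
- by rewrite !tmul0r.
- by rewrite !tmulDr IH IH'.
by rewrite !tmul_pure !mulrA.
Qed.

Lemma tmul1l : left_id (tone A B) mul.
Proof.
elim/tensor_ind => [|s t IHs IHt|a b]; first exact: tmul0r.
  by rewrite tmulDr IHs IHt.
by rewrite tmul_pure !mul1r.
Qed.

Lemma tmul1r : right_id (tone A B) mul.
Proof.
elim/tensor_ind => [|s t IHs IHt|a b]; first exact: tmul0l.
  by rewrite tmulDl IHs IHt.
by rewrite tmul_pure !mulr1.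
Qed.

Lemma tscaleAl (a : k) (x y : A ⊗ B) : a *: mul x y = mul (a *: x) y.
Proof. by have := tmul_linl y a x 0; rewrite !addr0 tmul0l addr0. Qed.
Lemma tscaleAr (a : k) (x y : A ⊗ B) : a *: mul x y = mul x (a *: y).
Proof. by have := tmul_linr x a y 0; rewrite !addr0 tmul0r addr0. Qed.

HB.instance Definition _ := Lmodule_isKAlgebra.Build k (tensor A B)
  tmulA tmul1l tmul1r tmulDl tmulDr tscaleAl tscaleAr.
HB.instance Definition _ := GRing.Zmodule_isPzRing.Build (tensor A B)
  tmulA tmul1l tmul1r tmulDl tmulDr.

End TensorAlgebraTheory.

Definition is_inverse (R : pzRingType) (x y : R) : Prop := x * y = 1 /\ y * x = 1.
Definition invertible (R : pzRingType) (x : R) : Prop := exists y, is_inverse x y.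

(* The inverse of x, with junk value 0 when x is not invertible. *)
Definition inverse (R : pzRingType) (x : R) : R := xget 0 [set y | is_inverse x y].

Definition is_algebra_map (k : fieldType) (A B : kalgType k) (f : A -> B) : Prop :=
  linear f /\ GRing.monoid_morphism f.

Definition is_left_action (k : fieldType) (A : kalgType k) (M : lmodType k)
    (act : A -> M -> M) : Prop :=
  [/\ is_bilinear act,
      forall m, act 1 m = m
    & forall a b m, act (a * b) m = act a (act b m)].

Definition is_right_action (k : fieldType) (A : kalgType k) (M : lmodType k)
    (act : M -> A -> M) : Prop :=
  [/\ is_bilinear act,
      forall m, act m 1 = m
    & forall a b m, act m (a * b) = act (act m a) b].

(** * Quasi-Hopf algebras

   Each algebraic structure is given by a record of structure maps together with
   a predicate stating its axioms; constructions, and the categories of modules,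
   depend only on the structure maps.  The threefold tensor power of V is
   [V ⊗ (V ⊗ V)]; Sweedler sums make the rebracketings implicit. *)

Record quasi_bialgebra_data (k : fieldType) := QuasiBialgebraData {
  qb_alg :> kalgType k;
  Delta : qb_alg -> qb_alg ⊗ qb_alg;
  eps : qb_alg -> k;
  Phi : qb_alg ⊗ qb_alg ⊗ qb_alg
}.
Arguments Delta {k q}.
Arguments eps {k q}.

Record is_quasi_bialgebra (k : fieldType) (H : quasi_bialgebra_data k) : Prop := {
  qb_Delta_alg : is_algebra_map (@Delta k H);
  qb_eps_alg : scalar (@eps k H) /\ GRing.monoid_morphism (@eps k H);
  qb_Phi_inv : invertible (Phi H);
  qb_coassoc : forall h : H,
    (\tsum_(h1 ⊗ h2 := Delta h) \tsum_(a ⊗ b := Delta h2) h1 ⊗ a ⊗ b)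
    = Phi H * (\tsum_(h1 ⊗ h2 := Delta h) \tsum_(a ⊗ b := Delta h1) a ⊗ b ⊗ h2)
      * inverse (Phi H);
  qb_counitr : forall h : H, (\tsum_(h1 ⊗ h2 := Delta h) (eps h2 *: h1)) = h;
  qb_counitl : forall h : H, (\tsum_(h1 ⊗ h2 := Delta h) (eps h1 *: h2)) = h;
  qb_pentagon :
    ((1 ⊗ Phi H : H ⊗ H ⊗ H ⊗ H)
     * (\tsum_(X1 ⊗ X2 ⊗ X3 := Phi H) \tsum_(a ⊗ b := Delta X2) X1 ⊗ a ⊗ b ⊗ X3)
     * (\tsum_(X1 ⊗ X2 ⊗ X3 := Phi H) X1 ⊗ X2 ⊗ X3 ⊗ (1 : H)))
    = (\tsum_(X1 ⊗ X2 ⊗ X3 := Phi H) \tsum_(a ⊗ b := Delta X3) X1 ⊗ X2 ⊗ a ⊗ b)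
      * (\tsum_(X1 ⊗ X2 ⊗ X3 := Phi H) \tsum_(a ⊗ b := Delta X1) a ⊗ b ⊗ X2 ⊗ X3);
  qb_Phi_counit :
    (\tsum_(X1 ⊗ X2 ⊗ X3 := Phi H) (eps X2 *: (X1 ⊗ X3))) = 1 ⊗ 1 :> H ⊗ H
}.

Definition opposite_qb (k : fieldType) (H : quasi_bialgebra_data k) :
    quasi_bialgebra_data k :=
  @QuasiBialgebraData k (H^c) (@Delta k H) (@eps k H) (inverse (Phi H)).

Definition tensor_qb (k : fieldType) (H K : quasi_bialgebra_data k) :
    quasi_bialgebra_data k :=
  @QuasiBialgebraData k (H ⊗ K)%type
    (fun t => \tsum_(h ⊗ l := t)
      \tsum_(h1 ⊗ h2 := Delta h) \tsum_(l1 ⊗ l2 := Delta l)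
        (h1 ⊗ l1) ⊗ (h2 ⊗ l2))
    (fun t => \tsum_(h ⊗ l := t) (eps h * eps l))
    (\tsum_(X1 ⊗ X2 ⊗ X3 := Phi H) \tsum_(Y1 ⊗ Y2 ⊗ Y3 := Phi K)
        (X1 ⊗ Y1) ⊗ (X2 ⊗ Y2) ⊗ (X3 ⊗ Y3)).

(* The last three axioms of [is_quasi_hopf] are the usual normalization. *)
Record quasi_hopf_data (k : fieldType) := QuasiHopfData {
  qh_qb :> quasi_bialgebra_data k;
  antipode : qh_qb -> qh_qb;
  antipode_inv : qh_qb -> qh_qb;
  qh_alpha : qh_qb;
  qh_beta : qh_qb
}.
Arguments antipode {k q}.
Arguments antipode_inv {k q}.

Record is_quasi_hopf (k : fieldType) (H : quasi_hopf_data k) : Prop := {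
  qh_quasi_bialgebra : is_quasi_bialgebra H;
  qh_S_linear : linear (@antipode k H);
  qh_S_one : antipode (1 : H) = 1;
  qh_S_mul : forall x y : H, antipode (x * y) = antipode y * antipode x;
  qh_S_invl : cancel (@antipode k H) antipode_inv;
  qh_S_invr : cancel (@antipode_inv k H) antipode;
  qh_alphaP : forall h : H,
    (\tsum_(h1 ⊗ h2 := Delta h) (antipode h1 * qh_alpha H * h2))
    = eps h *: qh_alpha H;
  qh_betaP : forall h : H,
    (\tsum_(h1 ⊗ h2 := Delta h) (h1 * qh_beta H * antipode h2))
    = eps h *: qh_beta H;
  qh_Phi_antipode :
    (\tsum_(X1 ⊗ X2 ⊗ X3 := Phi H)
      (X1 * qh_beta H * antipode X2 * qh_alpha H * X3)) = 1;
  qh_Phi_inv_antipode :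
    (\tsum_(x1 ⊗ x2 ⊗ x3 := inverse (Phi H))
      (antipode x1 * qh_alpha H * x2 * qh_beta H * antipode x3)) = 1;
  qh_eps_alpha : eps (qh_alpha H) = 1;
  qh_eps_beta : eps (qh_beta H) = 1;
  qh_eps_antipode : forall h : H, eps (antipode h) = eps h
}.

Section DrinfeldTwist.
Variables (k : fieldType) (H : quasi_hopf_data k).
Local Notation S := (@antipode k H).

Definition twist_gamma : H ⊗ H :=
  let A : H ⊗ H ⊗ H ⊗ H :=
    (\tsum_(X1 ⊗ X2 ⊗ X3 := Phi H) X1 ⊗ X2 ⊗ X3 ⊗ (1 : H))
    * (\tsum_(x1 ⊗ x2 ⊗ x3 := inverse (Phi H))
        \tsum_(a ⊗ b := Delta x1) a ⊗ b ⊗ x2 ⊗ x3) in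
  \tsum_(A1 ⊗ A2 ⊗ A3 ⊗ A4 := A)
    (S A2 * qh_alpha H * A3) ⊗ (S A1 * qh_alpha H * A4).

Definition drinfeld_twist : H ⊗ H :=
  \tsum_(x1 ⊗ x2 ⊗ x3 := inverse (Phi H))
    ((\tsum_(a ⊗ b := Delta x1) S b ⊗ S a)
     * twist_gamma * Delta (x2 * qh_beta H * S x3)).

End DrinfeldTwist.

(** * Comodule algebras *)

Record left_comodule_algebra_data (k : fieldType) (H : quasi_bialgebra_data k) :=
  LeftComoduleAlgebraData {
    lca_alg :> kalgType k;
    lcoact : lca_alg -> H ⊗ lca_alg;
    lPhi : H ⊗ H ⊗ lca_alg
  }.
Arguments lcoact {k H l}.

Record is_left_comodule_algebra (k : fieldType) (H : quasi_bialgebra_data k)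
    (B : left_comodule_algebra_data H) : Prop := {
  lca_alg_map : is_algebra_map (@lcoact k H B);
  lca_Phi_inv : invertible (lPhi B);
  lca_coassoc : forall b : B,
    (\tsum_(h ⊗ b0 := lcoact b) \tsum_(h' ⊗ b00 := lcoact b0) h ⊗ h' ⊗ b00)
      * lPhi B
    = lPhi B
      * (\tsum_(h ⊗ b0 := lcoact b) \tsum_(h1 ⊗ h2 := Delta h) h1 ⊗ h2 ⊗ b0);
  lca_pentagon :
    ((1 ⊗ lPhi B : H ⊗ H ⊗ H ⊗ B)
     * (\tsum_(X1 ⊗ X2 ⊗ X3 := lPhi B) \tsum_(a ⊗ b := Delta X2) X1 ⊗ a ⊗ b ⊗ X3)
     * (\tsum_(X1 ⊗ X2 ⊗ X3 := Phi H) X1 ⊗ X2 ⊗ X3 ⊗ (1 : B)))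
    = (\tsum_(X1 ⊗ X2 ⊗ X3 := lPhi B) \tsum_(h ⊗ b := lcoact X3) X1 ⊗ X2 ⊗ h ⊗ b)
      * (\tsum_(X1 ⊗ X2 ⊗ X3 := lPhi B) \tsum_(a ⊗ b := Delta X1) a ⊗ b ⊗ X2 ⊗ X3);
  lca_counit : forall b : B, (\tsum_(h ⊗ b0 := lcoact b) (eps h *: b0)) = b;
  lca_Phi_counit_mid :
    (\tsum_(X1 ⊗ X2 ⊗ X3 := lPhi B) (eps X2 *: (X1 ⊗ X3))) = 1 ⊗ 1 :> H ⊗ B;
  lca_Phi_counit_left :
    (\tsum_(X1 ⊗ X2 ⊗ X3 := lPhi B) (eps X1 *: (X2 ⊗ X3))) = 1 ⊗ 1 :> H ⊗ B
}.

Record right_comodule_algebra_data (k : fieldType) (H : quasi_bialgebra_data k) :=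
  RightComoduleAlgebraData {
    rca_alg :> kalgType k;
    rcoact : rca_alg -> rca_alg ⊗ H;
    rPhi : rca_alg ⊗ H ⊗ H
  }.
Arguments rcoact {k H r}.

Record is_right_comodule_algebra (k : fieldType) (H : quasi_bialgebra_data k)
    (A : right_comodule_algebra_data H) : Prop := {
  rca_alg_map : is_algebra_map (@rcoact k H A);
  rca_Phi_inv : invertible (rPhi A);
  rca_coassoc : forall a : A,
    rPhi A
      * (\tsum_(a0 ⊗ h := rcoact a) \tsum_(a00 ⊗ h' := rcoact a0) a00 ⊗ h' ⊗ h)
    = (\tsum_(a0 ⊗ h := rcoact a) \tsum_(h1 ⊗ h2 := Delta h) a0 ⊗ h1 ⊗ h2)
      * rPhi A;
  rca_pentagon :
    ((1 ⊗ Phi H : A ⊗ H ⊗ H ⊗ H)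
     * (\tsum_(X1 ⊗ X2 ⊗ X3 := rPhi A) \tsum_(a ⊗ b := Delta X2) X1 ⊗ a ⊗ b ⊗ X3)
     * (\tsum_(X1 ⊗ X2 ⊗ X3 := rPhi A) X1 ⊗ X2 ⊗ X3 ⊗ (1 : H)))
    = (\tsum_(X1 ⊗ X2 ⊗ X3 := rPhi A) \tsum_(a ⊗ b := Delta X3) X1 ⊗ X2 ⊗ a ⊗ b)
      * (\tsum_(X1 ⊗ X2 ⊗ X3 := rPhi A) \tsum_(a ⊗ h := rcoact X1) a ⊗ h ⊗ X2 ⊗ X3);
  rca_counit : forall a : A, (\tsum_(a0 ⊗ h := rcoact a) (eps h *: a0)) = a;
  rca_Phi_counit_mid :
    (\tsum_(X1 ⊗ X2 ⊗ X3 := rPhi A) (eps X2 *: (X1 ⊗ X3))) = 1 ⊗ 1 :> A ⊗ H;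
  rca_Phi_counit_right :
    (\tsum_(X1 ⊗ X2 ⊗ X3 := rPhi A) (eps X3 *: (X1 ⊗ X2))) = 1 ⊗ 1 :> A ⊗ H
}.

Record bicomodule_algebra_data (k : fieldType) (H : quasi_bialgebra_data k) :=
  BicomoduleAlgebraData {
    bca_alg :> kalgType k;
    blambda : bca_alg -> H ⊗ bca_alg;
    brho : bca_alg -> bca_alg ⊗ H;
    Phi_lambda : H ⊗ H ⊗ bca_alg;
    Phi_rho : bca_alg ⊗ H ⊗ H;
    Phi_lambda_rho : H ⊗ bca_alg ⊗ H
  }.
Arguments blambda {k H b}.
Arguments brho {k H b}.

Definition bca_left (k : fieldType) (H : quasi_bialgebra_data k)
    (A : bicomodule_algebra_data H) : left_comodule_algebra_data H :=
  LeftComoduleAlgebraData (@blambda k H A) (Phi_lambda A).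

Definition bca_right (k : fieldType) (H : quasi_bialgebra_data k)
    (A : bicomodule_algebra_data H) : right_comodule_algebra_data H :=
  RightComoduleAlgebraData (@brho k H A) (Phi_rho A).

Record is_bicomodule_algebra (k : fieldType) (H : quasi_bialgebra_data k)
    (A : bicomodule_algebra_data H) : Prop := {
  bca_left_comodule : is_left_comodule_algebra (bca_left A);
  bca_right_comodule : is_right_comodule_algebra (bca_right A);
  bca_Phi_inv : invertible (Phi_lambda_rho A);
  bca_compat : forall u : A,
    Phi_lambda_rho A
      * (\tsum_(u0 ⊗ h := brho u) \tsum_(h' ⊗ u00 := blambda u0) h' ⊗ u00 ⊗ h)
    = (\tsum_(h ⊗ u0 := blambda u) \tsum_(u00 ⊗ h' := brho u0) h ⊗ u00 ⊗ h')
      * Phi_lambda_rho A;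
  bca_pentagon_left :
    ((1 ⊗ Phi_lambda_rho A : H ⊗ H ⊗ A ⊗ H)
     * (\tsum_(T1 ⊗ T2 ⊗ T3 := Phi_lambda_rho A)
         \tsum_(h ⊗ u := blambda T2) T1 ⊗ h ⊗ u ⊗ T3)
     * (\tsum_(X1 ⊗ X2 ⊗ X3 := Phi_lambda A) X1 ⊗ X2 ⊗ X3 ⊗ (1 : H)))
    = (\tsum_(X1 ⊗ X2 ⊗ X3 := Phi_lambda A)
        \tsum_(u ⊗ h := brho X3) X1 ⊗ X2 ⊗ u ⊗ h)
      * (\tsum_(T1 ⊗ T2 ⊗ T3 := Phi_lambda_rho A)
          \tsum_(a ⊗ b := Delta T1) a ⊗ b ⊗ T2 ⊗ T3);
  bca_pentagon_right :
    ((1 ⊗ Phi_rho A : H ⊗ A ⊗ H ⊗ H)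
     * (\tsum_(T1 ⊗ T2 ⊗ T3 := Phi_lambda_rho A)
         \tsum_(u ⊗ h := brho T2) T1 ⊗ u ⊗ h ⊗ T3)
     * (\tsum_(T1 ⊗ T2 ⊗ T3 := Phi_lambda_rho A) T1 ⊗ T2 ⊗ T3 ⊗ (1 : H)))
    = (\tsum_(T1 ⊗ T2 ⊗ T3 := Phi_lambda_rho A)
        \tsum_(a ⊗ b := Delta T3) T1 ⊗ T2 ⊗ a ⊗ b)
      * (\tsum_(X1 ⊗ X2 ⊗ X3 := Phi_rho A)
          \tsum_(h ⊗ u := blambda X1) h ⊗ u ⊗ X2 ⊗ X3)
}.

(* The right comodule algebra A^2 over H^op ⊗ H.  The arguments of [Sinv] are
   multiplied in H, not in H^op. *)
Section ASquare.
Variables (k : fieldType) (H : quasi_hopf_data k) (A : bicomodule_algebra_data H).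
Local Notation Hop := (opposite_qb H).
Local Notation HopH := (tensor_qb (opposite_qb H) H).
Local Notation Sinv := (@antipode_inv k H).

Definition rho2 (u : A) : A ⊗ HopH :=
  \tsum_(v ⊗ u0 := blambda u) \tsum_(u00 ⊗ u01 := brho u0)
    u00 ⊗ ((Sinv v : Hop) ⊗ u01).

Definition Phi_rho2 : A ⊗ HopH ⊗ HopH :=
  \tsum_(x1 ⊗ x2 ⊗ x3 := inverse (Phi_lambda A))
  \tsum_(x30 ⊗ x31 := brho x3)
  \tsum_(x311 ⊗ x312 := Delta x31)
  \tsum_(X1 ⊗ X2 ⊗ X3 := Phi_rho A)
  \tsum_(T1 ⊗ T2 ⊗ T3 := Phi_lambda_rho A)
  \tsum_(T20 ⊗ T21 := brho T2)
  \tsum_(f1 ⊗ f2 := drinfeld_twist H)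
    (x30 * X1 * T20)
    ⊗ ((Sinv (f2 * x2 * T1) : Hop) ⊗ (x311 * X2 * T21))
    ⊗ ((Sinv (f1 * x1) : Hop) ⊗ (x312 * X3 * T3)).

Definition A2 : right_comodule_algebra_data HopH :=
  @RightComoduleAlgebraData k HopH A rho2 Phi_rho2.

End ASquare.

(** * Module coalgebras *)

Record bimodule_coalgebra_data (k : fieldType) (H : quasi_bialgebra_data k) :=
  BimoduleCoalgebraData {
    bmc_mod :> lmodType k;
    bmc_lact : H -> bmc_mod -> bmc_mod;
    bmc_ract : bmc_mod -> H -> bmc_mod;
    bmc_Delta : bmc_mod -> bmc_mod ⊗ bmc_mod;
    bmc_eps : bmc_mod -> k
  }.
Arguments bmc_lact {k H b}.
Arguments bmc_ract {k H b}.
Arguments bmc_Delta {k H b}.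
Arguments bmc_eps {k H b}.

Record is_bimodule_coalgebra (k : fieldType) (H : quasi_bialgebra_data k)
    (C : bimodule_coalgebra_data H) : Prop := {
  bmc_lactP : is_left_action (@bmc_lact k H C);
  bmc_ractP : is_right_action (@bmc_ract k H C);
  bmc_actA : forall (h h' : H) (c : C),
    bmc_ract (bmc_lact h c) h' = bmc_lact h (bmc_ract c h');
  bmc_Delta_linear : linear (@bmc_Delta k H C);
  bmc_eps_linear : scalar (@bmc_eps k H C);
  bmc_coassoc : forall c : C,
    (\tsum_(X1 ⊗ X2 ⊗ X3 := Phi H) \tsum_(x1 ⊗ x2 ⊗ x3 := inverse (Phi H))
      \tsum_(c1 ⊗ c2 := bmc_Delta c) \tsum_(c11 ⊗ c12 := bmc_Delta c1)
        bmc_ract (bmc_lact X1 c11) x1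
        ⊗ bmc_ract (bmc_lact X2 c12) x2
        ⊗ bmc_ract (bmc_lact X3 c2) x3)
    = \tsum_(c1 ⊗ c2 := bmc_Delta c) \tsum_(c21 ⊗ c22 := bmc_Delta c2)
        c1 ⊗ c21 ⊗ c22;
  bmc_Delta_lact : forall (h : H) (c : C),
    bmc_Delta (bmc_lact h c)
    = \tsum_(h1 ⊗ h2 := Delta h) \tsum_(c1 ⊗ c2 := bmc_Delta c)
        bmc_lact h1 c1 ⊗ bmc_lact h2 c2;
  bmc_Delta_ract : forall (c : C) (h : H),
    bmc_Delta (bmc_ract c h)
    = \tsum_(c1 ⊗ c2 := bmc_Delta c) \tsum_(h1 ⊗ h2 := Delta h)
        bmc_ract c1 h1 ⊗ bmc_ract c2 h2;
  bmc_counitl : forall c : C,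
    (\tsum_(c1 ⊗ c2 := bmc_Delta c) (bmc_eps c1 *: c2)) = c;
  bmc_counitr : forall c : C,
    (\tsum_(c1 ⊗ c2 := bmc_Delta c) (bmc_eps c2 *: c1)) = c;
  bmc_eps_lact : forall (h : H) (c : C), bmc_eps (bmc_lact h c) = eps h * bmc_eps c;
  bmc_eps_ract : forall (c : C) (h : H), bmc_eps (bmc_ract c h) = bmc_eps c * eps h
}.

Record left_module_coalgebra_data (k : fieldType) (H : quasi_bialgebra_data k) :=
  LeftModuleCoalgebraData {
    lmc_mod :> lmodType k;
    lmc_act : H -> lmc_mod -> lmc_mod;
    lmc_Delta : lmc_mod -> lmc_mod ⊗ lmc_mod;
    lmc_eps : lmc_mod -> k
  }.
Arguments lmc_act {k H l}.
Arguments lmc_Delta {k H l}.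
Arguments lmc_eps {k H l}.

Definition bimodule_as_left (k : fieldType) (H : quasi_bialgebra_data k)
    (C : bimodule_coalgebra_data H) :
    left_module_coalgebra_data (tensor_qb (opposite_qb H) H) :=
  @LeftModuleCoalgebraData k (tensor_qb (opposite_qb H) H) C
    (fun t c => \tsum_(h ⊗ h' := t) bmc_ract (bmc_lact h' c) h)
    bmc_Delta bmc_eps.

(** * Categories

   [small] is the universe of morphism sets; coproducts and diagrams are indexed
   by types of the same universe. *)

Definition small := Type.

Record category_on (ob : Type) := CategoryOn {
  hom_ : ob -> ob -> small;
  idm_ : forall x, hom_ x x;
  comp_ : forall x y z, hom_ y z -> hom_ x y -> hom_ x z;
  comp_idl_ : forall x y (f : hom_ x y), comp_ (idm_ y) f = f;
  comp_idr_ : forall x y (f : hom_ x y), comp_ f (idm_ x) = f;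
  comp_assoc_ : forall x y z w (h : hom_ z w) (g : hom_ y z) (f : hom_ x y),
    comp_ h (comp_ g f) = comp_ (comp_ h g) f
}.

Arguments comp_ {ob} c {x y z}.

Record category := Category {
  ob :> Type;
  cat_on : category_on ob
}.

Definition hom (C : category) : C -> C -> small := hom_ (cat_on C).
Definition idm (C : category) (x : C) : hom x x := idm_ (cat_on C) x.
Definition ccomp (C : category) (x y z : C) (g : hom y z) (f : hom x y) : hom x z :=
  comp_ (cat_on C) g f.
Notation "g ⊚ f" := (ccomp g f) (at level 40, left associativity).

Record functor (C D : category) := Functor {
  fob :> C -> D;
  fmap : forall x y : C, hom x y -> hom (fob x) (fob y);
  fmap_id : forall x, fmap (idm x) = idm (fob x);
  fmap_comp : forall x y z (g : hom y z) (f : hom x y),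
    fmap (g ⊚ f) = fmap g ⊚ fmap f
}.
Arguments fmap {C D} _ {x y} _.

Definition functor_id (C : category) : functor C C :=
  @Functor C C id (fun _ _ f => f) (fun _ => erefl) (fun _ _ _ _ _ => erefl).

Section FunctorComp.
Variables (C D E : category) (G : functor D E) (F : functor C D).
Fact functor_comp_id x : fmap G (fmap F (idm x)) = idm (G (F x)).
Proof. by rewrite !fmap_id. Qed.
Fact functor_comp_comp x y z (g : hom y z) (f : hom x y) :
  fmap G (fmap F (g ⊚ f)) = fmap G (fmap F g) ⊚ fmap G (fmap F f).
Proof. by rewrite !fmap_comp. Qed.
Definition functor_comp : functor C E :=
  @Functor C E (fun x => G (F x)) (fun x y f => fmap G (fmap F f))
    functor_comp_id functor_comp_comp.
End FunctorComp.

Definition isomorphic_categories (C D : category) : Prop :=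
  exists (F : functor C D) (G : functor D C),
    functor_comp G F = functor_id C /\ functor_comp F G = functor_id D.

Section Limits.
Variable C : category.

Definition mono (x y : C) (f : hom x y) : Prop :=
  forall w (g h : hom w x), f ⊚ g = f ⊚ h -> g = h.

Definition epi (x y : C) (f : hom x y) : Prop :=
  forall z (g h : hom y z), g ⊚ f = h ⊚ f -> g = h.

Definition zero_object (z : C) : Prop :=
  forall x, (exists! f : hom z x, True) /\ (exists! f : hom x z, True).

Definition is_coproduct (I : small) (X : I -> C) (P : C)
    (i : forall j, hom (X j) P) : Prop :=
  forall Y (u : forall j, hom (X j) Y), exists! h : hom P Y, forall j, h ⊚ i j = u j.

Definition natural (J : category) (F G : functor J C)
    (a : forall j, hom (F j) (G j)) : Prop :=
  forall i j (s : hom i j), fmap G s ⊚ a i = a j ⊚ fmap F s.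

Definition cocone (J : category) (F : functor J C) (L : C)
    (u : forall j, hom (F j) L) : Prop :=
  forall i j (s : hom i j), u j ⊚ fmap F s = u i.

Definition is_colimit (J : category) (F : functor J C) (L : C)
    (i : forall j, hom (F j) L) : Prop :=
  cocone i /\
  forall Y (u : forall j, hom (F j) Y), cocone u ->
    exists! h : hom L Y, forall j, h ⊚ i j = u j.

Definition is_generator (G : C) : Prop :=
  forall x y (f g : hom x y), (forall h : hom G x, f ⊚ h = g ⊚ h) -> f = g.

Definition injective_object (I : C) : Prop :=
  forall x y (f : hom x y), mono f ->
    forall g : hom x I, exists h : hom y I, h ⊚ f = g.

Definition enough_injectives : Prop :=
  forall x, exists (I : C) (f : hom x I), injective_object I /\ mono f.

End Limits.

Definition filtered (J : category) : Prop :=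
  [/\ inhabited J,
      forall i j : J, exists l, inhabited (hom i l) /\ inhabited (hom j l)
    & forall (i j : J) (s t : hom i j), exists l (r : hom j l), r ⊚ s = r ⊚ t].

(** * Abelian and Grothendieck categories *)

Record preadditive (C : category) := Preadditive {
  hadd : forall x y : C, hom x y -> hom x y -> hom x y;
  hzero : forall x y : C, hom x y;
  hopp : forall x y : C, hom x y -> hom x y;
  haddA : forall x y, associative (@hadd x y);
  haddC : forall x y, commutative (@hadd x y);
  hadd0 : forall x y, left_id (hzero x y) (@hadd x y);
  haddN : forall x y, left_inverse (hzero x y) (@hopp x y) (@hadd x y);
  comp_addl : forall x y z (g g' : hom y z) (f : hom x y),
    hadd g g' ⊚ f = hadd (g ⊚ f) (g' ⊚ f);
  comp_addr : forall x y z (g : hom y z) (f f' : hom x y),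
    g ⊚ hadd f f' = hadd (g ⊚ f) (g ⊚ f')
}.
Arguments hadd {C} p {x y}.
Arguments hzero {C} p {x y}.

Section Abelian.
Variables (C : category) (P : preadditive C).

Definition is_kernel (x y z : C) (f : hom x y) (i : hom z x) : Prop :=
  f ⊚ i = hzero P /\
  forall w (g : hom w x), f ⊚ g = hzero P -> exists! u : hom w z, i ⊚ u = g.

Definition is_cokernel (x y z : C) (f : hom x y) (p : hom y z) : Prop :=
  p ⊚ f = hzero P /\
  forall w (g : hom y w), g ⊚ f = hzero P -> exists! u : hom z w, u ⊚ p = g.

Definition is_biproduct (x y b : C) (i1 : hom x b) (i2 : hom y b)
    (p1 : hom b x) (p2 : hom b y) : Prop :=
  [/\ p1 ⊚ i1 = idm x, p2 ⊚ i2 = idm y, p1 ⊚ i2 = hzero P, p2 ⊚ i1 = hzero P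
    & hadd P (i1 ⊚ p1) (i2 ⊚ p2) = idm b].

Record abelian : Prop := {
  ab_zero : exists z : C, zero_object z;
  ab_biproduct : forall x y : C, exists b i1 i2 p1 p2, @is_biproduct x y b i1 i2 p1 p2;
  ab_kernel : forall (x y : C) (f : hom x y), exists z (i : hom z x), is_kernel f i;
  ab_cokernel : forall (x y : C) (f : hom x y), exists z (p : hom y z), is_cokernel f p;
  ab_mono : forall (x y : C) (f : hom x y), mono f ->
    exists z (g : hom y z), is_kernel g f;
  ab_epi : forall (x y : C) (f : hom x y), epi f ->
    exists z (g : hom z x), is_cokernel g f
}.

Definition short_exact (x y z : C) (f : hom x y) (g : hom y z) : Prop :=
  is_kernel g f /\ is_cokernel f g.

Definition has_small_coproducts : Prop :=
  forall (I : small) (X : I -> C),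
    exists Q (i : forall j, hom (X j) Q), is_coproduct i.

Definition exact_filtered_colimits : Prop :=
  forall (I : small) (Jon : category_on I) (J := Category Jon), filtered J ->
  forall (F G K : functor J C)
    (a : forall j, hom (F j) (G j)) (b : forall j, hom (G j) (K j)),
    natural a -> natural b -> (forall j, short_exact (a j) (b j)) ->
  forall (LF LG LK : C) (iF : forall j, hom (F j) LF) (iG : forall j, hom (G j) LG)
    (iK : forall j, hom (K j) LK),
    is_colimit iF -> is_colimit iG -> is_colimit iK ->
  forall (la : hom LF LG) (lb : hom LG LK),
    (forall j, la ⊚ iF j = iG j ⊚ a j) -> (forall j, lb ⊚ iG j = iK j ⊚ b j) ->
    short_exact la lb.

End Abelian.

Definition grothendieck (C : category) : Prop :=
  exists P : preadditive C,
    [/\ abelian P, has_small_coproducts C, exact_filtered_colimits P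
      & exists G : C, is_generator G].

(** * Hopf modules and Yetter-Drinfeld modules *)

Section ModuleMaps.
Variables (k : fieldType) (A : kalgType k) (C : lmodType k).

(* An A-action and a C-coaction, with no compatibility. *)
Record act_coact := ActCoact {
  ac_mod :> lmodType k;
  ac_act : A -> ac_mod -> ac_mod;
  ac_coact : ac_mod -> ac_mod ⊗ C
}.

Definition is_linear_colinear (M N : act_coact) (f : M -> N) : Prop :=
  [/\ linear f,
      forall a m, f (ac_act a m) = ac_act a (f m)
    & forall m, ac_coact (f m) = \tsum_(m0 ⊗ m1 := ac_coact m) f m0 ⊗ m1].

Definition ac_hom (M N : act_coact) := {f : M -> N | is_linear_colinear f}.

Lemma ac_hom_ext (M N : act_coact) (f g : ac_hom M N) : sval f = sval g -> f = g.
Proof. by case: f g => [f fP] [g gP] /= fg; apply: eq_exist. Qed.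

Fact linear_colinear_id M : is_linear_colinear (fun m : ac_mod M => m).
Proof. by split=> // m; apply: tpureE. Qed.

Fact linear_colinear_comp (M N Q : act_coact) (g : N -> Q) (f : M -> N) :
  is_linear_colinear g -> is_linear_colinear f ->
  is_linear_colinear (fun m => g (f m)).
Proof.
move=> [gl gA gC] [fl fA fC]; split=> [a x y|a m|m].
- by rewrite fl gl.
- by rewrite fA gA.
have [pl pr] := tpure_bilinear Q C.
have gb : is_bilinear (fun m0 m1 => g m0 ⊗ m1 : Q ⊗ C).
  by split=> [w a x y|v a x y]; rewrite ?gl ?pl ?pr.
by rewrite gC fC (linear_tsum _ _ (tsum_linear gb)); apply: eq_tsum => v w;
  rewrite tsum_pure.
Qed.

Definition ac_id (M : act_coact) : ac_hom M M :=
  exist _ (fun m => m) (linear_colinear_id M).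
Definition ac_comp (M N Q : act_coact) (g : ac_hom N Q) (f : ac_hom M N) :
    ac_hom M Q :=
  exist _ (fun m => sval g (sval f m))
    (linear_colinear_comp (proj2_sig g) (proj2_sig f)).

Fact ac_comp_idl (M N : act_coact) (f : ac_hom M N) : ac_comp (ac_id N) f = f.
Proof. exact: ac_hom_ext. Qed.
Fact ac_comp_idr (M N : act_coact) (f : ac_hom M N) : ac_comp f (ac_id M) = f.
Proof. exact: ac_hom_ext. Qed.
Fact ac_comp_assoc (M N Q R : act_coact) (h : ac_hom Q R) (g : ac_hom N Q)
  (f : ac_hom M N) : ac_comp h (ac_comp g f) = ac_comp (ac_comp h g) f.
Proof. exact: ac_hom_ext. Qed.

(* The category with the given objects and all A-linear C-colinear maps. *)
Definition ac_category (ob : Type) (U : ob -> act_coact) : category :=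
  @Category ob (@CategoryOn ob (fun M N => ac_hom (U M) (U N))
    (fun M => ac_id (U M)) (fun M N Q => @ac_comp (U M) (U N) (U Q))
    (fun M N => @ac_comp_idl (U M) (U N)) (fun M N => @ac_comp_idr (U M) (U N))
    (fun M N Q R => @ac_comp_assoc (U M) (U N) (U Q) (U R))).

End ModuleMaps.

Section HopfModules.
Variables (k : fieldType) (H : quasi_bialgebra_data k).
Variables (A : right_comodule_algebra_data H) (C : left_module_coalgebra_data H).

Record is_hopf_module (M : act_coact A C) : Prop := {
  hm_act : is_left_action (@ac_act k A C M);
  hm_coact_linear : linear (@ac_coact k A C M);
  hm_coassoc : forall m : M,
    (\tsum_(X1 ⊗ X2 ⊗ X3 := rPhi A)
      \tsum_(m0 ⊗ m1 := ac_coact m) \tsum_(m00 ⊗ m01 := ac_coact m0)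
        ac_act X1 m00 ⊗ lmc_act X2 m01 ⊗ lmc_act X3 m1)
    = \tsum_(m0 ⊗ m1 := ac_coact m) \tsum_(c1 ⊗ c2 := lmc_Delta m1) m0 ⊗ c1 ⊗ c2;
  hm_counit : forall m : M,
    (\tsum_(m0 ⊗ m1 := ac_coact m) (lmc_eps m1 *: m0)) = m;
  hm_compat : forall (a : A) (m : M),
    ac_coact (ac_act a m)
    = \tsum_(a0 ⊗ a1 := rcoact a) \tsum_(m0 ⊗ m1 := ac_coact m)
        ac_act a0 m0 ⊗ lmc_act a1 m1
}.

Definition hopf_module := {M : act_coact A C | is_hopf_module M}.
Definition hopf_modules : category := ac_category (fun M : hopf_module => sval M).

End HopfModules.

Section YetterDrinfeldModules.
Variables (k : fieldType) (H : quasi_bialgebra_data k).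
Variables (A : bicomodule_algebra_data H) (C : bimodule_coalgebra_data H).

Record is_yetter_drinfeld (M : act_coact A C) : Prop := {
  yd_act : is_left_action (@ac_act k A C M);
  yd_coact_linear : linear (@ac_coact k A C M);
  yd_counit : forall m : M,
    (\tsum_(m0 ⊗ m1 := ac_coact m) (bmc_eps m1 *: m0)) = m;
  yd_coassoc : forall m : M,
    (\tsum_(t1 ⊗ t2 ⊗ t3 := inverse (Phi_lambda_rho A))
      \tsum_(m0 ⊗ m1 := ac_coact m) \tsum_(n0 ⊗ n1 := ac_coact (ac_act t2 m0))
        n0 ⊗ bmc_ract n1 t1 ⊗ bmc_lact t3 m1)
    = \tsum_(y1 ⊗ y2 ⊗ y3 := inverse (Phi_rho A))
      \tsum_(x1 ⊗ x2 ⊗ x3 := inverse (Phi_lambda A))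
      \tsum_(n0 ⊗ n1 := ac_coact (ac_act x3 m)) \tsum_(c1 ⊗ c2 := bmc_Delta n1)
        ac_act y1 n0
        ⊗ bmc_ract (bmc_lact y2 c1) x1
        ⊗ bmc_ract (bmc_lact y3 c2) x2;
  yd_compat : forall (u : A) (m : M),
    (\tsum_(u0 ⊗ u1 := brho u) \tsum_(m0 ⊗ m1 := ac_coact m)
      ac_act u0 m0 ⊗ bmc_lact u1 m1)
    = \tsum_(v ⊗ u0 := blambda u) \tsum_(n0 ⊗ n1 := ac_coact (ac_act u0 m))
        n0 ⊗ bmc_ract n1 v
}.

Definition yd_module := {M : act_coact A C | is_yetter_drinfeld M}.
Definition yd_modules : category := ac_category (fun M : yd_module => sval M).

End YetterDrinfeldModules.

(* Main.v *)
(* The coaction of a Yetter-Drinfeld module M is replaced by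
   m ↦ (p² m)_(0) ⊗ (p² m)_(1) p¹, where p = X² S⁻¹(X¹ β) ⊗ X³ is built from
   X = Φ_λ.  The inverse assignment uses q = S(x¹) α x² ⊗ x³ with x = Φ_λ⁻¹,
   because λ(q²) p (S⁻¹(q¹) ⊗ 1) = 1 and (S(p¹) ⊗ 1) q λ(p²) = 1; and p
   commutes with the algebra up to λ, which matches the two compatibility axioms.  For the two
   coassociativity axioms one needs (Δ ⊗ id)(p) in terms of p, Φ_λ and the Drinfeld
   twist f.  As h ↦ Δ(S h) and h ↦ (S ⊗ S)(Δ^cop h) are both antipodes for the
   algebra map Δ, they are intertwined by a unique invertible element, which is f;
   in particular f is invertible and Δ(β) = δ f for Drinfeld's element δ.

   For the second part, a coaction of C amounts to the operators (id ⊗ ξ)ρ with ξ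
   in C^*, so that Yetter-Drinfeld modules are vector spaces with operators, and
   they are closed under subobjects, quotients and direct sums.  Hence kernels,
   cokernels and filtered colimits are computed on vector spaces.  The coproduct of
   all objects generated by one element is a generator, and every object embeds
   into an injective one, given by the right adjoint of the forgetful functor to
   vector spaces. *)

From HB Require Import structures.
From mathcomp Require Import all_boot all_algebra.
From mathcomp Require Import generic_quotient boolp classical_sets.
From Stdlib Require Import JMeq Eqdep.
From Stdlib Require List.
Require Import Defs.

Set Implicit Arguments.
Unset Strict Implicit.
Unset Printing Implicit Defensive.

Import GRing.Theory.
Local Open Scope ring_scope.

(** * Linear maps on tensor products *)

(* One device carries most of the Hopf-algebraic half: a contraction that inserts α or β between
   tensor factors replaces a comultiplication by a counit. Applied to a pentagon it erases all
   factors but the wanted ones, since the reassociators have trivial counits. The obstacle is to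
   show that (S ⊗ S)Δ^cop with γ and δ satisfies the two reassociator axioms of an antipode along Δ.
   Both come from a five-factor consequence of the pentagon, stated for any left comodule algebra B
   and taken at B = H. The same consequence for the given bicomodule algebra then yields (Δ ⊗
   id)(p), once the twist is available. The two coassociativity axioms are values of the same pair
   of functions on H ⊗ H ⊗ A at different arguments, namely 1 and w = (id ⊗ λ)(p)(1 ⊗ p). Both
   functions are equivariant for λ, and q undoes the multiplication by w, so that one equality
   yields the other. In the categorical half a filtered colimit is known only by its universal
   property. Its elements become accessible through test objects, namely quotients of the colimit
   and of a coproduct of the stages. *)
Create HintDb lin.

Section Linear.
Variable k : fieldType.
Implicit Types U V W : lmodType k.

Lemma lin_id V : linear (fun x : V => x). Proof. by []. Qed.

Lemma lin_comp U V W (f : V -> W) (g : U -> V) :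
  linear f -> linear g -> linear (fun x => f (g x)).
Proof. by move=> fl gl a x y; rewrite gl fl. Qed.

Lemma lin_add U V (f g : U -> V) :
  linear f -> linear g -> linear (fun x => f x + g x).
Proof. by move=> fl gl a x y; rewrite fl gl scalerDr addrACA. Qed.

Lemma lin_opp U V (f : U -> V) : linear f -> linear (fun x => - f x).
Proof. by move=> fl a x y; rewrite fl opprD scalerN. Qed.

Lemma lin_scale U V (b : k) (f : U -> V) : linear f -> linear (fun x => b *: f x).
Proof. by move=> fl a x y; rewrite fl scalerDr !scalerA mulrC. Qed.

Lemma lin_scalel U V (f : U -> k) (v : V) : scalar f -> linear (fun x => f x *: v).
Proof. by move=> fl a x y; rewrite fl scalerDl scalerA. Qed.

Lemma lin_zero U V : linear (fun _ : U => 0 : V).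
Proof. by move=> a x y; rewrite scaler0 addr0. Qed.

Lemma lin_mulr U (A : kalgType k) (b : A) (f : U -> A) :
  linear f -> linear (fun x => f x * b).
Proof. by move=> fl; exact: (@lin_comp _ A A (fun y => y * b) f (mulr_lin b) fl). Qed.

Lemma lin_mull U (A : kalgType k) (b : A) (f : U -> A) :
  linear f -> linear (fun x => b * f x).
Proof. by move=> fl; exact: (@lin_comp _ A A (fun y => b * y) f (mull_lin b) fl). Qed.

Lemma lin_tl U V W (f : U -> V) (w : W) : linear f -> linear (fun x => f x ⊗ w).
Proof.
have [pl _] := tpure_bilinear V W; move=> fl.
exact: (@lin_comp _ V _ (fun y => y ⊗ w) f (pl w) fl).
Qed.

Lemma lin_tr U V W (v : V) (f : U -> W) : linear f -> linear (fun x => v ⊗ f x).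
Proof.
have [_ pr] := tpure_bilinear V W; move=> fl.
exact: (@lin_comp _ W _ (fun y => v ⊗ y) f (pr v) fl).
Qed.

Lemma lin_tsum U V W W' (f : U -> V ⊗ W) (F : V -> W -> W') :
  linear f -> is_bilinear F -> linear (fun x => tsum (f x) F).
Proof.
move=> fl Fb.
exact: (@lin_comp _ (V ⊗ W)%type W' (fun t => tsum t F) f (tsum_linear Fb) fl).
Qed.

Lemma lin_tsum_body U V W W' (t : V ⊗ W) (F : U -> V -> W -> W') :
  (forall v w, linear (fun x => F x v w)) -> linear (fun x => tsum t (F x)).
Proof.
move=> Fl a x y; rewrite /tsum scaler_sumr -big_split /=.
by apply: eq_bigr => p _; apply: Fl.
Qed.

Lemma lin_bil1 U V W W' (F : V -> W -> W') (f : U -> V) w :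
  is_bilinear F -> linear f -> linear (fun x => F (f x) w).
Proof. by case=> Fl _ fl; exact: (@lin_comp _ V W' (fun v => F v w) f (Fl w) fl). Qed.

Lemma scalar_comp U V (f : V -> k) (g : U -> V) :
  scalar f -> linear g -> scalar (fun x => f (g x)).
Proof. by move=> fl gl a x y; rewrite gl fl. Qed.

Lemma lin0 U V (f : U -> V) : linear f -> f 0 = 0.
Proof. by move=> fl; have := fl (-1) 0 0; rewrite scaler0 addr0 scaleN1r addNr. Qed.

Lemma linD U V (f : U -> V) : linear f -> {morph f : x y / x + y}.
Proof. by move=> fl x y; have := fl 1 x y; rewrite !scale1r. Qed.

Lemma linZ U V (f : U -> V) : linear f -> forall a, {morph f : x / a *: x}.
Proof. by move=> fl a x; have := fl a x 0; rewrite !addr0 lin0 // addr0. Qed.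

Lemma tensor_ext V W U (f g : V ⊗ W -> U) : linear f -> linear g ->
  (forall v w, f (v ⊗ w) = g (v ⊗ w)) -> forall t, f t = g t.
Proof.
move=> fl gl fg; apply: tensor_ind => [|s t fgs fgt|//].
  by rewrite !lin0.
by rewrite !linD // fgs fgt.
Qed.

End Linear.

(** * Tensor products of algebras

   [A ⊠ B] and [a ⊠ b] are [A ⊗ B] and [a ⊗ b], typed so that the algebraic
   structure of an iterated tensor product is always reached through [kalgType]:
   the two paths are convertible, but comparing them is exponential in the number
   of tensor factors. *)

Definition ktensor (k : fieldType) (A B : kalgType k) : kalgType k := (A ⊗ B)%type.
Definition kpure (k : fieldType) (A B : kalgType k) (a : A) (b : B) : ktensor A B :=
  a ⊗ b.
Arguments ktensor {k} (A B)%_type_scope.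
Notation "A ⊠ B" := (ktensor A B) (at level 42, right associativity) : type_scope.
Notation "a ⊠ b" := (kpure a b) (at level 42, right associativity) : ring_scope.

Section KTensor.
Variable k : fieldType.
Implicit Types (A B C : kalgType k) (U V W : lmodType k).

Lemma kpure_bilinear A B : is_bilinear (@kpure k A B).
Proof. exact: tpure_bilinear. Qed.

Lemma lin_kl V A B (f : V -> A) (w : B) : linear f -> linear (fun x => f x ⊠ w).
Proof.
have [pl _] := kpure_bilinear A B; move=> fl.
exact: (@lin_comp _ _ A _ (fun y => y ⊠ w) f (pl w) fl).
Qed.

Lemma lin_kr V A B (v : A) (f : V -> B) : linear f -> linear (fun x => v ⊠ f x).
Proof.
have [_ pr] := kpure_bilinear A B; move=> fl.
exact: (@lin_comp _ _ B _ (fun y => v ⊠ y) f (pr v) fl).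
Qed.

Lemma lin_ksum V A B W (f : V -> (A ⊠ B)%type) (F : A -> B -> W) :
  linear f -> is_bilinear F -> linear (fun x => tsum (f x) F).
Proof. exact: lin_tsum. Qed.

Lemma ktensor_ext A B U (f g : (A ⊠ B)%type -> U) : linear f -> linear g ->
  (forall a b, f (a ⊠ b) = g (a ⊠ b)) -> forall t, f t = g t.
Proof. exact: tensor_ext. Qed.

Lemma ksum_pureL A B U (F : A -> B -> U) a b : is_bilinear F ->
  tsum (a ⊠ b) F = F a b.
Proof. exact: tsum_pure. Qed.

Lemma ksum_pureK A B C (F : A -> B -> C) a b : is_bilinear F ->
  tsum (a ⊠ b) F = F a b.
Proof. exact: tsum_pure. Qed.

Lemma kmulE A B (a c : A) (b d : B) : (a ⊠ b) * (c ⊠ d) = (a * c) ⊠ (b * d).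
Proof. exact: tmul_pure. Qed.

Lemma koneE A B : 1 = 1 ⊠ 1 :> (A ⊠ B)%type.
Proof. by []. Qed.

Lemma kpureZl A B a (v : A) (w : B) : (a *: v) ⊠ w = a *: (v ⊠ w).
Proof. by have [pl _] := kpure_bilinear A B; exact: (linZ (pl w)). Qed.

Lemma kpureZr A B a (v : A) (w : B) : v ⊠ (a *: w) = a *: (v ⊠ w).
Proof. by have [_ pr] := kpure_bilinear A B; exact: (linZ (pr v)). Qed.

Lemma kpure_tsumr A B V W (t : V ⊗ W) (F : V -> W -> B) (a : A) :
  a ⊠ tsum t F = tsum t (fun v w => a ⊠ F v w).
Proof. by have [_ pr] := kpure_bilinear A B; rewrite -(linear_tsum _ _ (pr a)). Qed.

Lemma kscalerAl A a (x y : A) : (a *: x) * y = a *: (x * y).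
Proof. by rewrite [in RHS]kscaleAl. Qed.

Lemma kscalerAr A a (x y : A) : x * (a *: y) = a *: (x * y).
Proof. by rewrite [in RHS]kscaleAr. Qed.

End KTensor.

Definition ksum_pure := (ksum_pureK, ksum_pureL).
Definition kE := (kpureZl, kpureZr, kscalerAl, kscalerAr).

(** The order of the clauses matters: a sum over a tensor free of [x] only needs a summand linear in
    [x], whereas a tensor that depends on [x] requires a bilinear summand. *)
Ltac lin_step :=
  match goal with
  | |- is_bilinear _ => split; intro; cbv beta
  | |- linear (fun x => x) => exact: lin_id
  | |- linear (fun x => tsum ?t (@?G x)) =>
      apply: (@lin_tsum_body _ _ _ _ _ t G); intros; cbv beta
  | |- linear (fun x => @tsum _ _ _ _ (@?F x) ?G) =>
      first [apply: (@lin_ksum _ _ _ _ _ F G) | apply: (@lin_tsum _ _ _ _ _ F G)]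
  | |- linear (fun x => @?F x + @?G x) => apply: (@lin_add _ _ _ F G)
  | |- linear (fun x => - @?F x) => apply: (@lin_opp _ _ _ F)
  | |- linear (fun x => ?b *: @?F x) => apply: (@lin_scale _ _ _ b F)
  | |- linear (fun x => @?F x *: ?v) => apply: (@lin_scalel _ _ _ F v)
  | |- linear (fun x => @?F x * ?v) => apply: (@lin_mulr _ _ _ v F)
  | |- linear (fun x => ?v * @?F x) => apply: (@lin_mull _ _ _ v F)
  | |- linear (fun x => @?F x ⊠ ?v) => apply: (@lin_kl _ _ _ _ F v)
  | |- linear (fun x => ?v ⊠ @?F x) => apply: (@lin_kr _ _ _ _ v F)
  | |- linear (fun x => @?F x ⊗ ?v) => apply: (@lin_tl _ _ _ _ F v)
  | |- linear (fun x => ?v ⊗ @?F x) => apply: (@lin_tr _ _ _ _ v F)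
  | |- linear (fun x => ?f x) => solve [eauto with lin]
  | |- linear (fun x => ?f (@?F x)) =>
      apply: (@lin_comp _ _ _ _ f F); [solve [eauto with lin]|]
  | |- linear (fun x => ?f (@?F x) ?w) =>
      apply: (@lin_bil1 _ _ _ _ _ f F w); [solve [eauto with lin]|]
  | |- linear ?f => solve [eauto with lin]
  | |- scalar (fun x => ?f x) => solve [eauto with lin]
  | |- scalar (fun x => ?f (@?F x)) =>
      apply: (@scalar_comp _ _ _ f F); [solve [eauto with lin]|]
  end.
Ltac lin := intros; cbv beta; repeat lin_step.

(* Reduces an equation linear in [t] to the case of a pure tensor [v ⊗ w]. *)
Tactic Notation "tind" hyp(t) "as" ident(v) ident(w) :=
  pattern t;
  match goal with |- (fun y => @?L y = @?R y) _ =>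
    revert t;
    first [ refine (@ktensor_ext _ _ _ _ L R _ _ _)
          | refine (@tensor_ext _ _ _ _ L R _ _ _)];
    cbv beta; [lin|lin|intros v w]
  end.

Section Morphisms.
Variable k : fieldType.
Implicit Types A B C D : kalgType k.

Record amor A B := Amor { amf :> A -> B; amP : is_algebra_map amf }.

Arguments amor (A B)%_type_scope.

Lemma am_lin A B (f : amor A B) : linear f. Proof. by have [] := amP f. Qed.
Lemma am1 A B (f : amor A B) : f 1 = 1.
Proof. by have [_ []] := amP f. Qed.
Lemma amM A B (f : amor A B) : {morph f : x y / x * y}.
Proof. by have [_ []] := amP f. Qed.
Lemma amZ A B (f : amor A B) a : {morph f : x / a *: x}.
Proof. exact/linZ/am_lin. Qed.
Hint Extern 0 (GRing.linear_for _ (amf _)) => exact: am_lin : lin.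

Fact am_id_subproof A : is_algebra_map (fun x : A => x).
Proof. by []. Qed.
Definition am_id A := Amor (am_id_subproof A).

Fact am_comp_subproof A B C (f : amor B C) (g : amor A B) :
  is_algebra_map (fun x => f (g x)).
Proof. by split; [lin | split=> [|x y]; rewrite ?am1 ?amM]. Qed.
Definition am_comp A B C f g := Amor (@am_comp_subproof A B C f g).

Lemma am_compE A B C (f : amor B C) (g : amor A B) x : am_comp f g x = f (g x).
Proof. by []. Qed.

Fact am_tmap_subproof A A' B B' (f : amor A A') (g : amor B B') :
  is_algebra_map (fun t : (A ⊠ B)%type =>
    \tsum_(a ⊗ b := t) f a ⊠ g b : (A' ⊠ B')%type).
Proof.
split; first by lin.
split=> [|s t]; first by rewrite ksum_pure ?am1 //; lin.
tind s as a b; tind t as c d.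
by rewrite !kmulE !ksum_pure ?amM ?kmulE //; lin.
Qed.
Definition am_tmap A A' B B' f g := Amor (@am_tmap_subproof A A' B B' f g).

Lemma am_tmapE A A' B B' (f : amor A A') (g : amor B B') a b :
  am_tmap f g (a ⊠ b) = f a ⊠ g b.
Proof. by rewrite [LHS]ksum_pure //; lin. Qed.

Definition kassoc A B C (t : ((A ⊠ B) ⊠ C)%type) : (A ⊠ B ⊠ C)%type :=
  \tsum_(s ⊗ w := t) \tsum_(u ⊗ v := s) u ⊠ v ⊠ w.

Lemma kassoc_pure A B C (u : A) (v : B) (w : C) :
  kassoc ((u ⊠ v) ⊠ w) = u ⊠ v ⊠ w.
Proof. by rewrite /kassoc !ksum_pure //; lin. Qed.

Fact am_assoc_subproof A B C : is_algebra_map (@kassoc A B C).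
Proof.
have tl : linear (@kassoc A B C) by rewrite /kassoc; lin.
split=> //; split=> [|s t]; first by rewrite [LHS]kassoc_pure.
tind s as x c; tind t as x' c'; tind x as a b; tind x' as a' b'.
by rewrite !kmulE !kassoc_pure !kmulE.
Qed.
Definition am_assoc A B C := Amor (@am_assoc_subproof A B C).
Arguments am_assoc {A B C}.

Lemma am_assocE A B C (a : A) (b : B) (c : C) :
  am_assoc ((a ⊠ b) ⊠ c) = a ⊠ b ⊠ c.
Proof. exact: kassoc_pure. Qed.

Fact am_sh_subproof A B : is_algebra_map (fun b : B => 1 ⊠ b : (A ⊠ B)%type).
Proof. by split; [lin | split=> [|x y] //; rewrite kmulE mulr1]. Qed.
Definition am_sh A B := Amor (@am_sh_subproof A B).
Arguments am_sh {A B}.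

Fact am_in_subproof A B : is_algebra_map (fun a : A => a ⊠ 1 : (A ⊠ B)%type).
Proof. by split; [lin | split=> [|x y] //; rewrite kmulE mulr1]. Qed.
Definition am_in A B := Amor (@am_in_subproof A B).
Arguments am_in {A B}.

Definition i2 A B B' (g : amor B B') : amor (A ⊠ B)%type (A ⊠ B')%type :=
  am_tmap (am_id A) g.
Arguments i2 {A B B'} g.

Lemma i2E A B B' (g : amor B B') (a : A) b : i2 g (a ⊠ b) = a ⊠ g b.
Proof. exact: am_tmapE. Qed.

Definition am_ext A B C D : amor (A ⊠ B ⊠ C)%type (A ⊠ B ⊠ C ⊠ D)%type :=
  i2 (i2 am_in).
Arguments am_ext {A B C D}.

Lemma am_extE A B C D (a : A) (b : B) (c : C) :
  am_ext (a ⊠ b ⊠ c) = a ⊠ b ⊠ c ⊠ (1 : D).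
Proof. by rewrite /am_ext !i2E. Qed.

Definition am_l A B C D (f : amor A (B ⊠ C)%type) :
    amor (A ⊠ D)%type (B ⊠ C ⊠ D)%type :=
  am_comp am_assoc (am_tmap f (am_id D)).
Arguments am_l {A B C D} f.

Lemma am_lE A B C D (f : amor A (B ⊠ C)%type) (a : A) (d : D) :
  am_l f (a ⊠ d) = am_assoc (f a ⊠ d).
Proof. by rewrite /am_l am_compE am_tmapE. Qed.

Lemma am_shE A B (b : B) : am_sh b = 1 ⊠ b :> (A ⊠ B)%type. Proof. by []. Qed.
Lemma am_inE A B (a : A) : am_in a = a ⊠ 1 :> (A ⊠ B)%type. Proof. by []. Qed.

End Morphisms.

Arguments amor {k} (A B)%_type_scope.
Arguments am_assoc {k A B C}.
Arguments am_sh {k A B}.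
Arguments am_in {k A B}.
Arguments i2 {k A B B'} g.
Arguments am_ext {k A B C D}.
Arguments am_l {k A B C D} f.

Definition amE :=
  (am_compE, am_shE, am_inE, i2E, am_extE, am_lE, am_assocE, am_tmapE).

Hint Extern 0 (GRing.linear_for _ (amf _)) => exact: am_lin : lin.

Lemma inverseP (R : pzRingType) (x : R) : invertible x ->
  x * inverse x = 1 /\ inverse x * x = 1.
Proof. by case=> y yP; rewrite /inverse; case: xgetP => [z -> []|/(_ y)]. Qed.

(** * Contractions with the antipode *)

Section QuasiHopf.
Variables (k : fieldType) (H : quasi_hopf_data k) (hH : is_quasi_hopf H).
Implicit Types V W : kalgType k.
Local Notation S := (@antipode k H).
Local Notation Sinv := (@antipode_inv k H).
Local Notation α := (qh_alpha H).
Local Notation β := (qh_beta H).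
Let hQ := qh_quasi_bialgebra hH.

Definition am_Delta : amor H (H ⊠ H)%type := Amor (qb_Delta_alg hQ).
Local Notation Δ := am_Delta.
Local Notation D1 := (am_l Δ).

Lemma lin_S : linear S. Proof. exact: qh_S_linear. Qed.
Lemma SM x y : S (x * y) = S y * S x. Proof. exact: qh_S_mul. Qed.
Lemma S1 : S 1 = 1. Proof. exact: qh_S_one. Qed.
Lemma SK : cancel S Sinv. Proof. exact: qh_S_invl. Qed.
Lemma SinvK : cancel Sinv S. Proof. exact: qh_S_invr. Qed.
Lemma lin_Sinv : linear Sinv.
Proof. by move=> a x y; apply: (can_inj SK); rewrite lin_S !SinvK. Qed.
Lemma SinvM x y : Sinv (x * y) = Sinv y * Sinv x.
Proof. by apply: (can_inj SK); rewrite SM !SinvK. Qed.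
Lemma Sinv1 : Sinv 1 = 1.
Proof. by apply: (can_inj SK); rewrite SinvK S1. Qed.
Hint Extern 0 (GRing.linear_for _ (@antipode _ _)) => exact: lin_S : lin.
Hint Extern 0 (GRing.linear_for _ (@antipode_inv _ _)) => exact: lin_Sinv : lin.

Lemma lin_eps : scalar (@eps k H). Proof. by have [] := qb_eps_alg hQ. Qed.
Lemma epsM (x y : H) : eps (x * y) = eps x * eps y.
Proof. by have [_ []] := qb_eps_alg hQ. Qed.
Lemma eps1 : eps (1 : H) = 1. Proof. by have [_ []] := qb_eps_alg hQ. Qed.
Lemma epsZ a (x : H) : eps (a *: x) = a * eps x.
Proof.
have e0 : eps (0 : H) = 0.
  have := lin_eps (-1) 0 0; rewrite scaler0 addr0 => ->.
  by rewrite mulN1r addNr.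
by have := lin_eps a x 0; rewrite e0 !addr0.
Qed.
Hint Extern 0 (GRing.linear_for _ (@eps _ _)) => exact: lin_eps : lin.

Lemma eps_Sinv h : eps (Sinv h) = eps h.
Proof. by rewrite -[RHS]/(eps h) -{2}[h]SinvK qh_eps_antipode. Qed.

Fact epl_subproof V :
  is_algebra_map (fun t : H ⊠ V => \tsum_(h ⊗ v := t) eps h *: v).
Proof.
split; first by lin.
split=> [|s t]; first by rewrite ksum_pure ?eps1 ?scale1r //; lin.
tind s as h v; tind t as h' v'.
by rewrite kmulE !ksum_pure ?epsM ?kscalerAl ?kscalerAr ?scalerA //; lin.
Qed.
Definition epl V := Amor (@epl_subproof V).
Arguments epl {V}.
Lemma eplE V h (v : V) : epl (h ⊠ v) = eps h *: v.
Proof. by rewrite [LHS]ksum_pure //; lin. Qed.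

(* [ε ⊠ 1 ⊠ 1] in place of [Δ]: what remains of [am_l Δ] after a contraction of
   the two legs of [Δ] against α or β. *)
Definition cl V : amor (H ⊠ V)%type (H ⊠ H ⊠ V)%type :=
  am_comp am_sh (am_comp am_sh epl).
Arguments cl {V}.
Lemma clE V h (v : V) : cl (h ⊠ v) = eps h *: (1 ⊠ 1 ⊠ v : H ⊠ H ⊠ V).
Proof. by rewrite !amE eplE !kpureZr. Qed.

Lemma alphaP h : \tsum_(a ⊗ b := Δ h) (S a * α * b) = eps h *: α.
Proof. exact: qh_alphaP. Qed.
Lemma betaP h : \tsum_(a ⊗ b := Δ h) (a * β * S b) = eps h *: β.
Proof. exact: qh_betaP. Qed.
(** This is the β-axiom seen through S⁻¹, which reverses products; it is the form met in p, where β
    occurs as S⁻¹(X¹ β) = S⁻¹(β) S⁻¹(X¹). *)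
Lemma betaPinv h : \tsum_(a ⊗ b := Δ h) (b * Sinv β * Sinv a) = eps h *: Sinv β.
Proof.
apply: (can_inj SK); rewrite linZ; last by lin.
rewrite SinvK -betaP linear_tsum; last exact: lin_S.
by apply: eq_tsum => a b; rewrite !SM !SinvK mulrA.
Qed.

(** [ctrβ] turns a reassociator into p and [ctrα] turns an inverse one into q. The fourfold versions
    have the shape of the two antipode axioms on Φ⁻¹ and Φ, with a spectator factor in V. *)
Definition ctrβ V (t : H ⊠ H ⊠ V) : H ⊠ V :=
  \tsum_(a ⊗ b ⊗ v := t) (b * Sinv β * Sinv a) ⊠ v.
Definition ctrα V (t : H ⊠ H ⊠ V) : H ⊠ V :=
  \tsum_(a ⊗ b ⊗ v := t) (S a * α * b) ⊠ v.
Definition ctrαβ V (t : H ⊠ H ⊠ H ⊠ V) : H ⊠ V :=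
  \tsum_(a ⊗ b ⊗ c ⊗ v := t) (S a * α * b * β * S c) ⊠ v.
Definition ctrβα V (t : H ⊠ H ⊠ H ⊠ V) : H ⊠ V :=
  \tsum_(a ⊗ b ⊗ c ⊗ v := t) (a * β * S b * α * c) ⊠ v.

Lemma lin_ctrβ V : linear (@ctrβ V). Proof. by rewrite /ctrβ; lin. Qed.
Lemma lin_ctrα V : linear (@ctrα V). Proof. by rewrite /ctrα; lin. Qed.
Lemma lin_ctrαβ V : linear (@ctrαβ V). Proof. by rewrite /ctrαβ; lin. Qed.
Lemma lin_ctrβα V : linear (@ctrβα V). Proof. by rewrite /ctrβα; lin. Qed.
Hint Extern 0 (GRing.linear_for _ (@ctrβ _)) => exact: lin_ctrβ : lin.
Hint Extern 0 (GRing.linear_for _ (@ctrα _)) => exact: lin_ctrα : lin.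
Hint Extern 0 (GRing.linear_for _ (@ctrαβ _)) => exact: lin_ctrαβ : lin.
Hint Extern 0 (GRing.linear_for _ (@ctrβα _)) => exact: lin_ctrβα : lin.
Lemma ctrβE V a b (v : V) : ctrβ (a ⊠ b ⊠ v) = (b * Sinv β * Sinv a) ⊠ v.
Proof. by rewrite /ctrβ !ksum_pure //; lin. Qed.
Lemma ctrαE V a b (v : V) : ctrα (a ⊠ b ⊠ v) = (S a * α * b) ⊠ v.
Proof. by rewrite /ctrα !ksum_pure //; lin. Qed.
Lemma ctrαβE V a b c (v : V) : ctrαβ (a ⊠ b ⊠ c ⊠ v) = (S a * α * b * β * S c) ⊠ v.
Proof. by rewrite /ctrαβ !ksum_pure //; lin. Qed.
Lemma ctrβαE V a b c (v : V) : ctrβα (a ⊠ b ⊠ c ⊠ v) = (a * β * S b * α * c) ⊠ v.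
Proof. by rewrite /ctrβα !ksum_pure //; lin. Qed.

(** Multiplying on the right places the two legs of Δ(h) directly around S⁻¹(β), because S⁻¹ is
    antimultiplicative. The absorption lemmas below work alike: α absorbs from the left and β from
    the right. *)
Lemma ctrβ_absr V (t : H ⊠ H ⊠ V) w : ctrβ (t * D1 w) = ctrβ (t * cl w).
Proof.
tind w as h v; tind t as a t; tind t as b u.
rewrite clE !(kscalerAr, kmulE, ctrβE, mulr1) linZ; last by lin.
rewrite ctrβE amE.
transitivity ((b * (\tsum_(x ⊗ y := Δ h) (y * Sinv β * Sinv x)) * Sinv a) ⊠ (u * v)).
  move: (Δ h) => d; tind d as x y.
  by rewrite amE !kmulE ctrβE ksum_pure ?SinvM ?mulrA //; lin.
by rewrite betaPinv ?(kscalerAr, kscalerAl, kpureZl).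
Qed.

Lemma ctrα_absl V (t : H ⊠ H ⊠ V) w : ctrα (D1 w * t) = ctrα (cl w * t).
Proof.
tind w as h v; tind t as a t; tind t as b u.
rewrite clE !(kscalerAl, kmulE, ctrαE, mul1r) linZ; last by lin.
rewrite ctrαE amE.
transitivity ((S a * (\tsum_(x ⊗ y := Δ h) (S x * α * y)) * b) ⊠ (v * u)).
  move: (Δ h) => d; tind d as x y.
  by rewrite amE !kmulE ctrαE ksum_pure ?SM ?mulrA //; lin.
by rewrite alphaP ?(kscalerAr, kscalerAl, kpureZl).
Qed.

Lemma ctrαβ_absl V (t : H ⊠ H ⊠ H ⊠ V) w : ctrαβ (D1 w * t) = ctrαβ (cl w * t).
Proof.
tind w as h v; tind t as a t; tind t as b u; tind v as c v; tind u as d u.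
rewrite clE !(kscalerAl, kmulE, ctrαβE, mul1r) linZ; last by lin.
rewrite ctrαβE amE.
transitivity ((S a * (\tsum_(x ⊗ y := Δ h) (S x * α * y)) * b * β * S (c * d))
   ⊠ (v * u)).
  move: (Δ h) => s; tind s as x y.
  by rewrite amE !kmulE ctrαβE ksum_pure ?SM ?mulrA //; lin.
by rewrite alphaP ?(kscalerAr, kscalerAl, kpureZl).
Qed.

Lemma ctrαβ_absr V (t : H ⊠ H ⊠ H ⊠ V) w : ctrαβ (t * i2 D1 w) = ctrαβ (t * i2 cl w).
Proof.
tind w as a w; tind w as h v.
tind t as b t; tind t as c t; tind t as d u.
rewrite !i2E clE !kpureZr !(kscalerAr, kmulE, ctrαβE, mulr1) linZ; last by lin.
rewrite ctrαβE amE.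
transitivity ((S (b * a) * α * c * (\tsum_(x ⊗ y := Δ h) (x * β * S y)) * S d)
   ⊠ (u * v)).
  move: (Δ h) => s; tind s as x y.
  by rewrite amE !kmulE ctrαβE ksum_pure ?SM ?mulrA //; lin.
by rewrite betaP ?(kscalerAr, kscalerAl, kpureZl).
Qed.

Lemma ctrβα_absl V (t : H ⊠ H ⊠ H ⊠ V) w : ctrβα (i2 D1 w * t) = ctrβα (i2 cl w * t).
Proof.
tind w as a w; tind w as h v.
tind t as b t; tind t as c t; tind t as d u.
rewrite !i2E clE !kpureZr !(kscalerAl, kmulE, ctrβαE, mul1r) linZ; last by lin.
rewrite ctrβαE amE.
transitivity ((a * b * β * S c * (\tsum_(x ⊗ y := Δ h) (S x * α * y)) * d)
   ⊠ (v * u)).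
  move: (Δ h) => s; tind s as x y.
  by rewrite amE !kmulE ctrβαE ksum_pure ?SM ?mulrA //; lin.
by rewrite alphaP ?(kscalerAr, kscalerAl, kpureZl).
Qed.

Lemma ctrβα_absr V (t : H ⊠ H ⊠ H ⊠ V) w : ctrβα (t * D1 w) = ctrβα (t * cl w).
Proof.
tind w as h v; tind t as a t; tind t as b u; tind v as c v; tind u as d u.
rewrite clE !(kscalerAr, kmulE, ctrβαE, mulr1) linZ; last by lin.
rewrite ctrβαE amE.
transitivity ((a * (\tsum_(x ⊗ y := Δ h) (x * β * S y)) * S b * α * (d * c))
   ⊠ (u * v)).
  move: (Δ h) => s; tind s as x y.
  by rewrite amE !kmulE ctrβαE ksum_pure ?SM ?mulrA //; lin.
by rewrite betaP ?(kscalerAr, kscalerAl, kpureZl).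
Qed.

Lemma ctrβ_mull V (t : H ⊠ H ⊠ V) h (u : H ⊠ V) :
  ctrβ ((h ⊠ u) * t) = u * ctrβ t * (Sinv h ⊠ 1).
Proof.
tind t as a t; tind t as b v; tind u as c u.
by rewrite !(kmulE, ctrβE) SinvM !mulrA mulr1.
Qed.

Lemma ctrα_mulr V (t : H ⊠ H ⊠ V) h (u : H ⊠ V) :
  ctrα (t * (h ⊠ u)) = (S h ⊠ 1) * ctrα t * u.
Proof.
tind t as a t; tind t as b v; tind u as c u.
by rewrite !(kmulE, ctrαE) SM !mulrA mul1r.
Qed.

(** With f = λ the left side is λ(q²) p (S⁻¹(q¹) ⊗ 1). Antimultiplicativity gathers the H-part into
    S⁻¹ of a single alternating product, to which the antipode axiom on Φ⁻¹ applies. *)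
Lemma ctrαβ_ctrα_ctrβ V (f : amor V (H ⊠ V)%type) (t t' : H ⊠ H ⊠ V) :
  \tsum_(a ⊗ v := ctrα t) f v * ctrβ t' * (Sinv a ⊠ 1)
  = \tsum_(c ⊗ v := ctrαβ (i2 (i2 f) t * am_sh t')) Sinv c ⊠ v.
Proof.
tind t' as a' t'; tind t' as b' v'.
tind t as a t; tind t as b v.
rewrite ctrαE ksum_pure; last by lin.
rewrite !amE ctrβE; move: (f v) => fv; tind fv as c u.
rewrite !(kmulE, ctrαβE) ksum_pure ?mulr1; last by lin.
by rewrite !(SinvM, SK) !mulrA.
Qed.

Lemma ctrβα_ctrβ_ctrα V (f : amor V (H ⊠ V)%type) (t t' : H ⊠ H ⊠ V) :
  \tsum_(a ⊗ v := ctrβ t) (S a ⊠ 1) * ctrα t' * f v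
  = ctrβα (am_sh t' * i2 (i2 f) t).
Proof.
tind t' as a' t'; tind t' as b' v'; tind t as a t; tind t as b v.
rewrite ctrβE ksum_pure; last by lin.
rewrite !amE ctrαE; move: (f v) => fv; tind fv as c u.
rewrite !(kmulE, ctrβαE) ?mul1r.
by rewrite !(SM, SinvK) !mulrA.
Qed.

End QuasiHopf.

Arguments epl {k H} hH {V}.
Arguments cl {k H} hH {V}.

Hint Extern 0 (GRing.linear_for _ (@antipode _ _)) =>
  solve [apply: lin_S; eassumption] : lin.
Hint Extern 0 (GRing.linear_for _ (@antipode_inv _ _)) =>
  solve [apply: lin_Sinv; eassumption] : lin.
Hint Extern 0 (GRing.linear_for _ (@eps _ _)) =>
  solve [apply: lin_eps; eassumption] : lin.
Hint Extern 0 (GRing.linear_for _ (@ctrβ _ _ _)) =>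
  solve [apply: lin_ctrβ; eassumption] : lin.
Hint Extern 0 (GRing.linear_for _ (@ctrα _ _ _)) =>
  solve [apply: lin_ctrα; eassumption] : lin.
Hint Extern 0 (GRing.linear_for _ (@ctrαβ _ _ _)) =>
  solve [apply: lin_ctrαβ; eassumption] : lin.
Hint Extern 0 (GRing.linear_for _ (@ctrβα _ _ _)) =>
  solve [apply: lin_ctrβα; eassumption] : lin.

(** * Reassociators as elements of tensor algebras *)

Section Unfold.
Variable k : fieldType.
Implicit Types A B C D : kalgType k.

Lemma ksumE A B (t : (A ⊠ B)%type) : \tsum_(a ⊗ b := t) a ⊠ b = t.
Proof. by rewrite [RHS]tpureE. Qed.

Lemma am_lsum A B C D (f : amor A (B ⊠ C)) (t : (A ⊠ D)%type) :
  am_l f t = \tsum_(a ⊗ d := t) \tsum_(b ⊗ c := f a) b ⊠ c ⊠ d.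
Proof.
tind t as a d; rewrite am_lE [in RHS]ksum_pure; last by lin.
by move: (f a) => s; tind s as b c; rewrite amE ksum_pure //; lin.
Qed.

Lemma i2_sum A B C (f : amor B C) (t : (A ⊠ B)%type) :
  i2 f t = \tsum_(a ⊗ b := t) a ⊠ f b.
Proof. by tind t as a b; rewrite amE ksum_pure //; lin. Qed.

Lemma i2_l_sum A B C D E (f : amor B (C ⊠ D)) (t : (A ⊠ B ⊠ E)%type) :
  i2 (am_l f) t
  = \tsum_(a ⊗ b ⊗ e := t) \tsum_(c ⊗ d := f b) a ⊠ c ⊠ d ⊠ e.
Proof.
tind t as a t; tind t as b e; rewrite amE am_lE !ksum_pure; try by lin.
by move: (f b) => s; tind s as c d; rewrite amE ksum_pure //; lin.
Qed.

Lemma i2_i2_sum A B C D E (f : amor C (D ⊠ E)) (t : (A ⊠ B ⊠ C)%type) :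
  i2 (i2 f) t
  = \tsum_(a ⊗ b ⊗ c := t) \tsum_(d ⊗ e := f c) a ⊠ b ⊠ d ⊠ e.
Proof.
tind t as a t; tind t as b c; rewrite !amE !ksum_pure; try by lin.
by move: (f c) => s; tind s as d e; rewrite ksum_pure //; lin.
Qed.

Lemma am_l_sum3 A B C D E (f : amor A (B ⊠ C)) (t : (A ⊠ D ⊠ E)%type) :
  am_l f t
  = \tsum_(a ⊗ d ⊗ e := t) \tsum_(b ⊗ c := f a) b ⊠ c ⊠ d ⊠ e.
Proof.
tind t as a t; tind t as d e; rewrite am_lE !ksum_pure; try by lin.
by move: (f a) => s; tind s as b c; rewrite amE ksum_pure //; lin.
Qed.

Lemma am_ext_sum A B C D (t : (A ⊠ B ⊠ C)%type) :
  am_ext t = \tsum_(a ⊗ b ⊗ c := t) a ⊠ b ⊠ c ⊠ (1 : D).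
Proof.
by tind t as a t; tind t as b c; rewrite amE !ksum_pure //; lin.
Qed.

Lemma i2_comp A B C D (f : amor C D) (g : amor B C) (t : (A ⊠ B)%type) :
  i2 f (i2 g t) = i2 (am_comp f g) t.
Proof. by tind t as a b; rewrite !amE. Qed.

Lemma i2_idE A B (f : amor B B) (t : (A ⊠ B)%type) :
  (forall b, f b = b) -> i2 f t = t.
Proof. by move=> fE; tind t as a b; rewrite !amE fE. Qed.

Lemma am_inv A B (f : amor A B) x y : f x = 1 -> x * y = 1 -> f y = 1.
Proof. by move=> fx xy; rewrite -[LHS]mul1r -fx -amM xy am1. Qed.

Lemma am_mul1 A B (f : amor A B) x y : x * y = 1 -> f x * f y = 1.
Proof. by move=> xy; rewrite -amM xy am1. Qed.

End Unfold.

Section QuasiBialgebra.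
Variables (k : fieldType) (H : quasi_hopf_data k) (hH : is_quasi_hopf H).
Implicit Types V W : kalgType k.
Let hQ := qh_quasi_bialgebra hH.
Local Notation Δ := (am_Delta hH).
Local Notation D1 := (am_l Δ).
Local Notation ε1 := (epl hH).

Definition kPhi : (H ⊠ H ⊠ H)%type := Phi H.
Definition kPhii : (H ⊠ H ⊠ H)%type := inverse (Phi H).
Local Notation Φ := kPhi.
Local Notation Φi := kPhii.

Lemma PhiK : Φ * Φi = 1.
Proof. by have [] := inverseP (qb_Phi_inv hQ). Qed.
Lemma PhiiK : Φi * Φ = 1.
Proof. by have [] := inverseP (qb_Phi_inv hQ). Qed.

Lemma Phi_pentagon :
  am_sh Φ * i2 D1 Φ * am_ext Φ = i2 (i2 Δ) Φ * D1 Φ :> (H ⊠ H ⊠ H ⊠ H)%type.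
Proof.
rewrite i2_l_sum i2_i2_sum am_ext_sum am_l_sum3.
exact: (qb_pentagon hQ).
Qed.

Lemma Delta_coassoc h : i2 Δ (Δ h) * Φ = Φ * D1 (Δ h).
Proof.
rewrite i2_sum am_lsum.
have /= -> : \tsum_(a ⊗ b := Δ h) a ⊠ Δ b
    = Φ * (\tsum_(a ⊗ b := Δ h) \tsum_(c ⊗ d := Δ a) c ⊠ d ⊠ b) * Φi.
  rewrite -[RHS](qb_coassoc hQ).
  by apply: eq_tsum => a b; rewrite -[Δ b in LHS]ksumE kpure_tsumr.
by rewrite -mulrA PhiiK mulr1.
Qed.

Lemma epl_Delta h : ε1 (Δ h) = h. Proof. exact: (qb_counitl hQ). Qed.
Lemma epr_Delta h : \tsum_(a ⊗ b := Δ h) (eps b *: a) = h.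
Proof. exact: (qb_counitr hQ). Qed.

Lemma epl_sh V (v : V) : ε1 (am_sh v) = v.
Proof. by rewrite amE eplE eps1 // scale1r. Qed.

Lemma epl_sum V W (t : (H ⊠ V ⊠ W)%type) :
  ε1 t = \tsum_(a ⊗ b ⊗ c := t) eps a *: (b ⊠ c).
Proof.
tind t as a t; tind t as b c.
by rewrite eplE !ksum_pure //; lin.
Qed.

Lemma i2_epl_sum V W (t : (W ⊠ H ⊠ V)%type) :
  i2 ε1 t = \tsum_(a ⊗ b ⊗ c := t) eps b *: (a ⊠ c).
Proof.
tind t as a t; tind t as b c.
by rewrite i2E eplE kpureZr !ksum_pure //; lin.
Qed.

Lemma epl_D1 V (t : (H ⊠ V)%type) : ε1 (D1 t) = t.
Proof.
tind t as h v; rewrite am_lE -[h in RHS]epl_Delta.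
by move: (Δ h) => d; tind d as a b; rewrite amE !eplE kpureZl.
Qed.

Lemma i2_epl_D1 V (t : (H ⊠ V)%type) : i2 ε1 (D1 t) = t.
Proof.
tind t as h v; rewrite am_lE -[h in RHS]epr_Delta.
move: (Δ h) => d; tind d as a b; rewrite !amE eplE kpureZr ksum_pure ?kpureZl //.
by lin.
Qed.

Lemma i2_epl_Phi : i2 ε1 Φ = 1.
Proof. by rewrite -[RHS](qb_Phi_counit hQ) i2_epl_sum. Qed.

(** Only the middle counit of Φ is an axiom. Applying ε to the second factor of the pentagon leaves
    (1 ⊗ (ε ⊗ id ⊗ id)(Φ)) Φ = Φ, and Φ is cancelled. *)
Lemma epl_Phi : ε1 Φ = 1.
Proof.
have := congr1 (i2 ε1) Phi_pentagon; rewrite !amM.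
rewrite [X in _ * X * _]i2_comp [X in _ * X * _]i2_idE; last by move=> t; exact: epl_D1.
have -> : i2 ε1 (am_ext Φ) = 1 :> (H ⊠ H ⊠ H)%type.
  rewrite -(am1 (i2 (am_in (B := H)))) -i2_epl_Phi.
  move: Φ => t; tind t as a t; tind t as b c.
  by rewrite !amE !eplE !(kpureZl, kpureZr).
have -> : i2 ε1 (i2 (i2 Δ) Φ) = 1.
  rewrite -(am1 (i2 Δ)) -i2_epl_Phi.
  move: Φ => t; tind t as a t; tind t as b c.
  by rewrite !amE !eplE amZ.
rewrite i2_epl_D1 mulr1 mul1r => /(congr1 (fun t => t * Φi)).
rewrite -mulrA PhiK mulr1 amE i2E => E.
by rewrite -[LHS]epl_sh amE E koneE eplE eps1 // scale1r.
Qed.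

Fact epr_subproof V :
  is_algebra_map (fun t : (V ⊠ H)%type => \tsum_(v ⊗ h := t) eps h *: v).
Proof.
split; first by lin.
split=> [|s t]; first by rewrite ksum_pure ?eps1 ?scale1r //; lin.
tind s as v h; tind t as v' h'.
by rewrite kmulE !ksum_pure ?epsM ?kscalerAl ?kscalerAr ?scalerA //; lin.
Qed.
Definition epr V := Amor (@epr_subproof V).
Lemma eprE V (v : V) h : epr V (v ⊠ h) = eps h *: v.
Proof. by rewrite [LHS]ksum_pure //; lin. Qed.

(* [ε ⊗ 1 ⊗ 1] in place of a comultiplication applied to a last tensor factor. *)
Fact cr_subproof : is_algebra_map (fun h : H => eps h *: (1 : (H ⊠ H)%type)).
Proof.
split; first by lin.
split=> [|x y]; first by rewrite eps1 ?scale1r.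
by rewrite epsM // kscalerAl kscalerAr scalerA mul1r.
Qed.
Definition cr := Amor cr_subproof.
Lemma crE h : cr h = eps h *: (1 : (H ⊠ H)%type). Proof. by []. Qed.

Lemma i2_cr_Delta h : i2 cr (Δ h) = h ⊠ 1.
Proof.
rewrite -[h in RHS]epr_Delta; move: (Δ h) => d; tind d as a b.
by rewrite amE ksum_pure ?kpureZr ?kpureZl //; lin.
Qed.

(** Here ε is applied to the third factor of the pentagon, which leaves Φ ((id ⊗ id ⊗ ε)(Φ) ⊗ 1) = Φ
    up to the placement of the counit. *)
Lemma i2_epr_Phi : i2 (epr H) Φ = 1.
Proof.
have := congr1 (i2 (i2 ε1)) Phi_pentagon; rewrite !amM.
have -> : i2 (i2 ε1) (am_sh (A := H) Φ) = 1.
  by rewrite am_shE i2E i2_epl_Phi.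
have -> : i2 (i2 ε1) (i2 D1 Φ) = Φ.
  by rewrite i2_comp i2_idE // => t; exact: i2_epl_D1.
have -> : i2 (i2 ε1) (i2 (i2 Δ) Φ) = Φ.
  by rewrite i2_comp i2_idE // => t; rewrite am_compE i2_comp i2_idE // => h;
    exact: epl_Delta.
have -> : i2 (i2 ε1) (D1 Φ) = 1.
  have -> : i2 (i2 ε1) (D1 Φ) = D1 (i2 ε1 Φ).
    move: Φ => t; tind t as a t; rewrite !(i2E, am_lE).
    by move: (Δ a) => d; tind d as b c; rewrite !amE.
  by rewrite i2_epl_Phi !am1.
rewrite mul1r mulr1 => /(congr1 (fun t => Φi * t)).
rewrite mulrA PhiiK mul1r => E.
have <- : i2 (epr H) (i2 (i2 ε1) (am_ext (D := H) Φ)) = 1.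
  by rewrite E !am1.
move: Φ => t; tind t as a t; tind t as b c.
by rewrite !(amE, eplE, eprE) epsZ // eps1 // mulr1.
Qed.

Lemma i2_i2_cr_Phi : i2 (i2 cr) Φ = 1.
Proof.
have <- : i2 (i2 am_in) (i2 am_in (i2 (epr H) Φ)) = 1 :> (H ⊠ H ⊠ H ⊠ H)%type.
  by rewrite i2_epr_Phi !am1.
move: Φ => t; tind t as a t; tind t as b c.
by rewrite !(amE, eprE, crE) !(kpureZl, kpureZr).
Qed.

(** H coacting on itself: results on comodule algebras then specialize to Φ, which is how the
    elements [hp], [hq] and the reassociator axioms for γ and δ are obtained. *)
Definition regular : left_comodule_algebra_data H :=
  LeftComoduleAlgebraData (@Delta k H) (Phi H).

Lemma regularP : is_left_comodule_algebra regular.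
Proof.
split.
- exact: qb_Delta_alg hQ.
- exact: qb_Phi_inv hQ.
- move=> h; have := Delta_coassoc h; rewrite i2_sum am_lsum => E.
  rewrite -[RHS]E; congr (_ * _); apply: eq_tsum => a b.
  by rewrite -[Δ b in RHS]ksumE kpure_tsumr.
- exact: (qb_pentagon hQ).
- exact: (qb_counitl hQ).
- exact: (qb_Phi_counit hQ).
- by rewrite -[RHS]epl_Phi epl_sum.
Qed.

End QuasiBialgebra.

Arguments epr {k H} hH {V}.

(** * The elements p and q of a left comodule algebra *)

Section LeftComodule.
Variables (k : fieldType) (H : quasi_hopf_data k) (hH : is_quasi_hopf H).
Variables (B : left_comodule_algebra_data H) (hB : is_left_comodule_algebra B).
Implicit Types V W : kalgType k.
Local Notation Sinv := (@antipode_inv k H).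
Local Notation S := (@antipode k H).
Local Notation Δ := (am_Delta hH).
Local Notation D1 := (am_l Δ).
Local Notation ε1 := (epl hH).
Local Notation Φ := (kPhi H).
Local Notation Φi := (kPhii H).

Definition am_lam : amor B (H ⊠ B) := Amor (lca_alg_map hB).
Local Notation λ := am_lam.
Definition lX : (H ⊠ H ⊠ B)%type := lPhi B.
Definition lXi : (H ⊠ H ⊠ B)%type := inverse (lPhi B).
Local Notation X := lX.
Local Notation Y := lXi.

Lemma lXK : X * Y = 1.
Proof. by have [] := inverseP (lca_Phi_inv hB). Qed.
Lemma lXiK : Y * X = 1.
Proof. by have [] := inverseP (lca_Phi_inv hB). Qed.

Lemma lX_pentagon :
  am_sh X * i2 D1 X * am_ext Φ = i2 (i2 λ) X * D1 X :> (H ⊠ H ⊠ H ⊠ B)%type.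
Proof.
rewrite i2_l_sum i2_i2_sum am_ext_sum am_l_sum3.
exact: (lca_pentagon hB).
Qed.

Lemma lam_coassoc b : i2 λ (λ b) * X = X * D1 (λ b).
Proof.
rewrite i2_sum am_lsum -[RHS](lca_coassoc hB); congr (_ * _).
by apply: eq_tsum => h c; rewrite -[λ c in LHS]ksumE kpure_tsumr.
Qed.

Lemma lam_coassoc_inv b : Y * i2 λ (λ b) = D1 (λ b) * Y.
Proof.
by rewrite -[RHS]mul1r -lXiK -!mulrA; congr (_ * _);
   rewrite mulrA -lam_coassoc -mulrA lXK mulr1.
Qed.

Lemma epl_lam b : ε1 (λ b) = b. Proof. exact: (lca_counit hB). Qed.
Lemma epl_lX : ε1 X = 1.
Proof. by rewrite epl_sum -[RHS](lca_Phi_counit_left hB). Qed.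
Lemma i2_epl_lX : i2 ε1 X = 1.
Proof. by rewrite i2_epl_sum -[RHS](lca_Phi_counit_mid hB). Qed.

Lemma cl_lX : cl hH X = 1. Proof. by rewrite /cl !am_compE epl_lX !am1. Qed.
Lemma i2_cl_lX : i2 (cl hH) X = 1.
Proof. by rewrite /cl -!i2_comp i2_epl_lX !am1. Qed.
Lemma cl_lXi : cl hH Y = 1. Proof. exact: am_inv cl_lX lXK. Qed.
Lemma i2_cl_lXi : i2 (cl hH) Y = 1. Proof. exact: am_inv i2_cl_lX lXK. Qed.

(** By the pentagon the argument is (Δ ⊗ id ⊗ id)(X)(Φ⁻¹ ⊗ 1)(id ⊗ Δ ⊗ id)(X⁻¹). The contraction
    erases both outer factors, whose counits are trivial, and sends Φ⁻¹ to 1 by an antipode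
    axiom. *)
Lemma ctrαβ_reassoc : ctrαβ (i2 (i2 λ) Y * am_sh X) = 1.
Proof.
have -> : i2 (i2 λ) Y * am_sh X = D1 X * am_ext Φi * i2 D1 Y.
  have e1 := am_mul1 (i2 (i2 λ)) lXiK; have e2 := am_mul1 (i2 D1) lXK.
  have e3 := am_mul1 (am_ext (D := B)) (PhiK hH).
  rewrite -[D1 X]mul1r -e1 -[_ * D1 X]mulrA -lX_pentagon.
  by rewrite -!mulrA [am_ext Φ * _]mulrA e3 mul1r e2 mulr1.
rewrite ctrαβ_absr // -mulrA ctrαβ_absl // cl_lX i2_cl_lXi mul1r mulr1.
have E : \tsum_(a ⊗ b ⊗ c := Φi)
  (S a * qh_alpha H * b * qh_beta H * S c : H) = 1 := qh_Phi_inv_antipode hH.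
rewrite koneE -[in RHS]E.
move: Φi => t; tind t as a t; tind t as b c.
by rewrite am_extE (ctrαβE hH) // !ksum_pure //; lin.
Qed.

Lemma ctrβα_reassoc : ctrβα (am_sh Y * i2 (i2 λ) X) = 1.
Proof.
have -> : am_sh Y * i2 (i2 λ) X = i2 D1 X * am_ext Φ * D1 Y.
  have e1 := am_mul1 (am_sh (A := H)) lXiK; have e2 := am_mul1 D1 lXK.
  rewrite -[i2 D1 X]mul1r -e1 -!mulrA [i2 D1 X * _]mulrA [am_sh X * _]mulrA.
  by rewrite [am_sh X * _]mulrA lX_pentagon -!mulrA e2 mulr1.
rewrite ctrβα_absr // -mulrA ctrβα_absl // i2_cl_lX cl_lXi mul1r mulr1.
have E : \tsum_(a ⊗ b ⊗ c := Φ)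
  (a * qh_beta H * S b * qh_alpha H * c : H) = 1 := qh_Phi_antipode hH.
rewrite koneE -[in RHS]E.
move: Φ => t; tind t as a t; tind t as b c.
by rewrite am_extE (ctrβαE hH) // !ksum_pure //; lin.
Qed.

(* The elements p_λ and q_λ of Hausser and Nill. *)
Definition lp : (H ⊠ B)%type := ctrβ X.
Definition lq : (H ⊠ B)%type := ctrα Y.

Lemma ctrβ_i2_lam t w :
  ctrβ (i2 λ w * t) = \tsum_(h ⊗ b := w) λ b * ctrβ t * (Sinv h ⊠ 1).
Proof. by tind w as h b; rewrite i2E ctrβ_mull // ksum_pure //; lin. Qed.

Lemma ctrα_i2_lam t w :
  ctrα (t * i2 λ w) = \tsum_(h ⊗ b := w) (S h ⊠ 1) * ctrα t * λ b.
Proof. by tind w as h b; rewrite i2E ctrα_mulr // ksum_pure //; lin. Qed.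

(** It is the contraction of (id ⊗ λ)λ(b) X = X (Δ ⊗ id)λ(b): on the right the comultiplication
    collapses and only b remains. *)
Lemma lp_lam b : \tsum_(h ⊗ c := λ b) λ c * lp * (Sinv h ⊠ 1) = lp * (1 ⊠ b).
Proof.
rewrite -ctrβ_i2_lam lam_coassoc ctrβ_absr // /cl !am_compE epl_lam !amE.
rewrite /lp; move: X => t; tind t as x t; tind t as y z.
by rewrite !(kmulE, (ctrβE hH)) !mulr1.
Qed.

Lemma lq_lam b : \tsum_(h ⊗ c := λ b) (S h ⊠ 1) * lq * λ c = (1 ⊠ b) * lq.
Proof.
rewrite -ctrα_i2_lam lam_coassoc_inv ctrα_absl // /cl !am_compE epl_lam !amE.
rewrite /lq; move: Y => t; tind t as x t; tind t as y z.
by rewrite !(kmulE, (ctrαE hH)) !mul1r.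
Qed.

Lemma lq_lp : \tsum_(h ⊗ b := lq) λ b * lp * (Sinv h ⊠ 1) = 1.
Proof.
rewrite ctrαβ_ctrα_ctrβ // ctrαβ_reassoc koneE ksum_pure ?Sinv1 //; lin.
Qed.

Lemma lp_lq : \tsum_(h ⊗ b := lp) (S h ⊠ 1) * lq * λ b = 1.
Proof. by rewrite ctrβα_ctrβ_ctrα // ctrβα_reassoc. Qed.

(** The normalization ε(β) = 1 enters here, as ε(α) = 1 does for q; these two values make the counit
    axioms of the two kinds of modules correspond. *)
Lemma epl_lp : ε1 lp = 1.
Proof.
have <- : ε1 (i2 ε1 X) = 1 by rewrite i2_epl_lX am1.
rewrite /lp; move: X => t; tind t as x t; tind t as y z.
rewrite (ctrβE hH) !(amE, eplE) !epsM // !eps_Sinv // qh_eps_beta // mulr1.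
by rewrite scalerA mulrC.
Qed.

Lemma epl_lq : ε1 lq = 1.
Proof.
have <- : ε1 (i2 ε1 Y) = 1.
  by rewrite (am_inv i2_epl_lX lXK) am1.
rewrite /lq; move: Y => t; tind t as x t; tind t as y z.
rewrite (ctrαE hH) !(amE, eplE) !epsM // qh_eps_antipode // qh_eps_alpha // mulr1.
by rewrite scalerA.
Qed.

End LeftComodule.

Section Regular.
Variables (k : fieldType) (H : quasi_hopf_data k) (hH : is_quasi_hopf H).
Local Notation Δ := (am_Delta hH).
Let R := regularP hH.

Lemma Delta_coassoc_inv h :
  kPhii H * i2 Δ (Δ h) = am_l Δ (Δ h) * kPhii H.
Proof. exact: (lam_coassoc_inv hH R h). Qed.
Lemma cl_Phi : cl hH (kPhi H) = 1. Proof. exact: (cl_lX hH R). Qed.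
Lemma i2_cl_Phi : i2 (cl hH) (kPhi H) = 1. Proof. exact: (i2_cl_lX hH R). Qed.
Lemma i2_cl_Phii : i2 (cl hH) (kPhii H) = 1.
Proof. exact: (i2_cl_lXi hH R). Qed.

End Regular.

(** * Antipodes relative to an algebra map *)

Section RelativeAntipode.
Variables (k : fieldType) (H : quasi_hopf_data k) (hH : is_quasi_hopf H).
Variables (B : kalgType k) (j : amor H B).
Local Notation Δ := (am_Delta hH).
Local Notation D1 := (am_l Δ).
Local Notation ε1 := (epl hH).
Local Notation Φ := (kPhi H).
Local Notation Φi := (kPhii H).

(** The axioms on (S, α, β) with values pushed along [j]. The case in use is j = Δ, where both Δ∘S
    and (S ⊗ S)Δ^cop are instances. *)
Record relative_antipode := RelativeAntipode {
  ra_S :> H -> B;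
  ra_α : B;
  ra_β : B;
  ra_lin : linear ra_S;
  ra_S1 : ra_S 1 = 1;
  ra_SM : forall x y, ra_S (x * y) = ra_S y * ra_S x;
  ra_αP : forall h,
    \tsum_(a ⊗ b := Δ h) (ra_S a * ra_α * j b : B) = eps h *: ra_α;
  ra_βP : forall h,
    \tsum_(a ⊗ b := Δ h) (j a * ra_β * ra_S b : B) = eps h *: ra_β;
  ra_Phi :
    \tsum_(a ⊗ b ⊗ c := Φ) (j a * ra_β * ra_S b * ra_α * j c : B) = 1;
  ra_Phii :
    \tsum_(a ⊗ b ⊗ c := Φi) (ra_S a * ra_α * j b * ra_β * ra_S c : B) = 1
}.

Hint Extern 0 (GRing.linear_for _ (ra_S _)) => exact: ra_lin : lin.

(* The element intertwining two antipodes relative to j; the Drinfeld twist is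
   of this form. *)
Definition ra_twist (P Q : relative_antipode) : B :=
  \tsum_(a ⊗ b ⊗ c := Φi) (Q a * ra_α Q * j b * ra_β P * P c).

Section Two.
Variables P Q : relative_antipode.

Let T (t : (H ⊠ H ⊠ H)%type) : B :=
  \tsum_(a ⊗ b ⊗ c := t) (Q a * ra_α Q * j b * ra_β P * P c).

Let lin_T : linear T. Proof. by rewrite /T; lin. Qed.
Hint Extern 0 (GRing.linear_for _ T) => exact: lin_T : lin.
Let TE a b c : T (a ⊠ b ⊠ c) = Q a * ra_α Q * j b * ra_β P * P c.
Proof. by rewrite /T !ksum_pure //; lin. Qed.

Let T_absl t w : T (D1 w * t) = T (cl hH w * t).
Proof.
tind w as h v; tind t as a t; tind t as b u.
rewrite clE !(kscalerAl, kmulE, TE, mul1r) linZ; last by lin.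
rewrite TE amE.
transitivity (Q a * (\tsum_(x ⊗ y := Δ h) (Q x * ra_α Q * j y)) * j b
  * ra_β P * P (v * u)).
  move: (Δ h) => s; tind s as x y.
  by rewrite amE !kmulE TE ksum_pure ?ra_SM ?amM ?mulrA //; lin.
by rewrite ra_αP ?(kscalerAr, kscalerAl).
Qed.

Let T_absr t w : T (t * i2 Δ w) = T (t * i2 (cr hH) w).
Proof.
tind w as a h; tind t as b t; tind t as c d.
rewrite !i2E crE kpureZr !kscalerAr linZ; last by lin.
rewrite koneE !kmulE !mulr1 TE.
transitivity (Q (b * a) * ra_α Q * j c
  * (\tsum_(x ⊗ y := Δ h) (j x * ra_β P * P y)) * P d).
  move: (Δ h) => s; tind s as x y.
  by rewrite !kmulE TE ksum_pure ?ra_SM ?amM ?mulrA //; lin.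
by rewrite ra_βP ?(kscalerAr, kscalerAl).
Qed.

(** [T] is applied to Φ⁻¹ (id ⊗ Δ)Δ(h) = (Δ ⊗ id)Δ(h) Φ⁻¹. The β-axiom of [P] erases one
    comultiplication and the α-axiom of [Q] the other, so that h survives as [Q h] on one side and
    as [P h] on the other. *)
Lemma ra_twist_S h : ra_twist P Q * P h = Q h * ra_twist P Q.
Proof.
have E0 : Φi * i2 Δ (Δ h) = D1 (Δ h) * Φi := Delta_coassoc_inv hH h.
have := congr1 T E0.
rewrite T_absr T_absl i2_cr_Delta /cl !am_compE epl_Delta !amE => E.
have -> : ra_twist P Q = T Φi by [].
transitivity (T ((1 ⊠ 1 ⊠ h) * Φi)).
  move: Φi => t; tind t as a t; tind t as b c.
  by rewrite !kmulE !TE !mul1r ra_SM !mulrA.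
rewrite -[LHS]E; move: Φi => t; tind t as a t; tind t as b c.
by rewrite koneE !kmulE !TE !mulr1 ra_SM !mulrA.
Qed.

Let U (t : (H ⊠ H ⊠ H ⊠ H)%type) : B :=
  \tsum_(a ⊗ b ⊗ c ⊗ d := t)
    (j a * ra_β Q * Q b * ra_α Q * j c * ra_β P * P d).

Let lin_U : linear U. Proof. by rewrite /U; lin. Qed.
Hint Extern 0 (GRing.linear_for _ U) => exact: lin_U : lin.
Let UE a b c d : U (a ⊠ b ⊠ c ⊠ d)
  = j a * ra_β Q * Q b * ra_α Q * j c * ra_β P * P d.
Proof. by rewrite /U !ksum_pure //; lin. Qed.

Let U_absl t w : U (i2 D1 w * t) = U (i2 (cl hH) w * t).
Proof.
tind w as e w; tind w as h v; tind t as a t; tind t as b t; tind t as c d.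
rewrite !i2E clE kpureZr !(kscalerAl, kmulE, mul1r) linZ; last by lin.
rewrite UE amE.
transitivity (j (e * a) * ra_β Q * Q b
  * (\tsum_(x ⊗ y := Δ h) (Q x * ra_α Q * j y)) * j c * ra_β P * P (v * d)).
  move: (Δ h) => s; tind s as x y.
  by rewrite amE !kmulE UE ksum_pure ?ra_SM ?amM ?mulrA //; lin.
by rewrite ra_αP ?(kscalerAr, kscalerAl).
Qed.

Let U_absr t w : U (t * D1 w) = U (t * cl hH w).
Proof.
tind w as h v; tind v as e g; tind t as a t; tind t as b t; tind t as c d.
rewrite clE !(kscalerAr, kmulE, mulr1) linZ; last by lin.
rewrite UE amE.
transitivity (j a * (\tsum_(x ⊗ y := Δ h) (j x * ra_β Q * Q y)) * Q b * ra_α Q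
  * j (c * e) * ra_β P * P (d * g)).
  move: (Δ h) => s; tind s as x y.
  by rewrite amE !kmulE UE ksum_pure ?ra_SM ?amM ?mulrA //; lin.
by rewrite ra_βP ?(kscalerAr, kscalerAl).
Qed.

Let U_absr' t w : U (t * i2 (i2 Δ) w) = U (t * i2 (i2 (cr hH)) w).
Proof.
tind w as e w; tind w as g h; tind t as a t; tind t as b t; tind t as c d.
rewrite !i2E crE !kpureZr !kscalerAr linZ; last by lin.
rewrite koneE !kmulE !mulr1 UE.
transitivity (j (a * e) * ra_β Q * Q (b * g) * ra_α Q * j c
  * (\tsum_(x ⊗ y := Δ h) (j x * ra_β P * P y)) * P d).
  move: (Δ h) => s; tind s as x y.
  by rewrite !kmulE UE ksum_pure ?ra_SM ?amM ?mulrA //; lin.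
by rewrite ra_βP ?(kscalerAr, kscalerAl).
Qed.

(** In (id ⊗ Δ ⊗ id)(Φ)(Φ ⊗ 1) = (1 ⊗ Φ⁻¹)(id ⊗ id ⊗ Δ)(Φ)(Δ ⊗ id ⊗ id)(Φ) the contraction [U]
    erases the three comultiplied factors. By [ra_Phi Q] the left side becomes [ra_β P], and Φ⁻¹ on
    the right gives the twist. *)
Lemma ra_twist_β : ra_β P = ra_β Q * ra_twist P Q.
Proof.
have E : i2 D1 Φ * am_ext Φ = am_sh Φi * (i2 (i2 Δ) Φ * D1 Φ).
  rewrite -(Phi_pentagon hH) !mulrA am_mul1 ?mul1r //; exact: PhiiK.
have := congr1 U E; rewrite U_absl mulrA U_absr cl_Phi mulr1.
rewrite U_absr' i2_i2_cr_Phi mulr1 i2_cl_Phi mul1r.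
have -> : U (am_ext Φ) = ra_β P.
  rewrite -[RHS]mul1r -(ra_Phi Q); move: Φ => t; tind t as a t; tind t as b c.
  by rewrite am_extE UE ra_S1 mulr1 !ksum_pure //; lin.
move=> ->; rewrite /ra_twist -/(T Φi); move: Φi => t.
tind t as a t; tind t as b c.
by rewrite amE UE TE am1 mul1r !mulrA.
Qed.

End Two.

(** The right-hand twist moves left through each [Q c], turning it into [P c], and is then absorbed
    by [ra_β Q]; what results is the axiom [ra_Phii P]. *)
Lemma ra_twistK P Q : ra_twist Q P * ra_twist P Q = 1.
Proof.
rewrite {1}/ra_twist -[RHS](ra_Phii P).
rewrite (linear_tsum _ _ (mulr_lin (ra_twist P Q))); apply: eq_tsum => a t.
rewrite (linear_tsum _ _ (mulr_lin (ra_twist P Q))); apply: eq_tsum => b c.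
by rewrite -mulrA -ra_twist_S (ra_twist_β P Q) !mulrA.
Qed.

End RelativeAntipode.

(** * Two nested contractions *)

Section Nested.
Variables (k : fieldType) (H : quasi_hopf_data k) (hH : is_quasi_hopf H).
Implicit Types V : kalgType k.
Local Notation S := (@antipode k H).
Local Notation Sinv := (@antipode_inv k H).
Local Notation α := (qh_alpha H).
Local Notation β := (qh_beta H).
Local Notation Δ := (am_Delta hH).
Local Notation D1 := (am_l Δ).
Local Notation ε1 := (epl hH).
Local Notation Φ := (kPhi H).
Local Notation Φi := (kPhii H).
Local Notation e14 := (i2 (am_comp am_sh am_sh)).

Lemma i2_clE V W (w : (W ⊠ H ⊠ V)%type) : i2 (cl hH) w = e14 (i2 ε1 w).
Proof. by rewrite i2_comp. Qed.

Definition sS (t : (H ⊠ H)%type) : (H ⊠ H)%type := \tsum_(a ⊗ b := t) S b ⊠ S a.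
Definition sSinv (t : (H ⊠ H)%type) : (H ⊠ H)%type :=
  \tsum_(a ⊗ b := t) Sinv b ⊠ Sinv a.
Lemma lin_sS : linear sS. Proof. by rewrite /sS; lin. Qed.
Lemma lin_sSinv : linear sSinv. Proof. by rewrite /sSinv; lin. Qed.
Hint Extern 0 (GRing.linear_for _ sS) => exact: lin_sS : lin.
Hint Extern 0 (GRing.linear_for _ sSinv) => exact: lin_sSinv : lin.
Lemma sSE a b : sS (a ⊠ b) = S b ⊠ S a.
Proof. by rewrite /sS ksum_pure //; lin. Qed.
Lemma sSinvE a b : sSinv (a ⊠ b) = Sinv b ⊠ Sinv a.
Proof. by rewrite /sSinv ksum_pure //; lin. Qed.
Lemma sSM s t : sS (s * t) = sS t * sS s.
Proof. by tind s as a b; tind t as c d; rewrite !(kmulE, sSE) !SM. Qed.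
Lemma sSinvM s t : sSinv (s * t) = sSinv t * sSinv s.
Proof. by tind s as a b; tind t as c d; rewrite !(kmulE, sSinvE) !SinvM. Qed.
Lemma sSK : cancel sS sSinv.
Proof. by move=> t; tind t as a b; rewrite sSE sSinvE !SK. Qed.
Lemma sSinvK : cancel sSinv sS.
Proof. by move=> t; tind t as a b; rewrite sSinvE sSE !SinvK. Qed.
Lemma sS_1 : sS 1 = 1. Proof. by rewrite koneE sSE !S1. Qed.
Lemma sSinv_1 : sSinv 1 = 1. Proof. by rewrite koneE sSinvE !Sinv1. Qed.

(** The pairs are nested: factors 2 and 3 inside, 1 and 4 outside. A comultiplication on the inner
    pair collapses and leaves units there, marked by [e14]; one on the outer pair can collapse
    afterwards. The variants ending in 1 carry a spectator, and use S⁻¹ in the β case to match p. *)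
Definition ctrαα (t : (H ⊠ H ⊠ H ⊠ H)%type) : (H ⊠ H)%type :=
  \tsum_(a ⊗ b ⊗ c ⊗ d := t) (S b * α * c) ⊠ (S a * α * d).
Definition ctrββ (t : (H ⊠ H ⊠ H ⊠ H)%type) : (H ⊠ H)%type :=
  \tsum_(a ⊗ b ⊗ c ⊗ d := t) (a * β * S d) ⊠ (b * β * S c).
Definition ctrαα1 V (t : (H ⊠ H ⊠ H ⊠ H ⊠ V)%type) : (H ⊠ H ⊠ V)%type :=
  \tsum_(a ⊗ b ⊗ c ⊗ u := t) \tsum_(d ⊗ v := u) (S b * α * c) ⊠ (S a * α * d) ⊠ v.
Definition ctrββ1 V (t : (H ⊠ H ⊠ H ⊠ H ⊠ V)%type) : (H ⊠ H ⊠ V)%type :=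
  \tsum_(a ⊗ b ⊗ c ⊗ u := t) \tsum_(d ⊗ v := u)
    (c * Sinv β * Sinv b) ⊠ (d * Sinv β * Sinv a) ⊠ v.
Lemma lin_ctrαα : linear ctrαα. Proof. by rewrite /ctrαα; lin. Qed.
Lemma lin_ctrββ : linear ctrββ. Proof. by rewrite /ctrββ; lin. Qed.
Lemma lin_ctrαα1 V : linear (@ctrαα1 V). Proof. by rewrite /ctrαα1; lin. Qed.
Lemma lin_ctrββ1 V : linear (@ctrββ1 V). Proof. by rewrite /ctrββ1; lin. Qed.
Hint Extern 0 (GRing.linear_for _ ctrαα) => exact: lin_ctrαα : lin.
Hint Extern 0 (GRing.linear_for _ ctrββ) => exact: lin_ctrββ : lin.
Hint Extern 0 (GRing.linear_for _ (@ctrαα1 _)) => exact: lin_ctrαα1 : lin.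
Hint Extern 0 (GRing.linear_for _ (@ctrββ1 _)) => exact: lin_ctrββ1 : lin.
Lemma ctrααE a b c d : ctrαα (a ⊠ b ⊠ c ⊠ d) = (S b * α * c) ⊠ (S a * α * d).
Proof. by rewrite /ctrαα !ksum_pure //; lin. Qed.
Lemma ctrββE a b c d : ctrββ (a ⊠ b ⊠ c ⊠ d) = (a * β * S d) ⊠ (b * β * S c).
Proof. by rewrite /ctrββ !ksum_pure //; lin. Qed.
Lemma ctrαα1E V a b c d (v : V) :
  ctrαα1 (a ⊠ b ⊠ c ⊠ d ⊠ v) = (S b * α * c) ⊠ (S a * α * d) ⊠ v.
Proof. by rewrite /ctrαα1 !ksum_pure //; lin. Qed.
Lemma ctrββ1E V a b c d (v : V) : ctrββ1 (a ⊠ b ⊠ c ⊠ d ⊠ v)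
  = (c * Sinv β * Sinv b) ⊠ (d * Sinv β * Sinv a) ⊠ v.
Proof. by rewrite /ctrββ1 !ksum_pure //; lin. Qed.

Lemma ctrαα_absl t w : ctrαα (i2 D1 w * t) = ctrαα (e14 (i2 ε1 w) * t).
Proof.
rewrite -i2_clE; tind w as e w; tind w as h v.
tind t as a t; tind t as b t; tind t as c d.
rewrite !i2E clE kpureZr !(kscalerAl, kmulE, mul1r) linZ; last by lin.
rewrite ctrααE amE.
transitivity ((S b * (\tsum_(x ⊗ y := Δ h) (S x * α * y)) * c)
   ⊠ (S (e * a) * α * (v * d))).
  move: (Δ h) => s; tind s as x y.
  by rewrite amE !kmulE ctrααE ksum_pure ?SM ?mulrA //; lin.
by rewrite (alphaP hH) ?kE.
Qed.

Lemma ctrββ_absr t w : ctrββ (t * i2 D1 w) = ctrββ (t * e14 (i2 ε1 w)).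
Proof.
rewrite -i2_clE; tind w as e w; tind w as h v.
tind t as a t; tind t as b t; tind t as c d.
rewrite !i2E clE kpureZr !(kscalerAr, kmulE, mulr1) linZ; last by lin.
rewrite ctrββE amE.
transitivity ((a * e * β * S (d * v))
   ⊠ (b * (\tsum_(x ⊗ y := Δ h) (x * β * S y)) * S c)).
  move: (Δ h) => s; tind s as x y.
  by rewrite amE !kmulE ctrββE ksum_pure ?SM ?mulrA //; lin.
by rewrite (betaP hH) ?kE.
Qed.

Lemma ctrαα1_absl V (t : (H ⊠ H ⊠ H ⊠ H ⊠ V)%type) w :
  ctrαα1 (i2 D1 w * t) = ctrαα1 (e14 (i2 ε1 w) * t).
Proof.
rewrite -i2_clE; tind w as e w; tind w as h v; tind v as v z.
tind t as a t; tind t as b t; tind t as c d; tind d as d u.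
rewrite !i2E clE kpureZr !(kscalerAl, kmulE, mul1r) linZ; last by lin.
rewrite ctrαα1E amE.
transitivity ((S b * (\tsum_(x ⊗ y := Δ h) (S x * α * y)) * c)
   ⊠ (S (e * a) * α * (v * d)) ⊠ (z * u)).
  move: (Δ h) => s; tind s as x y.
  by rewrite amE !kmulE ctrαα1E ksum_pure ?SM ?mulrA //; lin.
by rewrite (alphaP hH) ?kE.
Qed.

Lemma ctrββ1_absr V (t : (H ⊠ H ⊠ H ⊠ H ⊠ V)%type) w :
  ctrββ1 (t * i2 D1 w) = ctrββ1 (t * e14 (i2 ε1 w)).
Proof.
rewrite -i2_clE; tind w as e w; tind w as h v; tind v as v z.
tind t as a t; tind t as b t; tind t as c d; tind d as d u.
rewrite !i2E clE kpureZr !(kscalerAr, kmulE, mulr1) linZ; last by lin.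
rewrite ctrββ1E amE.
transitivity ((c * (\tsum_(x ⊗ y := Δ h) (y * Sinv β * Sinv x)) * Sinv b)
   ⊠ (d * v * Sinv β * Sinv (a * e)) ⊠ (u * z)).
  move: (Δ h) => s; tind s as x y.
  by rewrite amE !kmulE ctrββ1E ksum_pure ?SinvM ?mulrA //; lin.
by rewrite (betaPinv hH) ?kE.
Qed.

Lemma ctrαα_abs14 t h : ctrαα (e14 (Δ h) * t) = eps h *: ctrαα t.
Proof.
tind t as a t; tind t as b t; tind t as c d.
rewrite ctrααE.
transitivity ((S b * α * c) ⊠ (S a * (\tsum_(x ⊗ y := Δ h) (S x * α * y)) * d)).
  move: (Δ h) => s; tind s as x y.
  by rewrite !amE !kmulE ctrααE !mul1r ksum_pure ?SM ?mulrA //; lin.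
by rewrite (alphaP hH) ?kE.
Qed.

Lemma ctrββ_abs14 t h : ctrββ (t * e14 (Δ h)) = eps h *: ctrββ t.
Proof.
tind t as a t; tind t as b t; tind t as c d.
rewrite ctrββE.
transitivity ((a * (\tsum_(x ⊗ y := Δ h) (x * β * S y)) * S d) ⊠ (b * β * S c)).
  move: (Δ h) => s; tind s as x y.
  by rewrite !amE !kmulE ctrββE !mulr1 ksum_pure ?SM ?mulrA //; lin.
by rewrite (betaP hH) ?kE.
Qed.

Lemma D1_sh V (t : V) : D1 (am_sh t) = am_sh (am_sh t).
Proof. by rewrite !amE am1 koneE amE. Qed.

(** This is coassociativity in the first factor with a spectator in V; the rebracketing [r] is
    multiplicative, so it transports the identity from H ⊗ H ⊗ H. *)
Lemma D1_coassoc V (t : (H ⊠ V)%type) :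
  am_ext Φ * D1 (D1 t) = i2 D1 (D1 t) * am_ext Φ.
Proof.
pose r (t : ((H ⊠ H ⊠ H) ⊠ V)%type) := i2 am_assoc (am_assoc t).
have rM s t' : r (s * t') = r s * r t' by rewrite /r !amM.
have rl : linear r by rewrite /r; lin.
have rext (s : (H ⊠ H ⊠ H)%type) : am_ext s = r (s ⊠ 1).
  by tind s as a s; tind s as b c; rewrite /r !amE.
tind t as h v; rewrite am_lE rext.
have -> : D1 (am_assoc (Δ h ⊠ v)) = r (D1 (Δ h) ⊠ v).
  move: (Δ h) => d; tind d as a b; rewrite /r amE !am_lE.
  by move: (Δ a) => d; tind d as x y; rewrite !amE.
have -> : i2 D1 (am_assoc (Δ h ⊠ v)) = r (i2 Δ (Δ h) ⊠ v).
  by move: (Δ h) => d; tind d as a b; rewrite /r !amE.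
by rewrite -!rM !kmulE mulr1 mul1r Delta_coassoc.
Qed.

End Nested.

Hint Extern 0 (GRing.linear_for _ (@sS _ _)) => solve [apply: lin_sS; eassumption] : lin.
Hint Extern 0 (GRing.linear_for _ (@sSinv _ _)) => solve [apply: lin_sSinv; eassumption] : lin.
Hint Extern 0 (GRing.linear_for _ (@ctrαα _ _)) => solve [apply: lin_ctrαα; eassumption] : lin.
Hint Extern 0 (GRing.linear_for _ (@ctrββ _ _)) => solve [apply: lin_ctrββ; eassumption] : lin.
Hint Extern 0 (GRing.linear_for _ (@ctrαα1 _ _ _)) => solve [apply: lin_ctrαα1; eassumption] : lin.
Hint Extern 0 (GRing.linear_for _ (@ctrββ1 _ _ _)) => solve [apply: lin_ctrββ1; eassumption] : lin.

(** * Drinfeld's elements γ and δ *)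

Section GammaDelta.
Variables (k : fieldType) (H : quasi_hopf_data k) (hH : is_quasi_hopf H).
Implicit Types V : kalgType k.
Local Notation S := (@antipode k H).
Local Notation Sinv := (@antipode_inv k H).
Local Notation α := (qh_alpha H).
Local Notation β := (qh_beta H).
Local Notation Δ := (am_Delta hH).
Local Notation D1 := (am_l Δ).
Local Notation ε1 := (epl hH).
Local Notation Φ := (kPhi H).
Local Notation Φi := (kPhii H).
Local Notation e14 := (i2 (am_comp am_sh am_sh)).

Definition γ : (H ⊠ H)%type := ctrαα (am_ext Φ * D1 Φi).
Definition δ : (H ⊠ H)%type := ctrββ (D1 Φ * am_ext Φi).

(** By the pentagon the two arguments differ by the left factor (id ⊗ Δ ⊗ id)(Φ), which the inner
    contraction erases. In this form Φ can later cancel against Φ⁻¹ under id ⊗ id ⊗ Δ. *)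
Lemma γ_alt : γ = ctrαα (am_sh Φi * i2 (i2 Δ) Φ).
Proof.
have -> : am_sh Φi * i2 (i2 Δ) Φ = i2 D1 Φ * (am_ext Φ * D1 Φi).
  have e1 := am_mul1 (am_sh (A := H)) (PhiiK hH).
  have e2 := am_mul1 D1 (PhiK hH).
  rewrite -[i2 D1 Φ]mul1r -e1 -[LHS]mulr1 -e2 -!mulrA [i2 (i2 Δ) Φ * _]mulrA.
  by rewrite -Phi_pentagon !mulrA.
by rewrite ctrαα_absl -i2_clE i2_cl_Phi mul1r.
Qed.

Lemma δ_alt : δ = ctrββ (i2 (i2 Δ) Φi * am_sh Φ).
Proof.
have -> : i2 (i2 Δ) Φi * am_sh Φ = D1 Φ * am_ext Φi * i2 D1 Φi.
  have e1 := am_mul1 (i2 (i2 Δ)) (PhiiK hH).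
  have e2 := am_mul1 (i2 D1) (PhiK hH).
  have e3 := am_mul1 (am_ext (D := H)) (PhiK hH).
  rewrite -[D1 Φ]mul1r -e1 -[_ * D1 Φ]mulrA -Phi_pentagon.
  by rewrite -!mulrA [am_ext Φ * _]mulrA e3 mul1r e2 mulr1.
by rewrite ctrββ_absr -i2_clE i2_cl_Phii mulr1.
Qed.

Definition S2 (h : H) : (H ⊠ H)%type := sS (Δ h).
Lemma lin_S2 : linear S2. Proof. by rewrite /S2; lin. Qed.
Hint Extern 0 (GRing.linear_for _ S2) => exact: lin_S2 : lin.
Lemma S2M x y : S2 (x * y) = S2 y * S2 x.
Proof. by rewrite /S2 amM sSM. Qed.
Lemma S2_1 : S2 1 = 1. Proof. by rewrite /S2 am1 sS_1. Qed.

Lemma ctrαα_D1_i2 t w :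
  ctrαα (t * D1 (i2 Δ w)) = \tsum_(a ⊗ b := w) (S2 a * ctrαα t * Δ b).
Proof.
tind w as x y; rewrite i2E am_lE ksum_pure; last by lin.
rewrite /S2; move: (Δ x) (Δ y) => u v; tind u as x1 x2; tind v as y1 y2.
tind t as a t; tind t as b t; tind t as c d.
by rewrite !(amE, kmulE, ctrααE hH, sSE hH) !SM // !mulrA.
Qed.

Lemma ctrββ_D1_i2 t w :
  ctrββ (D1 (i2 Δ w) * t) = \tsum_(a ⊗ b := w) (Δ a * ctrββ t * S2 b).
Proof.
tind w as x y; rewrite i2E am_lE ksum_pure; last by lin.
rewrite /S2; move: (Δ x) (Δ y) => u v; tind u as x1 x2; tind v as y1 y2.
tind t as a t; tind t as b t; tind t as c d.
by rewrite !(amE, kmulE, ctrββE hH, sSE hH) !SM // !mulrA.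
Qed.

(** This is the α-axiom for γ along Δ. Coassociativity used twice brings two legs of h to the inner
    pair; after they collapse, the remaining two collapse on the outer pair. *)
Lemma γP h : \tsum_(a ⊗ b := Δ h) (S2 a * γ * Δ b) = eps h *: γ.
Proof.
rewrite -ctrαα_D1_i2 -mulrA -amM Delta_coassoc_inv amM mulrA D1_coassoc.
by rewrite -mulrA ctrαα_absl i2_epl_D1 ctrαα_abs14.
Qed.

Lemma δP h : \tsum_(a ⊗ b := Δ h) (Δ a * δ * S2 b) = eps h *: δ.
Proof.
have E : D1 (D1 (Δ h)) * am_ext Φi = am_ext Φi * i2 D1 (D1 (Δ h)).
  have e1 := am_mul1 (am_ext (D := H)) (PhiiK hH).
  have e2 := am_mul1 (am_ext (D := H)) (PhiK hH).
  rewrite -[LHS]mul1r -e1 -!mulrA [am_ext Φ * _]mulrA D1_coassoc.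
  by rewrite -!mulrA e2 mulr1.
rewrite -ctrββ_D1_i2 mulrA -amM Delta_coassoc amM -mulrA E mulrA.
by rewrite ctrββ_absr i2_epl_D1 ctrββ_abs14.
Qed.

End GammaDelta.

Hint Extern 0 (GRing.linear_for _ (@S2 _ _ _)) => solve [apply: lin_S2] : lin.

(** * The five-factor identity and its nested contractions *)

Section LeftComodule.
Variables (k : fieldType) (H : quasi_hopf_data k) (hH : is_quasi_hopf H).
Variables (B : left_comodule_algebra_data H) (hB : is_left_comodule_algebra B).
Local Notation S := (@antipode k H).
Local Notation Sinv := (@antipode_inv k H).
Local Notation β := (qh_beta H).
Local Notation Δ := (am_Delta hH).
Local Notation D1 := (am_l Δ).
Local Notation ε1 := (epl hH).
Local Notation Φ := (kPhi H).
Local Notation Φi := (kPhii H).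
Local Notation λ := (am_lam hB).
Local Notation X := (lX B).
Local Notation Y := (lXi B).
Local Notation e14 := (i2 (am_comp am_sh am_sh)).

Let ring_chain (C : kalgType k) (x x' l e i g d m p p' s n f : C) :
  x * l * e = g * d -> s * n * f = p * g -> d * i = i * m -> x' * x = 1 ->
  p' * p = 1 -> f * i = 1 -> l * (e * i) = x' * p' * (s * (n * m)).
Proof.
move=> E1 E2 E3 x'K p'K fK.
rewrite -[l]mul1r -x'K -!mulrA; congr (_ * _).
rewrite !mulrA E1 -mulrA E3 -[g]mul1r -p'K -[_ * g]mulrA -E2.
by rewrite -!mulrA [f * _]mulrA fK mul1r.
Qed.

(** Two instances of the pentagon, one with Δ on the first factor and one with λ on the last, share
    the factor (Δ ⊗ id)(id ⊗ id ⊗ λ)(X); eliminating it gives the identity. The left side starts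
    with Δ(X¹) ⊗ Δ(X²) ⊗ X³, from which the nested contraction produces (Δ ⊗ id)(p) up to the
    twist. *)
Lemma lX_reassoc5 :
  D1 (i2 D1 X) * i2 am_ext (D1 Φ * am_ext Φi)
  = am_sh (am_sh Y) * i2 (i2 (am_comp (i2 λ) λ)) Y
    * (am_sh (i2 (i2 λ) X) * i2 D1 (i2 (i2 λ) X * D1 X)).
Proof.
have ea : am_sh (am_sh X) * D1 (i2 D1 X) * i2 am_ext (D1 Φ)
    = D1 (i2 (i2 λ) X) * D1 (D1 X).
  rewrite -amM -lX_pentagon !amM D1_sh; congr (_ * _ * _).
  move: Φ => t; tind t as a t; tind t as b c; rewrite !(amE, am_lE).
  by move: (Δ a) => d; tind d as x y; rewrite !amE.
have eb : am_sh (i2 (i2 λ) X) * i2 D1 (i2 (i2 λ) X) * am_ext Φ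
    = i2 (i2 (am_comp (i2 λ) λ)) X * D1 (i2 (i2 λ) X).
  have := congr1 (i2 (i2 (i2 λ))) (lX_pentagon hH hB); rewrite !amM.
  have -> : i2 (i2 (i2 λ)) (am_sh (A := H) X) = am_sh (i2 (i2 λ) X) by rewrite !amE.
  have -> : i2 (i2 (i2 λ)) (i2 D1 X) = i2 D1 (i2 (i2 λ) X).
    move: X => t; tind t as a t; tind t as b c; rewrite !(amE, am_lE).
    by move: (Δ b) => d; tind d as x y; rewrite !amE.
  have -> : i2 (i2 (i2 λ)) (am_ext Φ) = am_ext Φ.
    by move: Φ => t; tind t as a t; tind t as b c; rewrite !amE am1.
  have -> : i2 (i2 (i2 λ)) (i2 (i2 λ) X) = i2 (i2 (am_comp (i2 λ) λ)) X.
    by move: X => t; tind t as a t; tind t as b c; rewrite !amE.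
  have -> // : i2 (i2 (i2 λ)) (D1 X) = D1 (i2 (i2 λ) X).
  move: X => t; tind t as a t; tind t as b c; rewrite !(amE, am_lE).
  by move: (Δ a) => d; tind d as x y; rewrite !amE.
have ec : D1 (D1 X) * am_ext Φi = am_ext Φi * i2 D1 (D1 X).
  have e1 := am_mul1 (am_ext (D := (H ⊠ B)%type)) (PhiiK hH).
  have e2 := am_mul1 (am_ext (D := (H ⊠ B)%type)) (PhiK hH).
  rewrite -[LHS]mul1r -e1 -!mulrA [am_ext Φ * _]mulrA D1_coassoc.
  by rewrite -!mulrA e2 mulr1.
have ed : i2 am_ext (am_ext Φi) = am_ext Φi :> (H ⊠ H ⊠ H ⊠ H ⊠ B)%type.
  by move: Φi => t; tind t as a t; tind t as b c; rewrite !amE.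
have e1 : am_sh (am_sh Y) * am_sh (am_sh X) = 1 :> (H ⊠ H ⊠ H ⊠ H ⊠ B)%type.
  by rewrite -!amM lXiK // !am1.
have e2 := am_mul1 (i2 (i2 (am_comp (i2 λ) λ))) (lXiK hB).
have e3 := am_mul1 (am_ext (D := (H ⊠ B)%type)) (PhiK hH).
by rewrite amM ed [i2 D1 (_ * _)]amM (ring_chain ea eb ec e1 e2 e3).
Qed.

Lemma lX_reassoc5_inv :
  i2 am_ext (am_ext Φ * D1 Φi) * D1 (i2 D1 Y)
  = i2 D1 (D1 Y * i2 (i2 λ) Y) * am_sh (i2 (i2 λ) Y)
    * (i2 (i2 (am_comp (i2 λ) λ)) X * am_sh (am_sh X)).
Proof.
have inv (C : kalgType k) (a b a' b' : C) : a = b -> a * a' = 1 -> b' * b = 1 -> b' = a'.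
  by move=> ab aa' bb'; rewrite -[b']mulr1 -aa' ab mulrA bb' mul1r.
symmetry; apply: (inv _ _ _ _ _ lX_reassoc5).
  rewrite mulrA -[_ * _ * i2 am_ext _]mulrA -amM.
  have -> : D1 Φ * am_ext Φi * (am_ext Φ * D1 Φi) = 1.
    rewrite mulrA -[_ * _ * am_ext Φ]mulrA am_mul1 ?mulr1 ?am_mul1 //;
      by [exact: PhiK | exact: PhiiK].
  by rewrite am1 mulr1 -!amM lXK // !am1.
rewrite -!mulrA [am_sh (am_sh X) * _]mulrA.
have -> : am_sh (am_sh X) * am_sh (am_sh Y) = 1 :> (H ⊠ H ⊠ H ⊠ H ⊠ B)%type.
  by rewrite -!amM lXK // !am1.
rewrite mul1r [i2 (i2 _) X * _]mulrA (am_mul1 _ (lXK hB)) mul1r.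
rewrite [am_sh _ * (am_sh _ * _)]mulrA.
have -> : am_sh (i2 (i2 λ) Y) * am_sh (i2 (i2 λ) X) = 1 :> (H ⊠ H ⊠ H ⊠ H ⊠ B)%type.
  by rewrite -!amM lXiK // !am1.
rewrite mul1r -amM mulrA -[D1 Y * _ * _]mulrA.
by rewrite (am_mul1 _ (lXiK hB)) mulr1 (am_mul1 _ (lXiK hB)) am1.
Qed.

Lemma ctrββ1_mull t (x y : H) (u : (H ⊠ H ⊠ B)%type) :
  ctrββ1 ((x ⊠ y ⊠ u) * t) = u * ctrββ1 t * am_assoc (sSinv (x ⊠ y) ⊠ (1 : B)).
Proof.
tind t as a t; tind t as b t; tind t as c t; tind t as d v.
tind u as e u; tind u as g w.
rewrite !(kmulE, ctrββ1E hH) sSinvE // amE !kmulE !SinvM // !mulrA.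
by rewrite mulr1.
Qed.

Lemma ctrαα1_mulr t (x y : H) (u : (H ⊠ H ⊠ B)%type) :
  ctrαα1 (t * (x ⊠ y ⊠ u)) = am_assoc (sS (x ⊠ y) ⊠ (1 : B)) * ctrαα1 t * u.
Proof.
tind t as a t; tind t as b t; tind t as c t; tind t as d v.
tind u as e u; tind u as g w.
rewrite !(kmulE, ctrαα1E hH) sSE // amE !kmulE !SM // !mulrA.
by rewrite mul1r.
Qed.

Lemma ctrββ1_D1_i2_D1 (x : (H ⊠ H ⊠ B)%type) t :
  ctrββ1 (D1 (i2 D1 x) * i2 am_ext t)
  = \tsum_(a ⊗ b ⊗ c := x) am_assoc ((Δ b * sSinv (ctrββ t) * sSinv (Δ a)) ⊠ (c : B)).
Proof.
tind x as a x; tind x as b c; rewrite !(i2E, am_lE) !ksum_pure; try by lin.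
move: (Δ a) (Δ b) => u v; tind u as a1 a2; tind v as b1 b2.
tind t as x t; tind t as y t; tind t as z w.
rewrite !(am_assocE, i2E, am_extE, kmulE, ctrββ1E hH, ctrββE hH, sSinvE hH).
by rewrite !SinvM // !SK // !mulrA mulr1.
Qed.

Lemma ctrαα1_D1_i2_D1 (x : (H ⊠ H ⊠ B)%type) t :
  ctrαα1 (i2 am_ext t * D1 (i2 D1 x))
  = \tsum_(a ⊗ b ⊗ c := x) am_assoc ((S2 hH a * ctrαα t * Δ b) ⊠ (c : B)).
Proof.
tind x as a x; tind x as b c; rewrite !(i2E, am_lE) !ksum_pure; try by lin.
rewrite /S2; move: (Δ a) (Δ b) => u v; tind u as a1 a2; tind v as b1 b2.
tind t as x t; tind t as y t; tind t as z w.
rewrite !(am_assocE, i2E, am_extE, kmulE, ctrαα1E hH, ctrααE hH, sSE hH).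
by rewrite !SM // !mulrA mul1r.
Qed.

Lemma ctrββ1_sh_i2 (x y : (H ⊠ H ⊠ B)%type) :
  ctrββ1 (am_sh (i2 (i2 λ) y) * e14 x) = i2 λ (ctrβ y) * am_sh (ctrβ x).
Proof.
tind x as a x; tind x as b c; tind y as d y; tind y as e v.
rewrite !amE !(ctrβE hH) !amE; move: (λ v) => s; tind s as g w.
by rewrite !kmulE (ctrββ1E hH) !(mulr1, mul1r) !mulrA.
Qed.

Lemma ctrαα1_i2_sh (x y : (H ⊠ H ⊠ B)%type) :
  ctrαα1 (e14 x * am_sh (i2 (i2 λ) y)) = am_sh (ctrα x) * i2 λ (ctrα y).
Proof.
tind x as a x; tind x as b c; tind y as d y; tind y as e v.
rewrite !amE !(ctrαE hH) !amE; move: (λ v) => s; tind s as g w.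
by rewrite !kmulE (ctrαα1E hH) !(mulr1, mul1r) !mulrA.
Qed.

Definition lw : (H ⊠ H ⊠ B)%type := i2 λ (lp B) * am_sh (lp B).

(** The nested contraction of [lX_reassoc5]: on its right side the factor under id ⊗ Δ ⊗ id leaves
    just one X on the outer pair, and together with (id ⊗ id ⊗ λ)(X) this contracts to two copies of
    p, that is, to [lw]. *)
Lemma lX_ctrββ_sum :
  \tsum_(a ⊗ b ⊗ c := X)
    am_assoc ((Δ b * sSinv (δ hH) * sSinv (Δ a)) ⊠ (c : B))
  = \tsum_(a ⊗ b ⊗ c := Y)
      (D1 (λ c) * (Y * lw) * am_assoc (sSinv (a ⊠ b) ⊠ 1)).
Proof.
have E : e14 (i2 ε1 (i2 (i2 λ) X * D1 X)) = e14 X.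
  rewrite amM i2_epl_D1.
  have -> : i2 ε1 (i2 (i2 λ) X) = i2 λ (i2 ε1 X).
    by move: X => t; tind t as a t; tind t as b c; rewrite !(amE, eplE) amZ.
  by rewrite (i2_epl_lX hH hB) am1 mul1r.
(* Coassociativity of λ lets X⁻¹ pass to the right, converting an iterated λ into (Δ ⊗ id)λ. *)
have F (x : (H ⊠ H ⊠ B)%type) : am_sh (am_sh Y) * i2 (i2 (am_comp (i2 λ) λ)) x
    = i2 (i2 (am_comp D1 λ)) x * am_sh (am_sh Y).
  tind x as a x; tind x as b c; rewrite !amE !kmulE !mul1r !mulr1.
  by rewrite (lam_coassoc_inv hH hB).
have G (x : (H ⊠ H ⊠ B)%type) t : ctrββ1 (i2 (i2 (am_comp D1 λ)) x * t)
    = \tsum_(a ⊗ b ⊗ c := x) (D1 (λ c) * ctrββ1 t * am_assoc (sSinv (a ⊠ b) ⊠ 1)).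
  by tind x as a x; tind x as b c; rewrite !ksum_pure ?amE ?ctrββ1_mull //; lin.
have ctrββ1_sh2 (u : (H ⊠ H ⊠ B)%type) t : ctrββ1 (am_sh (am_sh u) * t) = u * ctrββ1 t.
  rewrite !amE ctrββ1_mull sSinvE // Sinv1 // amE.
  by rewrite -[1 ⊠ _]/(1 : (H ⊠ H ⊠ B)%type) mulr1.
rewrite /δ -ctrββ1_D1_i2_D1 lX_reassoc5 mulrA (ctrββ1_absr hH) E -mulrA F -mulrA G.
apply: eq_tsum => a t; apply: eq_tsum => b c.
by rewrite ctrββ1_sh2 ctrββ1_sh_i2.
Qed.

Lemma lX_ctrαα_sum :
  \tsum_(a ⊗ b ⊗ c := Y) am_assoc ((S2 hH a * γ hH * Δ b) ⊠ (c : B))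
  = \tsum_(a ⊗ b ⊗ c := X)
      (am_assoc (sS (a ⊠ b) ⊠ 1) * (am_sh (lq B) * i2 λ (lq B) * X) * D1 (λ c)).
Proof.
have E : e14 (i2 ε1 (D1 Y * i2 (i2 λ) Y)) = e14 Y.
  rewrite amM i2_epl_D1.
  have -> : i2 ε1 (i2 (i2 λ) Y) = i2 λ (i2 ε1 Y).
    by move: Y => t; tind t as a t; tind t as b c; rewrite !(amE, eplE) amZ.
  by rewrite (am_inv (i2_epl_lX hH hB) (lXK hB)) am1 mulr1.
have F (x : (H ⊠ H ⊠ B)%type) : i2 (i2 (am_comp (i2 λ) λ)) x * am_sh (am_sh X)
    = am_sh (am_sh X) * i2 (i2 (am_comp D1 λ)) x.
  tind x as a x; tind x as b c; rewrite !amE !kmulE !mul1r !mulr1.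
  by rewrite (lam_coassoc hH hB).
have G (x : (H ⊠ H ⊠ B)%type) t : ctrαα1 (t * i2 (i2 (am_comp D1 λ)) x)
    = \tsum_(a ⊗ b ⊗ c := x) (am_assoc (sS (a ⊠ b) ⊠ 1) * ctrαα1 t * D1 (λ c)).
  by tind x as a x; tind x as b c; rewrite !ksum_pure ?amE ?ctrαα1_mulr //; lin.
have ctrαα1_sh2 (u : (H ⊠ H ⊠ B)%type) t : ctrαα1 (t * am_sh (am_sh u)) = ctrαα1 t * u.
  rewrite !amE ctrαα1_mulr sSE // S1 // amE.
  by rewrite -[1 ⊠ _]/(1 : (H ⊠ H ⊠ B)%type) mul1r.
rewrite /γ -ctrαα1_D1_i2_D1 lX_reassoc5_inv -mulrA (ctrαα1_absl hH) E F 2!mulrA G.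
apply: eq_tsum => a t; apply: eq_tsum => b c.
by rewrite ctrαα1_sh2 ctrαα1_i2_sh.
Qed.

End LeftComodule.

(** * The Drinfeld twist as an intertwiner of two antipodes along Δ *)

Section Twist.
Variables (k : fieldType) (H : quasi_hopf_data k) (hH : is_quasi_hopf H).
Local Notation S := (@antipode k H).
Local Notation Sinv := (@antipode_inv k H).
Local Notation α := (qh_alpha H).
Local Notation β := (qh_beta H).
Local Notation Δ := (am_Delta hH).
Local Notation D1 := (am_l Δ).
Local Notation ε1 := (epl hH).
Local Notation Φ := (kPhi H).
Local Notation Φi := (kPhii H).
Local Notation γ := (γ hH).
Local Notation δ := (δ hH).
Local Notation S2 := (S2 hH).
Local Notation e14 := (i2 (am_comp am_sh am_sh)).

Definition hp : (H ⊠ H)%type := ctrβ Φ.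
Definition hq : (H ⊠ H)%type := ctrα Φi.
Definition hw : (H ⊠ H ⊠ H)%type := i2 Δ hp * am_sh hp.

Lemma hq_hp : \tsum_(h ⊗ b := hp) (S h ⊠ 1) * hq * Δ b = 1.
Proof. exact: (lp_lq hH (regularP hH)). Qed.

Lemma Phi_ctrαβ : ctrαβ (i2 (i2 Δ) Φi * am_sh Φ) = 1.
Proof. exact: (ctrαβ_reassoc hH (regularP hH)). Qed.

Lemma Phi_ctrββ_sum :
  \tsum_(a ⊗ b ⊗ c := Φ) am_assoc ((Δ b * sSinv δ * sSinv (Δ a)) ⊠ c)
  = \tsum_(a ⊗ b ⊗ c := Φi)
      (D1 (Δ c) * (Φi * hw) * am_assoc (sSinv (a ⊠ b) ⊠ 1)).
Proof. exact: (lX_ctrββ_sum hH (regularP hH)). Qed.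

Lemma Phi_ctrαα_sum :
  \tsum_(a ⊗ b ⊗ c := Φi) am_assoc ((S2 a * γ * Δ b) ⊠ c)
  = \tsum_(a ⊗ b ⊗ c := Φ)
      (am_assoc (sS (a ⊠ b) ⊠ 1) * (am_sh hq * i2 Δ hq * Φ) * D1 (Δ c)).
Proof. exact: (lX_ctrαα_sum hH (regularP hH)). Qed.

Lemma hp_α : \tsum_(a ⊗ b := hp) (S a * α * b : H) = 1.
Proof.
have E : \tsum_(a ⊗ b ⊗ c := Φ) (a * β * S b * α * c : H) = 1 := qh_Phi_antipode hH.
rewrite /hp -[RHS]E; move: Φ => t; tind t as a t; tind t as b c.
by rewrite (ctrβE hH) !ksum_pure ?SM ?SinvK ?mulrA //; lin.
Qed.

Lemma hq_β : \tsum_(a ⊗ b := hq) (a * β * S b : H) = 1.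
Proof.
have E : \tsum_(a ⊗ b ⊗ c := Φi) (S a * α * b * β * S c : H) = 1 :=
  qh_Phi_inv_antipode hH.
rewrite /hq -[RHS]E; move: Φi => t; tind t as a t; tind t as b c.
by rewrite (ctrαE hH) !ksum_pure //; lin.
Qed.

Lemma Phi_epr : \tsum_(a ⊗ b ⊗ c := Φ) (eps c *: (a ⊠ b)) = 1 :> (H ⊠ H)%type.
Proof.
rewrite -[RHS](i2_epr_Phi hH); move: Φ => t; tind t as a t; tind t as b c.
by rewrite !amE eprE kpureZr !ksum_pure //; lin.
Qed.

Lemma Phii_epr : \tsum_(a ⊗ b ⊗ c := Φi) (eps c *: (a ⊠ b)) = 1 :> (H ⊠ H)%type.
Proof.
rewrite -[RHS](am_inv (i2_epr_Phi hH) (PhiK hH)).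
move: Φi => t; tind t as a t; tind t as b c.
by rewrite !amE eprE kpureZr !ksum_pure //; lin.
Qed.

Let ν (t : (H ⊠ H ⊠ H)%type) : (H ⊠ H)%type :=
  \tsum_(a ⊗ b ⊗ c := t) (sS (a ⊠ b) * γ * Δ c).
Let lin_ν : linear ν. Proof. by rewrite /ν; lin. Qed.
Hint Extern 0 (GRing.linear_for _ ν) => exact: lin_ν : lin.
Let νE u c : ν (am_assoc (u ⊠ c)) = sS u * γ * Δ c.
Proof. by tind u as a b; rewrite amE /ν !ksum_pure //; lin. Qed.

Let ν_ctrαα t : ν t = ctrαα (am_sh Φi * i2 (i2 Δ) Φ * i2 (i2 Δ) t).
Proof.
tind t as a t; tind t as b c; rewrite -[a ⊠ b ⊠ c]am_assocE νE !amE γ_alt.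
move: (am_sh Φi * _) (Δ c) => s d; tind d as x y.
tind s as e s; tind s as f s; tind s as g h.
by rewrite !(kmulE, ctrααE hH, sSE hH) !SM // !mulrA.
Qed.

Let ν_Delta h t : ν (D1 (Δ h) * t) = eps h *: ν t.
Proof.
tind t as a t; tind t as b c; rewrite -[a ⊠ b ⊠ c]am_assocE νE.
transitivity (sS (a ⊠ b) * (\tsum_(x ⊗ y := Δ h) (S2 x * γ * Δ y)) * Δ c).
  rewrite /S2; move: (Δ h) => s; tind s as x y; rewrite am_lE.
  by rewrite -amM kmulE νE sSM // amM ksum_pure ?mulrA //; lin.
by rewrite γP ?kE.
Qed.

Let ν_mulr t u : ν (t * am_assoc (u ⊠ 1)) = sS u * ν t.
Proof.
tind t as a t; tind t as b c; rewrite -[a ⊠ b ⊠ c]am_assocE -amM kmulE !νE.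
by rewrite mulr1 sSM // !mulrA.
Qed.

(** The sum is the image under [ν] of the left side of [Phi_ctrββ_sum]. On the right side [γP]
    reduces each (Δ ⊗ id)Δ(c) to ε(c), hence the outer Φ⁻¹ to 1. In the remaining ν(Φ⁻¹ w), [γ_alt]
    makes Φ and Φ⁻¹ cancel; of the two copies of p in w, one closes with α and the other with q. *)
Lemma Phi_γδ :
  \tsum_(a ⊗ b ⊗ c := Φ) (Δ a * δ * S2 b * γ * Δ c : (H ⊠ H)%type) = 1.
Proof.
transitivity (ν (\tsum_(a ⊗ b ⊗ c := Φ)
    am_assoc ((Δ b * sSinv δ * sSinv (Δ a)) ⊠ c))).
  move: Φ => t; tind t as a t; tind t as b c.
  by rewrite !ksum_pure ?νE ?sSM ?sSinvK ?mulrA //; lin.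
rewrite Phi_ctrββ_sum.
transitivity ((\tsum_(a ⊗ b ⊗ c := Φi) (eps c *: (a ⊠ b)) : (H ⊠ H)%type)
    * ν (Φi * hw)).
  move: (Φi * hw) => v; move: Φi => t; tind t as a t; tind t as b c.
  rewrite !ksum_pure; try by lin.
  by rewrite ν_mulr ν_Delta sSinvK // kscalerAr kscalerAl.
rewrite Phii_epr mul1r ν_ctrαα amM mulrA.
rewrite -[_ * i2 (i2 Δ) Φi]mulrA am_mul1 ?PhiK // mulr1.
(* Coassociativity carries Φ⁻¹ past the first copy of p, so that its comultiplied legs come to the
   far left, where the inner pair absorbs them. *)
have E1 : am_sh Φi * i2 (i2 Δ) hw = i2 D1 (i2 Δ hp) * am_sh (Φi * i2 Δ hp).
  rewrite /hw !amM mulrA.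
  have -> : i2 (i2 Δ) (am_sh (A := H) hp) = am_sh (i2 Δ hp) by rewrite !amE.
  rewrite mulrA; congr (_ * _).
  move: hp => t; tind t as a b; rewrite !amE !kmulE !mulr1 mul1r.
  by rewrite Delta_coassoc_inv.
rewrite E1 ctrαα_absl //.
have -> : i2 ε1 (i2 Δ hp) = hp by rewrite i2_comp i2_idE // => h; exact: epl_Delta.
have E2 (t : (H ⊠ H)%type) u : ctrαα (e14 t * am_sh u)
    = (1 ⊠ \tsum_(a ⊗ b := t) (S a * α * b)) * ctrα u.
  tind t as a b; tind u as x u; tind u as y z.
  rewrite !amE !kmulE (ctrααE hH) (ctrαE hH) ksum_pure; last by lin.
  by rewrite !(mul1r, mulr1) kmulE mul1r mulrA.
by rewrite E2 hp_α mul1r (ctrα_i2_lam hH (regularP hH)) hq_hp.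
Qed.

Let ν' (t : (H ⊠ H ⊠ H)%type) : (H ⊠ H)%type :=
  \tsum_(a ⊗ b ⊗ c := t) ((a ⊠ b) * δ * S2 c).
Let lin_ν' : linear ν'. Proof. by rewrite /ν'; lin. Qed.
Hint Extern 0 (GRing.linear_for _ ν') => exact: lin_ν' : lin.
Let ν'E u c : ν' (am_assoc (u ⊠ c)) = u * δ * S2 c.
Proof. by tind u as a b; rewrite amE /ν' !ksum_pure //; lin. Qed.

Let ν'_ctrββ t : ν' t = ctrββ (i2 (i2 Δ) t * (i2 (i2 Δ) Φi * am_sh Φ)).
Proof.
tind t as a t; tind t as b c; rewrite -[a ⊠ b ⊠ c]am_assocE ν'E !amE δ_alt /S2.
move: (_ * am_sh Φ) (Δ c) => s d; tind d as x y.
tind s as e s; tind s as f s; tind s as g h.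
by rewrite !(kmulE, ctrββE hH, sSE hH) !SM // !mulrA.
Qed.

Let ν'_Delta h t : ν' (t * D1 (Δ h)) = eps h *: ν' t.
Proof.
tind t as a t; tind t as b c; rewrite -[a ⊠ b ⊠ c]am_assocE ν'E.
transitivity ((a ⊠ b) * (\tsum_(x ⊗ y := Δ h) (Δ x * δ * S2 y)) * S2 c).
  move: (Δ h) => s; tind s as x y; rewrite am_lE.
  by rewrite -amM kmulE ν'E S2M ksum_pure ?mulrA //; lin.
by rewrite δP ?kE.
Qed.

Let ν'_mull t u : ν' (am_assoc (u ⊠ 1) * t) = u * ν' t.
Proof.
tind t as a t; tind t as b c; rewrite -[a ⊠ b ⊠ c]am_assocE -amM kmulE !ν'E.
by rewrite mul1r !mulrA.
Qed.

(** The mirror image of the preceding argument, with [ν'], [δP] and [δ_alt]: of the two copies of q,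
    one closes with β, and the other combines with Φ into the fourfold contraction of
    [Phi_ctrαβ]. *)
Lemma Phii_γδ :
  \tsum_(a ⊗ b ⊗ c := Φi) (S2 a * γ * Δ b * δ * S2 c : (H ⊠ H)%type) = 1.
Proof.
transitivity (ν' (\tsum_(a ⊗ b ⊗ c := Φi) am_assoc ((S2 a * γ * Δ b) ⊠ c))).
  move: Φi => t; tind t as a t; tind t as b c.
  by rewrite !ksum_pure ?ν'E //; lin.
rewrite Phi_ctrαα_sum.
transitivity (sS (\tsum_(a ⊗ b ⊗ c := Φ) (eps c *: (a ⊠ b)))
    * ν' (am_sh hq * i2 Δ hq * Φ)).
  move: (_ * Φ) => v; move: Φ => t; tind t as a t; tind t as b c.
  rewrite !ksum_pure; try by lin.
  by rewrite ν'_Delta ν'_mull linZ ?kscalerAl //; lin.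
rewrite Phi_epr sS_1 // mul1r ν'_ctrββ amM.
rewrite -[_ * i2 (i2 Δ) Φ * _]mulrA [i2 (i2 Δ) Φ * _]mulrA am_mul1 ?PhiK // mul1r.
have E1 : i2 (i2 Δ) (am_sh hq * i2 Δ hq) * am_sh Φ
    = am_sh (i2 Δ hq * Φ) * i2 D1 (i2 Δ hq).
  rewrite !amM.
  have -> : i2 (i2 Δ) (am_sh (A := H) hq) = am_sh (i2 Δ hq) by rewrite !amE.
  rewrite -!mulrA; congr (_ * _).
  move: hq => t; tind t as a b; rewrite !amE !kmulE !mulr1 mul1r.
  by rewrite Delta_coassoc.
rewrite E1 ctrββ_absr //.
have -> : i2 ε1 (i2 Δ hq) = hq by rewrite i2_comp i2_idE // => h; exact: epl_Delta.
have E2 (t : (H ⊠ H)%type) u : ctrββ (am_sh u * e14 t)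
    = ((\tsum_(a ⊗ b := t) (a * β * S b)) ⊠ 1)
      * (\tsum_(a ⊗ b ⊗ c := u) (S c ⊠ (a * β * S b))).
  tind t as a b; tind u as x u; tind u as y z.
  rewrite !amE !kmulE (ctrββE hH) !ksum_pure; try by lin.
  by rewrite !(mul1r, mulr1) kmulE mul1r SM // !mulrA.
rewrite E2 hq_β mul1r.
transitivity (\tsum_(a ⊗ b := ctrαβ (i2 (i2 Δ) Φi * am_sh Φ)) (S b ⊠ a)).
  rewrite /hq; move: Φ => v; move: Φi => t.
  tind t as a t; tind t as b c; tind v as x v; tind v as y z.
  rewrite (ctrαE hH) !amE; move: (Δ c) => s; tind s as d e.
  rewrite !kmulE (ctrαβE hH) !ksum_pure; try by lin. by rewrite !mulrA mulr1.
by rewrite Phi_ctrαβ ksum_pure ?S1 //; lin.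
Qed.

Definition antipode_left : relative_antipode hH Δ.
Proof.
apply: (@RelativeAntipode _ _ hH _ Δ (fun h => Δ (S h)) (Δ α) (Δ β)).
- by lin.
- by rewrite S1 // am1.
- by move=> x y; rewrite SM // amM.
- move=> h; rewrite -amZ -(alphaP hH); move: (Δ h) => t; tind t as a b.
  by rewrite !ksum_pure ?amM //; lin.
- move=> h; rewrite -amZ -(betaP hH); move: (Δ h) => t; tind t as a b.
  by rewrite !ksum_pure ?amM //; lin.
- have E : \tsum_(a ⊗ b ⊗ c := Φ) (a * β * S b * α * c : H) = 1 :=
    qh_Phi_antipode hH.
  rewrite -[RHS](am1 Δ) -E; move: Φ => t; tind t as a t; tind t as b c.
  by rewrite !ksum_pure ?amM //; lin.
- have E : \tsum_(a ⊗ b ⊗ c := Φi) (S a * α * b * β * S c : H) = 1 :=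
    qh_Phi_inv_antipode hH.
  rewrite -[RHS](am1 Δ) -E; move: Φi => t; tind t as a t; tind t as b c.
  by rewrite !ksum_pure ?amM //; lin.
Defined.

Definition antipode_right : relative_antipode hH Δ :=
  RelativeAntipode (lin_S2 hH) (S2_1 hH) (S2M hH) (γP hH) (δP hH) Phi_γδ Phii_γδ.

Definition twist : (H ⊠ H)%type := drinfeld_twist H.
Definition twist_inv : (H ⊠ H)%type := ra_twist antipode_right antipode_left.

(** Once Δ(x² β S(x³)) is expanded, Drinfeld's formula is literally the intertwiner of the two
    antipodes, and its inverse is the intertwiner in the other direction. *)
Lemma twistE : twist = ra_twist antipode_left antipode_right.
Proof.
rewrite /ra_twist /=.
have Eγ : twist_gamma H = γ.
  by rewrite /twist_gamma /γ am_ext_sum am_l_sum3.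
apply: eq_tsum => a t; apply: eq_tsum => b c.
have -> : S2 a * γ * Δ b * Δ β * Δ (S c) = S2 a * γ * Δ (b * β * S c).
  by rewrite !amM !mulrA.
by rewrite Eγ.
Qed.

Lemma twistK : twist_inv * twist = 1.
Proof. by rewrite twistE; exact: ra_twistK. Qed.
Lemma twist_invK : twist * twist_inv = 1.
Proof. by rewrite twistE; exact: ra_twistK. Qed.
Lemma twist_S h : twist * Δ (S h) = S2 h * twist.
Proof. by rewrite twistE; exact: (ra_twist_S antipode_left antipode_right). Qed.
Lemma twist_β : Δ β = δ * twist.
Proof. by rewrite twistE; exact: (ra_twist_β antipode_left antipode_right). Qed.

(** The intertwining property at S⁻¹(β), with Δ(β) = δ f, gives (S ⊗ S)Δ^cop(S⁻¹(β)) = f δ. *)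
Lemma twist_δ : sSinv δ * sSinv twist = Δ (Sinv β).
Proof.
rewrite -sSinvM //; apply: (can_inj (sSK hH)); rewrite sSinvK // -/(S2 _).
have := twist_S (Sinv β); rewrite SinvK // twist_β mulrA.
by move/(congr1 (fun t => t * twist_inv)); rewrite -!mulrA twist_invK !mulr1.
Qed.

Lemma twist_Sinv h : sSinv twist * Δ (Sinv h) = sSinv (Δ h) * sSinv twist.
Proof.
rewrite -[Δ (Sinv h)](sSK hH) -sSinvM // -/(S2 _) -twist_S SinvK //.
by rewrite sSinvM.
Qed.

End Twist.

Section TwistComodule.
Variables (k : fieldType) (H : quasi_hopf_data k) (hH : is_quasi_hopf H).
Variables (B : left_comodule_algebra_data H) (hB : is_left_comodule_algebra B).
Local Notation Δ := (am_Delta hH).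
Local Notation D1 := (am_l Δ).
Local Notation λ := (am_lam hB).

(** In Δ(X² S⁻¹(β) S⁻¹(X¹)) the twist replaces Δ(S⁻¹(β)) by its δ-form and moves right past
    Δ(S⁻¹(X¹)); what precedes it is the left side of [lX_ctrββ_sum]. *)
Lemma Delta_lp :
  D1 (lp B) = \tsum_(a ⊗ b ⊗ c := lXi B)
    (D1 (λ c) * (lXi B * lw hB) * am_assoc (sSinv (twist H * (a ⊠ b)) ⊠ 1)).
Proof.
transitivity ((\tsum_(a ⊗ b ⊗ c := lX B)
    am_assoc ((Δ b * sSinv (δ hH) * sSinv (Δ a)) ⊠ (c : B)))
    * am_assoc (sSinv (twist H) ⊠ 1)).
  rewrite /lp; move: (lX B) => t; tind t as a t; tind t as b c.
  rewrite (ctrβE hH) !ksum_pure; try by lin.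
  rewrite -amM kmulE mulr1 -!mulrA -twist_Sinv // [sSinv (δ hH) * _]mulrA.
  by rewrite twist_δ -!amM am_lE.
rewrite lX_ctrββ_sum (linear_tsum _ _ (mulr_lin _)); apply: eq_tsum => a t.
rewrite (linear_tsum _ _ (mulr_lin _)); apply: eq_tsum => b c.
by rewrite -!mulrA -amM kmulE mulr1 -sSinvM.
Qed.

End TwistComodule.

(** * Bicomodule algebras *)

Section Bicomodule.
Variables (k : fieldType) (H : quasi_hopf_data k) (hH : is_quasi_hopf H).
Variables (A : bicomodule_algebra_data H) (hA : is_bicomodule_algebra A).
Local Notation Sinv := (@antipode_inv k H).
Local Notation Δ := (am_Delta hH).
Local Notation D1 := (am_l Δ).
Local Notation ε1 := (epl hH).
Local Notation hL := (bca_left_comodule hA).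

Definition b_lam : amor A (H ⊠ A) := Amor (lca_alg_map (bca_left_comodule hA)).
Definition b_rho : amor A (A ⊠ H) := Amor (rca_alg_map (bca_right_comodule hA)).
Local Notation λ := b_lam.
Local Notation ρ := b_rho.
Definition bX : (H ⊠ H ⊠ A)%type := Phi_lambda A.
Definition bY : (H ⊠ H ⊠ A)%type := inverse (Phi_lambda A).
Definition rX : (A ⊠ H ⊠ H)%type := Phi_rho A.
Definition rY : (A ⊠ H ⊠ H)%type := inverse (Phi_rho A).
Definition bΘ : (H ⊠ A ⊠ H)%type := Phi_lambda_rho A.
Definition bθ : (H ⊠ A ⊠ H)%type := inverse (Phi_lambda_rho A).
Definition bp : (H ⊠ A)%type := ctrβ bX.
Definition bq : (H ⊠ A)%type := ctrα bY.
Definition bw : (H ⊠ H ⊠ A)%type := i2 λ bp * am_sh bp.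

Lemma bXK : bX * bY = 1. Proof. exact: (lXK hL). Qed.
Lemma rXK : rX * rY = 1.
Proof. by have [] := inverseP (rca_Phi_inv (bca_right_comodule hA)). Qed.
Lemma rYK : rY * rX = 1.
Proof. by have [] := inverseP (rca_Phi_inv (bca_right_comodule hA)). Qed.
Lemma bΘK : bΘ * bθ = 1. Proof. by have [] := inverseP (bca_Phi_inv hA). Qed.
Lemma bθK : bθ * bΘ = 1. Proof. by have [] := inverseP (bca_Phi_inv hA). Qed.

Lemma b_lam_coassoc_inv u : bY * i2 λ (λ u) = D1 (λ u) * bY.
Proof. exact: (lam_coassoc_inv hH hL u). Qed.
Lemma bp_lam u : \tsum_(h ⊗ c := λ u) λ c * bp * (Sinv h ⊠ 1) = bp * (1 ⊠ u).
Proof. exact: (lp_lam hH hL u). Qed.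
Lemma bq_lam u : \tsum_(h ⊗ c := λ u) (antipode h ⊠ 1) * bq * λ c = (1 ⊠ u) * bq.
Proof. exact: (lq_lam hH hL u). Qed.
Lemma bq_bp : \tsum_(h ⊗ b := bq) λ b * bp * (Sinv h ⊠ 1) = 1.
Proof. exact: (lq_lp hH hL). Qed.
Lemma bp_bq : \tsum_(h ⊗ b := bp) (antipode h ⊠ 1) * bq * λ b = 1.
Proof. exact: (lp_lq hH hL). Qed.
Lemma epl_bp : ε1 bp = 1. Proof. exact: (epl_lp hH hL). Qed.
Lemma epl_bq : ε1 bq = 1. Proof. exact: (epl_lq hH hL). Qed.
Lemma Delta_bp :
  D1 bp = \tsum_(a ⊗ b ⊗ c := bY)
    (D1 (λ c) * (bY * bw) * am_assoc (sSinv (twist H * (a ⊠ b)) ⊠ 1)).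
Proof. exact: (Delta_lp hH hL). Qed.
Lemma epl_b_lam u : ε1 (λ u) = u. Proof. exact: (epl_lam hH hL). Qed.
Lemma i2_epl_bX : i2 ε1 bX = 1. Proof. exact: (i2_epl_lX hH hL). Qed.

Lemma b_rho_coassoc u : rX * am_l ρ (ρ u) = i2 Δ (ρ u) * rX.
Proof.
rewrite am_lsum i2_sum.
have E : \tsum_(a ⊗ h := ρ u) (a ⊠ Δ h)
    = \tsum_(a ⊗ h := ρ u) \tsum_(h1 ⊗ h2 := Δ h) (a ⊠ h1 ⊠ h2).
  by apply: eq_tsum => a h; rewrite -[Δ h in LHS]ksumE kpure_tsumr.
rewrite E; exact: (rca_coassoc (bca_right_comodule hA) u).
Qed.

Lemma b_rho_coassoc_inv u : rY * i2 Δ (ρ u) = am_l ρ (ρ u) * rY.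
Proof.
rewrite -[RHS]mul1r -rYK -!mulrA; congr (_ * _).
by rewrite mulrA b_rho_coassoc -mulrA rXK mulr1.
Qed.

Lemma bΘ_compat_inv u : bθ * i2 ρ (λ u) = am_l λ (ρ u) * bθ.
Proof.
have E : bΘ * am_l λ (ρ u) = i2 ρ (λ u) * bΘ.
  rewrite am_lsum i2_sum.
  have F : \tsum_(h ⊗ a := λ u) (h ⊠ ρ a)
      = \tsum_(h ⊗ a := λ u) \tsum_(a0 ⊗ g := ρ a) (h ⊠ a0 ⊠ g).
    by apply: eq_tsum => h a; rewrite -[ρ a in LHS]ksumE kpure_tsumr.
  rewrite F; exact: (bca_compat hA u).
rewrite -[RHS]mul1r -bθK -!mulrA; congr (_ * _).
by rewrite mulrA E -mulrA bΘK mulr1.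
Qed.

Lemma bΘ_pentagon :
  am_sh bΘ * i2 (am_l λ) bΘ * am_ext bX = i2 (i2 ρ) bX * D1 bΘ.
Proof.
rewrite i2_l_sum i2_i2_sum am_ext_sum am_l_sum3.
exact: (bca_pentagon_left hA).
Qed.

(** As for Φ: ε on the second factor of the left pentagon leaves (1 ⊗ (ε ⊗ id ⊗ id)(Θ)) Θ = Θ. *)
Lemma epl_bΘ : ε1 bΘ = 1.
Proof.
have := congr1 (i2 ε1) bΘ_pentagon; rewrite !amM.
have -> : i2 ε1 (i2 (am_l λ) bΘ) = bΘ.
  rewrite i2_comp i2_idE // => t; tind t as a h; rewrite am_compE am_lE.
  rewrite -[a in RHS]epl_b_lam; move: (λ a) => s; tind s as x y.
  by rewrite amE !eplE kpureZl.
have -> : i2 ε1 (am_ext bX) = 1 :> (H ⊠ A ⊠ H)%type.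
  rewrite -(am1 (i2 (am_in (B := H)))) -i2_epl_bX.
  move: bX => t; tind t as a t; tind t as b c.
  by rewrite !amE !eplE !(kpureZl, kpureZr).
have -> : i2 ε1 (i2 (i2 ρ) bX) = 1.
  rewrite -(am1 (i2 ρ)) -i2_epl_bX.
  move: bX => t; tind t as a t; tind t as b c.
  by rewrite !amE !eplE amZ.
rewrite i2_epl_D1 mulr1 mul1r => /(congr1 (fun t => t * bθ)).
rewrite -mulrA bΘK mulr1 amE i2E => E.
by rewrite -[LHS](epl_sh hH) amE E koneE eplE eps1 // scale1r.
Qed.

(** The left pentagon trades Θ for θ. This is needed because the Yetter-Drinfeld axiom contains θ,
    whereas the reassociator of [A2] contains Θ. *)
Lemma ctrβ_bΘ : ctrβ (i2 (am_l λ) bΘ * am_ext bX) = bθ * i2 ρ bp.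
Proof.
have -> : i2 (am_l λ) bΘ * am_ext bX = am_sh bθ * (i2 (i2 ρ) bX * D1 bΘ).
  by rewrite -bΘ_pentagon !mulrA am_mul1 ?mul1r // bθK.
rewrite mulrA ctrβ_absr // /cl !am_compE epl_bΘ !am1 mulr1.
rewrite amE ctrβ_mull // Sinv1 // -[1 ⊠ 1]/(1 : (H ⊠ A ⊠ H)%type) mulr1.
congr (_ * _); rewrite /bp; move: bX => t; tind t as a t; tind t as b c.
by rewrite !amE !(ctrβE hH) !amE.
Qed.

(* Right multiplication by [bw] is undone by the left coaction. *)
Lemma bq_bw :
  \tsum_(h ⊗ b := bq) \tsum_(g ⊗ c := bq) \tsum_(e ⊗ d := λ b)
    i2 λ (λ (c * d)) * bw * (Sinv (g * e) ⊠ Sinv h ⊠ 1) = 1.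
Proof.
have E b : \tsum_(g ⊗ c := bq) \tsum_(e ⊗ d := λ b)
    λ (c * d) * bp * (Sinv (g * e) ⊠ 1) = 1 ⊠ b.
  rewrite -[RHS]mul1r -bq_bp (linear_tsum _ _ (mulr_lin _)).
  apply: eq_tsum => g c; rewrite -mulrA kmulE mulr1 mul1r.
  transitivity (λ c * (bp * (1 ⊠ b)) * (Sinv g ⊠ 1)); last first.
    by rewrite -!mulrA kmulE mul1r mulr1.
  rewrite -bp_lam; move: (λ b) => s; tind s as e d.
  rewrite !ksum_pure; try by lin.
  by rewrite SinvM // amM -!mulrA kmulE mulr1.
transitivity (am_sh (\tsum_(h ⊗ b := bq) λ b * bp * (Sinv h ⊠ 1)) : (H ⊠ H ⊠ A)%type).
  rewrite (linear_tsum _ _ (am_lin am_sh)); apply: eq_tsum => h b.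
  transitivity (i2 λ ((1 : H) ⊠ b) * am_sh (bp * (Sinv h ⊠ 1))); last first.
    by rewrite !amE kmulE mul1r mulrA.
  rewrite -E /bw; move: (λ b) => s; tind s as e d; move: bq => t.
  tind t as g c; rewrite !ksum_pure; try by lin.
  rewrite !amM -!mulrA !amE; congr (_ * (_ * _)).
  by rewrite am1 !kmulE !(mul1r, mulr1).
by rewrite bq_bp am1.
Qed.

End Bicomodule.

(** * Coactions *)

Lemma lin_bilr (k : fieldType) (U V W : lmodType k) (F : U -> V -> W) :
  is_bilinear F -> forall u, linear (F u).
Proof. by case. Qed.

Section Coaction.
Variables (k : fieldType) (H : quasi_hopf_data k) (hH : is_quasi_hopf H).
Variables (A : bicomodule_algebra_data H) (hA : is_bicomodule_algebra A).
Variables (C : bimodule_coalgebra_data H) (hC : is_bimodule_coalgebra C).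
Variables (M : lmodType k) (act : A -> M -> M) (hact : is_left_action act).
Local Notation Sinv := (@antipode_inv k H).
Local Notation Δ := (am_Delta hH).
Local Notation D1 := (am_l Δ).
Local Notation ε1 := (epl hH).
Local Notation λ := (b_lam hA).
Local Notation ρ := (b_rho hA).
Local Notation lact := (@bmc_lact k H C).
Local Notation ract := (@bmc_ract k H C).
Local Notation bX := (bX A).
Local Notation bY := (bY A).
Local Notation rX := (rX A).
Local Notation rY := (rY A).
Local Notation bΘ := (bΘ A).
Local Notation bθ := (bθ A).
Local Notation bp := (bp A).
Local Notation bq := (bq A).
Local Notation bw := (bw hA).

Let bil_act : is_bilinear act. Proof. by case: hact. Qed.
Let act1 m : act 1 m = m. Proof. by case: hact. Qed.
Let actM a b m : act (a * b) m = act a (act b m). Proof. by case: hact. Qed.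
Let bil_lact : is_bilinear lact. Proof. by case: (bmc_lactP hC). Qed.
Let lact1 c : lact 1 c = c. Proof. by case: (bmc_lactP hC). Qed.
Let lactM a b c : lact (a * b) c = lact a (lact b c).
Proof. by case: (bmc_lactP hC). Qed.
Let bil_ract : is_bilinear ract. Proof. by case: (bmc_ractP hC). Qed.
Let ract1 c : ract c 1 = c. Proof. by case: (bmc_ractP hC). Qed.
Let ractM a b c : ract c (a * b) = ract (ract c a) b.
Proof. by case: (bmc_ractP hC). Qed.
Let lract a c b : ract (lact a c) b = lact a (ract c b).
Proof. exact: bmc_actA. Qed.

Hint Extern 0 (is_bilinear act) => exact: bil_act : lin.
Hint Extern 0 (is_bilinear lact) => exact: bil_lact : lin.
Hint Extern 0 (is_bilinear ract) => exact: bil_ract : lin.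
Hint Extern 0 (GRing.linear_for _ (act _)) => exact (lin_bilr bil_act _) : lin.
Hint Extern 0 (GRing.linear_for _ (@bmc_lact _ _ _ _)) => exact (lin_bilr bil_lact _) : lin.
Hint Extern 0 (GRing.linear_for _ (@bmc_ract _ _ _ _)) => exact (lin_bilr bil_ract _) : lin.
Hint Extern 0 (GRing.linear_for _ (@bmc_Delta _ _ _)) =>
  exact (bmc_Delta_linear hC) : lin.

Definition mc_l (s : (A ⊠ H)%type) (z : M ⊗ C) : M ⊗ C :=
  \tsum_(a ⊗ h := s) \tsum_(m ⊗ c := z) act a m ⊗ lact h c.
Definition mc_r (z : M ⊗ C) (h : H) : M ⊗ C := \tsum_(m ⊗ c := z) m ⊗ ract c h.
Definition mcc_l (s : (A ⊠ H ⊠ H)%type) (z : M ⊗ C ⊗ C) : M ⊗ C ⊗ C :=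
  \tsum_(a ⊗ h ⊗ g := s) \tsum_(m ⊗ c ⊗ d := z) act a m ⊗ lact h c ⊗ lact g d.
Definition mcc_r (z : M ⊗ C ⊗ C) (s : (H ⊠ H)%type) : M ⊗ C ⊗ C :=
  \tsum_(h ⊗ g := s) \tsum_(m ⊗ c ⊗ d := z) m ⊗ ract c h ⊗ ract d g.
Definition mDelta (z : M ⊗ C) : M ⊗ C ⊗ C := \tsum_(m ⊗ c := z) m ⊗ bmc_Delta c.
Definition app3 (z : M ⊗ C) (d : C) : M ⊗ C ⊗ C := \tsum_(m ⊗ c := z) m ⊗ c ⊗ d.

Lemma bil_mc_l : is_bilinear mc_l. Proof. by unfold mc_l; lin. Qed.
Lemma bil_mc_r : is_bilinear mc_r. Proof. by unfold mc_r; lin. Qed.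
Lemma bil_mcc_l : is_bilinear mcc_l. Proof. by unfold mcc_l; lin. Qed.
Lemma bil_mcc_r : is_bilinear mcc_r. Proof. by unfold mcc_r; lin. Qed.
Lemma lin_mDelta : linear mDelta. Proof. by unfold mDelta; lin. Qed.
Lemma bil_app3 : is_bilinear app3. Proof. by unfold app3; lin. Qed.
Hint Extern 0 (is_bilinear mc_l) => exact: bil_mc_l : lin.
Hint Extern 0 (is_bilinear mc_r) => exact: bil_mc_r : lin.
Hint Extern 0 (is_bilinear mcc_l) => exact: bil_mcc_l : lin.
Hint Extern 0 (is_bilinear mcc_r) => exact: bil_mcc_r : lin.
Hint Extern 0 (is_bilinear app3) => exact: bil_app3 : lin.
Hint Extern 0 (GRing.linear_for _ (mc_l _)) => exact (lin_bilr bil_mc_l _) : lin.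
Hint Extern 0 (GRing.linear_for _ (mc_r _)) => exact (lin_bilr bil_mc_r _) : lin.
Hint Extern 0 (GRing.linear_for _ (mcc_l _)) => exact (lin_bilr bil_mcc_l _) : lin.
Hint Extern 0 (GRing.linear_for _ (mcc_r _)) => exact (lin_bilr bil_mcc_r _) : lin.
Hint Extern 0 (GRing.linear_for _ (app3 _)) => exact (lin_bilr bil_app3 _) : lin.
Hint Extern 0 (GRing.linear_for _ mDelta) => exact: lin_mDelta : lin.

Lemma mc_lE a h m c : mc_l (a ⊠ h) (m ⊗ c) = act a m ⊗ lact h c.
Proof. by rewrite /mc_l ksum_pure ?tsum_pure //; lin. Qed.
Lemma mc_rE m c h : mc_r (m ⊗ c) h = m ⊗ ract c h.
Proof. by rewrite /mc_r tsum_pure //; lin. Qed.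
Lemma mcc_lE a h g m c d :
  mcc_l (a ⊠ h ⊠ g) (m ⊗ c ⊗ d) = act a m ⊗ lact h c ⊗ lact g d.
Proof. by rewrite /mcc_l !ksum_pure ?tsum_pure //; lin. Qed.
Lemma mcc_rE m c d h g : mcc_r (m ⊗ c ⊗ d) (h ⊠ g) = m ⊗ ract c h ⊗ ract d g.
Proof. by rewrite /mcc_r !ksum_pure ?tsum_pure //; lin. Qed.
Lemma mDeltaE m c : mDelta (m ⊗ c) = m ⊗ bmc_Delta c.
Proof. by rewrite /mDelta !tsum_pure //; lin. Qed.
Lemma app3E m c d : app3 (m ⊗ c) d = m ⊗ c ⊗ d.
Proof. by rewrite /app3 !tsum_pure //; lin. Qed.

Lemma mc_lM s t z : mc_l (s * t) z = mc_l s (mc_l t z).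
Proof.
tind z as m c; tind s as a h; tind t as b g.
by rewrite kmulE !mc_lE actM lactM.
Qed.
Lemma mc_rM z h g : mc_r z (h * g) = mc_r (mc_r z h) g.
Proof. by tind z as m c; rewrite !mc_rE ractM. Qed.
Lemma mc_lr s z h : mc_r (mc_l s z) h = mc_l s (mc_r z h).
Proof. by tind z as m c; tind s as a g; rewrite !(mc_lE, mc_rE) lract. Qed.
Lemma mcc_lM s t z : mcc_l (s * t) z = mcc_l s (mcc_l t z).
Proof.
tind z as m z; tind z as c d; tind s as a s; tind s as h g.
tind t as b t; tind t as e f.
by rewrite !kmulE !mcc_lE actM !lactM.
Qed.
Lemma mcc_rM z s t : mcc_r z (s * t) = mcc_r (mcc_r z s) t.
Proof.
tind z as m z; tind z as c d; tind s as h g; tind t as e f.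
by rewrite !kmulE !mcc_rE !ractM.
Qed.
Lemma mcc_lr s z t : mcc_r (mcc_l s z) t = mcc_l s (mcc_r z t).
Proof.
tind z as m z; tind z as c d; tind s as a s; tind s as h g; tind t as e f.
by rewrite !(mcc_lE, mcc_rE) !lract.
Qed.
Lemma mcc_l1 z : mcc_l 1 z = z.
Proof. by tind z as m z; tind z as c d; rewrite !koneE mcc_lE act1 !lact1. Qed.
Lemma mcc_r1 z : mcc_r z 1 = z.
Proof. by tind z as m z; tind z as c d; rewrite !koneE mcc_rE !ract1. Qed.
Lemma mc_l1 z : mc_l 1 z = z.
Proof. by tind z as m c; rewrite !koneE mc_lE act1 !lact1. Qed.
Lemma mc_r1 z : mc_r z 1 = z.
Proof. by tind z as m c; rewrite mc_rE !ract1. Qed.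

Lemma mDelta_l s z : mDelta (mc_l s z) = mcc_l (i2 Δ s) (mDelta z).
Proof.
tind z as m c; tind s as a h; rewrite mc_lE !mDeltaE i2E.
rewrite (bmc_Delta_lact hC) -[Delta h]/(Δ h).
move: (Δ h) (bmc_Delta c) => s z; tind z as x y; tind s as e f.
by rewrite ksum_pure ?tsum_pure ?mcc_lE //; lin.
Qed.
Lemma mDelta_r z h : mDelta (mc_r z h) = mcc_r (mDelta z) (Δ h).
Proof.
tind z as m c; rewrite mc_rE !mDeltaE (bmc_Delta_ract hC) -[Delta h]/(Δ h).
move: (Δ h) (bmc_Delta c) => s z; tind z as x y; tind s as e f.
by rewrite tsum_pure ?ksum_pure ?mcc_rE //; lin.
Qed.

Lemma app3_l s g z d : app3 (mc_l s z) (lact g d)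
  = mcc_l (am_assoc (s ⊠ g)) (app3 z d).
Proof.
by tind z as m c; tind s as a h; rewrite amE mc_lE !app3E mcc_lE.
Qed.
Lemma app3_r z h d : app3 (mc_r z h) d = mcc_r (app3 z d) (h ⊠ 1).
Proof. by tind z as m c; rewrite mc_rE !app3E mcc_rE ract1. Qed.
Lemma app3_r2 z h d : app3 z (ract d h) = mcc_r (app3 z d) (1 ⊠ h).
Proof. by tind z as m c; rewrite !app3E mcc_rE ract1. Qed.

Variable coact : M -> M ⊗ C.
Hypothesis lin_coact : linear coact.
Hint Extern 0 (GRing.linear_for _ coact) => exact: lin_coact : lin.

(* The right-hand side of the compatibility axiom of a Yetter-Drinfeld module is
   [rt (λ u) m]. *)
Definition rt (t : (H ⊠ A)%type) (m : M) : M ⊗ C :=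
  \tsum_(h ⊗ a := t) mc_r (coact (act a m)) h.
Lemma bil_rt : is_bilinear rt. Proof. by unfold rt; lin. Qed.
Hint Extern 0 (is_bilinear rt) => exact: bil_rt : lin.
Hint Extern 0 (GRing.linear_for _ (rt _)) => exact (lin_bilr bil_rt _) : lin.
Lemma rtE h a m : rt (h ⊠ a) m = mc_r (coact (act a m)) h.
Proof. by rewrite /rt ksum_pure //; lin. Qed.

Lemma rt_mulr t h a m : rt (t * (h ⊠ a)) m = mc_r (rt t (act a m)) h.
Proof. by tind t as g b; rewrite kmulE !rtE actM mc_rM. Qed.

Definition dt (w : (H ⊠ H ⊠ A)%type) (m : M) : M ⊗ C ⊗ C :=
  \tsum_(h ⊗ g ⊗ a := w) mcc_r (mDelta (coact (act a m))) (h ⊠ g).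
Lemma bil_dt : is_bilinear dt. Proof. by unfold dt; lin. Qed.
Hint Extern 0 (is_bilinear dt) => exact: bil_dt : lin.
Lemma dtE u a m : dt (am_assoc (u ⊠ a)) m = mcc_r (mDelta (coact (act a m))) u.
Proof. by tind u as h g; rewrite amE /dt !ksum_pure //; lin. Qed.

Lemma dt_mulr w u a m : dt (w * am_assoc (u ⊠ a)) m = mcc_r (dt w (act a m)) u.
Proof.
tind w as x w; tind w as y b; rewrite -[x ⊠ y ⊠ b]am_assocE -amM kmulE.
by rewrite !dtE actM mcc_rM.
Qed.

Lemma dt_D1 t m : dt (D1 t) m = mDelta (rt t m).
Proof. by tind t as h a; rewrite am_lE dtE rtE mDelta_r. Qed.

Definition rt3 (w : (H ⊠ A ⊠ H)%type) (z : M ⊗ C) : M ⊗ C ⊗ C :=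
  \tsum_(h ⊗ a ⊗ g := w) \tsum_(m ⊗ c := z) app3 (rt (h ⊠ a) m) (lact g c).
Lemma bil_rt3 : is_bilinear rt3. Proof. by unfold rt3; lin. Qed.
Hint Extern 0 (is_bilinear rt3) => exact: bil_rt3 : lin.
Hint Extern 0 (GRing.linear_for _ (rt3 _)) => exact (lin_bilr bil_rt3 _) : lin.
Lemma rt3E t g m c : rt3 (am_assoc (t ⊠ g)) (m ⊗ c) = app3 (rt t m) (lact g c).
Proof.
by tind t as h a; rewrite amE /rt3 !ksum_pure ?tsum_pure //; lin.
Qed.

Lemma rt3_mulr w h s z : rt3 (w * (h ⊠ s)) z = mcc_r (rt3 w (mc_l s z)) (h ⊠ 1).
Proof.
tind z as m c; tind s as a g; tind w as x w; tind w as b y.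
rewrite mc_lE -[x ⊠ b ⊠ y]am_assocE -[h ⊠ a ⊠ g]am_assocE -amM kmulE !rt3E.
by rewrite rt_mulr app3_r lactM.
Qed.

Lemma rt3_r w z h : rt3 w (mc_r z h) = mcc_r (rt3 w z) (1 ⊠ h).
Proof.
tind z as m c; tind w as x w; tind w as b y; rewrite mc_rE.
by rewrite -[x ⊠ b ⊠ y]am_assocE !rt3E -lract app3_r2.
Qed.

(* The sides of the coassociativity axiom of a Yetter-Drinfeld module are [LL 1]
   and [RR 1], while coassociativity of the Hopf module [coact'] below amounts to
   [LL bw] being equal to [RR bw]. *)
Definition LL (w : (H ⊠ H ⊠ A)%type) (m : M) : M ⊗ C ⊗ C :=
  \tsum_(h ⊗ g ⊗ a := w) mcc_r (rt3 bθ (coact (act a m))) (h ⊠ g).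
Lemma bil_LL : is_bilinear LL. Proof. by unfold LL; lin. Qed.
Hint Extern 0 (is_bilinear LL) => exact: bil_LL : lin.
Lemma LLE u a m : LL (am_assoc (u ⊠ a)) m = mcc_r (rt3 bθ (coact (act a m))) u.
Proof. by tind u as h g; rewrite amE /LL !ksum_pure //; lin. Qed.
Lemma LL_mulr w u a m : LL (w * am_assoc (u ⊠ a)) m = mcc_r (LL w (act a m)) u.
Proof.
tind w as x w; tind w as y b; rewrite -[x ⊠ y ⊠ b]am_assocE -amM kmulE.
by rewrite !LLE actM mcc_rM.
Qed.

Definition RR (w : (H ⊠ H ⊠ A)%type) (m : M) : M ⊗ C ⊗ C :=
  mcc_l rY (dt (bY * w) m).
Lemma RR_mulr w u a m : RR (w * am_assoc (u ⊠ a)) m = mcc_r (RR w (act a m)) u.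
Proof. by rewrite /RR mulrA dt_mulr mcc_lr. Qed.

Hypothesis compat : forall u m, mc_l (ρ u) (coact m) = rt (λ u) m.

Lemma rt_lam u t m : rt (λ u * t) m = mc_l (ρ u) (rt t m).
Proof. by tind t as h a; rewrite rt_mulr -compat mc_lr rtE. Qed.

Lemma dt_lam u w m : dt (D1 (λ u) * w) m = mcc_l (i2 Δ (ρ u)) (dt w m).
Proof.
tind w as x w; tind w as y b; rewrite -[x ⊠ y ⊠ b]am_assocE dt_mulr dt_D1.
by rewrite -compat mDelta_l mcc_lr dtE.
Qed.

Lemma rt3_lam v w z : rt3 (am_l λ v * w) z = mcc_l (am_l ρ v) (rt3 w z).
Proof.
tind z as m c; tind v as a g; tind w as x w; tind w as b y.
rewrite !am_lE -[x ⊠ b ⊠ y]am_assocE -amM kmulE !rt3E.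
by rewrite rt_lam lactM app3_l.
Qed.

(** Compatibility turns the inner λ into ρ, Θ-compatibility moves (id ⊗ ρ)λ(u) across θ as (λ ⊗
    id)ρ(u), and compatibility applies once more. [RR] transforms alike, by coassociativity of λ and
    ρ. *)
Lemma LL_lam u w m : LL (i2 λ (λ u) * w) m = mcc_l (am_l ρ (ρ u)) (LL w m).
Proof.
tind w as x w; tind w as y b; rewrite -[x ⊠ y ⊠ b]am_assocE LL_mulr LLE.
rewrite -mcc_lr; congr mcc_r; move: (act b m) => n.
rewrite -rt3_lam -bΘ_compat_inv; move: (λ u) => s; tind s as h a.
rewrite !i2E rt3_mulr compat; move: (λ a) => s; tind s as g c.
rewrite -[h ⊠ g ⊠ c]am_assocE LLE rtE rt3_r -mcc_rM.
by rewrite kmulE mul1r mulr1.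
Qed.

Lemma RR_lam u w m : RR (i2 λ (λ u) * w) m = mcc_l (am_l ρ (ρ u)) (RR w m).
Proof.
by rewrite /RR mulrA b_lam_coassoc_inv // -mulrA dt_lam -!mcc_lM b_rho_coassoc_inv.
Qed.

Lemma LL1 m : LL 1 m = rt3 bθ (coact m).
Proof.
have -> : 1 = am_assoc ((1 : (H ⊠ H)%type) ⊠ (1 : A)) by rewrite -[LHS](am1 am_assoc).
by rewrite LLE mcc_r1 act1.
Qed.

(** By [bq_bw], 1 is a sum of terms (id ⊗ λ)λ(u) w (x ⊗ y ⊗ 1), and [LL] and [RR] respond
    identically to both multiplications. *)
Lemma LL_RR m : LL bw m = RR bw m -> LL 1 m = RR 1 m.
Proof.
move=> E.
have EL (x y : H) (u : A) : LL (i2 λ (λ u) * bw * (x ⊠ y ⊠ 1)) m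
    = RR (i2 λ (λ u) * bw * (x ⊠ y ⊠ 1)) m.
  rewrite -[x ⊠ y ⊠ 1]am_assocE LL_mulr RR_mulr act1 LL_lam RR_lam E.
  by [].
have linLL : linear (LL ^~ m) by lin.
have linRR : linear (RR ^~ m) by unfold RR; lin.
rewrite -(bq_bw hH hA).
rewrite [LHS](linear_tsum _ _ linLL) [RHS](linear_tsum _ _ linRR).
apply: eq_tsum => h b.
rewrite [LHS](linear_tsum _ _ linLL) [RHS](linear_tsum _ _ linRR).
apply: eq_tsum => g c.
rewrite [LHS](linear_tsum _ _ linLL) [RHS](linear_tsum _ _ linRR).
by apply: eq_tsum => e d.
Qed.

Definition coact' (m : M) : M ⊗ C := rt bp m.

(* What Φ_{ρ_2} contributes besides Φ_ρ and Φ_{λ,ρ}. *)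
Definition sandwich (w : (H ⊠ H ⊠ A)%type) (g : (H ⊠ H)%type) (z : M ⊗ C ⊗ C) :=
  \tsum_(a ⊗ b ⊗ c := w) mcc_r (mcc_l (i2 Δ (ρ c)) z) (sSinv (g * (a ⊠ b))).

(** Without the twist, the sandwich is multiplicative in w, so the one with Φ_λ⁻¹ is inverted by the
    one with Φ_λ; the twist is invertible as well. *)
Lemma sandwich_inj z z' :
  sandwich bY (twist H) z = sandwich bY (twist H) z' -> z = z'.
Proof.
pose s w z : M ⊗ C ⊗ C :=
  \tsum_(a ⊗ b ⊗ c := w) mcc_r (mcc_l (i2 Δ (ρ c)) z) (sSinv (a ⊠ b)).
have linS : forall w, linear (s w) by unfold s; lin.
have E w g y : sandwich w g y = mcc_r (s w y) (sSinv g).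
  rewrite /sandwich /s; tind w as a w; tind w as b c.
  by rewrite !ksum_pure ?sSinvM ?mcc_rM //; lin.
have sE a b c y : s (a ⊠ b ⊠ c) y = mcc_r (mcc_l (i2 Δ (ρ c)) y) (sSinv (a ⊠ b)).
  by rewrite /s !ksum_pure //; lin.
have sl y : linear (s ^~ y) by unfold s; lin.
have bil_s : is_bilinear s by split.
have sM v w y : s v (s w y) = s (v * w) y.
  tind v as a v; tind v as b c; tind w as x w; tind w as e d.
  rewrite !kmulE !sE !amM mcc_lM -mcc_lr -mcc_rM.
  by rewrite -sSinvM // kmulE.
rewrite !E => /(congr1 (fun y => mcc_r y (sSinv (twist_inv hH)))).
rewrite -!mcc_rM -!sSinvM // twistK // sSinv_1 // !mcc_r1.
move/(congr1 (s bX)); rewrite !sM bXK //.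
by rewrite !koneE !sE !am1 sSinvE // Sinv1 // -[1 ⊠ 1]/(1 : (H ⊠ H)%type) !mcc_r1 !mcc_l1.
Qed.

Lemma mDelta_coact' m : mDelta (coact' m) = sandwich bY (twist H) (dt (bY * bw) m).
Proof.
rewrite -dt_D1 Delta_bp (linear_tsum _ _ (proj1 bil_dt m)).
apply: eq_tsum => a v; rewrite (linear_tsum _ _ (proj1 bil_dt m)).
by apply: eq_tsum => b c; rewrite dt_mulr act1 dt_lam.
Qed.

(** In w, the factor 1 ⊗ p produces the outer [coact'] and the factor (id ⊗ λ)(p) puts (id ⊗ ρ)(p)
    next to θ. By [ctrβ_bΘ] this becomes a contraction of Θ and X, and the contracted X is the p of
    the inner [coact']. *)
Lemma LL_bw m : LL bw m = \tsum_(n ⊗ c := coact' m) \tsum_(h ⊗ a ⊗ g := bΘ)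
  app3 (mc_r (mc_l (ρ a) (coact' n)) (Sinv h)) (lact g c).
Proof.
have E1 h t : LL (h ⊠ t) m = mcc_r (rt3 bθ (rt t m)) (h ⊠ 1).
  tind t as g a; rewrite -[h ⊠ g ⊠ a]am_assocE LLE rtE rt3_r -mcc_rM.
  by rewrite kmulE mul1r mulr1.
have E2 t : LL (i2 λ t * am_sh bp) m = rt3 (bθ * i2 ρ t) (rt bp m).
  tind t as h a; rewrite !amE kmulE mulr1 E1 rt3_mulr rt_lam.
  by [].
have E3 : ctrβ (am_ext bX) = am_assoc (bp ⊠ 1) :> (H ⊠ A ⊠ H)%type.
  rewrite -[bp]/(ctrβ bX); move: bX => t; tind t as x t; tind t as y a.
  by rewrite am_extE !(ctrβE hH) amE.
rewrite -[bw]/(i2 λ bp * am_sh bp) E2 -(ctrβ_bΘ hH) /coact'.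
move: (rt bp m) bΘ => z t; tind z as n c; tind t as h t; tind t as a g.
rewrite tsum_pure ?ksum_pure; try by lin.
rewrite !amE ctrβ_mull // E3 -[Sinv h ⊠ 1]am_assocE -!amM !kmulE !mulr1.
by rewrite rt3E rt_mulr act1 rt_lam.
Qed.

Let lhact (t : (H^c ⊗ H)%type) (c : C) : C :=
  \tsum_(h ⊗ h' := t) ract (lact h' c) h.

Lemma hopf_coassoc_lhs m :
  \tsum_(X1 ⊗ X2 ⊗ X3 := Phi_rho2 A)
    \tsum_(m0 ⊗ m1 := coact' m) \tsum_(m00 ⊗ m01 := coact' m0)
      act X1 m00 ⊗ lhact X2 m01 ⊗ lhact X3 m1
  = sandwich bY (twist H) (mcc_l rX (LL bw m)).
Proof.
have bil_lhact : is_bilinear lhact by unfold lhact; lin.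
pose Ξ (P : (A ⊗ (H^c ⊗ H) ⊗ (H^c ⊗ H))%type) : M ⊗ C ⊗ C :=
  \tsum_(X1 ⊗ X2 ⊗ X3 := P)
    \tsum_(m0 ⊗ m1 := coact' m) \tsum_(m00 ⊗ m01 := coact' m0)
      act X1 m00 ⊗ lhact X2 m01 ⊗ lhact X3 m1.
have linΞ : linear Ξ.
  by rewrite /Ξ; lin.
have lhactE (x y : H) c : lhact ((x : H^c) ⊗ y) c = ract (lact y c) x.
  by rewrite /lhact tsum_pure //; lin.
pose Ψ (a : A) (x h y g : H) : M ⊗ C ⊗ C :=
  \tsum_(n ⊗ c := coact' m) \tsum_(u ⊗ d := coact' n)
    act a u ⊗ ract (lact h d) x ⊗ ract (lact g c) y.
have ΞE a x h y g : Ξ (a ⊗ ((x : H^c) ⊗ h) ⊗ ((y : H^c) ⊗ g)) = Ψ a x h y g.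
  rewrite /Ξ !tsum_pure; try by lin.
  by apply: eq_tsum => n c; apply: eq_tsum => u d; rewrite !lhactE.
transitivity (\tsum_(x1 ⊗ x2 ⊗ x3 := bY) \tsum_(x30 ⊗ x31 := ρ x3)
    \tsum_(x311 ⊗ x312 := Δ x31) \tsum_(X1 ⊗ X2 ⊗ X3 := rX)
    \tsum_(T1 ⊗ T2 ⊗ T3 := bΘ) \tsum_(T20 ⊗ T21 := ρ T2)
    \tsum_(f1 ⊗ f2 := twist H)
      Ψ (x30 * X1 * T20) (Sinv (f2 * x2 * T1)) (x311 * X2 * T21)
        (Sinv (f1 * x1)) (x312 * X3 * T3)).
  rewrite -[LHS]/(Ξ (Phi_rho2 A)) /Phi_rho2.
  (* Ten nested binary sums: two for each of the three reassociators and one each for two ρ's, Δ and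
     the twist. *)
  do 10! (rewrite (linear_tsum _ _ linΞ); apply: eq_tsum => ? ?).
  exact: ΞE.
have linc' : linear coact' by rewrite /coact'; lin.
rewrite LL_bw /Ψ /sandwich.
move: (coact' m) (twist H) bY rX bΘ => z f y r t.
tind z as n c; tind f as f1 f2; tind t as t1 t; tind t as t2 t3.
tind y as y1 y; tind y as y2 y3; tind r as r1 r; tind r as r2 r3.
rewrite !ksum_pure; try by lin.
rewrite tsum_pure; last by lin.
rewrite !ksum_pure; try by lin.
move: (ρ y3) => s; tind s as s1 s2; rewrite i2E ksum_pure; last by lin.
move: (Δ s2) => s; tind s as g1 g2; rewrite !ksum_pure; try by lin.
move: (ρ t2) => s; tind s as u1 u2; rewrite !ksum_pure; try by lin.
rewrite tsum_pure; last by lin.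
move: (coact' n) => v; tind v as v d; rewrite tsum_pure; last by lin.
rewrite mc_lE mc_rE app3E !kmulE sSinvE // !mcc_lE mcc_rE.
by rewrite !actM !SinvM // !ractM !lactM !lract.
Qed.

End Coaction.

(** * Recovering one coaction from the other by means of q *)

Section InverseCoaction.
Variables (k : fieldType) (H : quasi_hopf_data k) (hH : is_quasi_hopf H).
Variables (A : bicomodule_algebra_data H) (hA : is_bicomodule_algebra A).
Variables (C : bimodule_coalgebra_data H) (hC : is_bimodule_coalgebra C).
Variables (M : lmodType k) (act : A -> M -> M) (hact : is_left_action act).
Local Notation S := (@antipode k H).
Local Notation Sinv := (@antipode_inv k H).
Local Notation ε1 := (epl hH).
Local Notation λ := (b_lam hA).
Local Notation ρ := (b_rho hA).
Hint Extern 0 (GRing.linear_for _ (@mc_l _ _ _ _ _ _ _)) =>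
  exact (lin_bilr (bil_mc_l hC hact) _) : lin.
Hint Extern 0 (GRing.linear_for _ (@mc_r _ _ _ _ _)) =>
  exact (lin_bilr (bil_mc_r hC M) _) : lin.
Local Notation mc_l := (@mc_l k H A C M act).
Local Notation mc_r := (@mc_r k H C M).

Let bil_act : is_bilinear act. Proof. by case: hact. Qed.
Let act1 m : act 1 m = m. Proof. by case: hact. Qed.
Hint Extern 0 (GRing.linear_for _ (@antipode _ _)) => exact: (lin_S hH) : lin.
Hint Extern 0 (GRing.linear_for _ (@antipode_inv _ _)) => exact: (lin_Sinv hH) : lin.
Hint Extern 0 (GRing.linear_for _ (@eps _ _)) => exact: (lin_eps hH) : lin.
Hint Extern 0 (GRing.linear_for _ (@bmc_eps _ _ _)) => exact: (bmc_eps_linear hC) : lin.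
Hint Extern 0 (is_bilinear act) => exact: bil_act : lin.
Hint Extern 0 (GRing.linear_for _ (act _)) => exact (lin_bilr bil_act _) : lin.
Hint Extern 0 (is_bilinear mc_l) => exact: (bil_mc_l hC hact) : lin.
Hint Extern 0 (is_bilinear mc_r) => exact: (bil_mc_r hC M) : lin.

(** An action of H ⊗ A on M ⊗ C; its restriction along λ is the action of A through ρ_2, so that
    compatibility of a Hopf module reads r(u m) = λ(u) · r(m). *)
Definition rq (t : (H ⊠ A)%type) (z : M ⊗ C) : M ⊗ C :=
  \tsum_(h ⊗ a := t) mc_r (mc_l (ρ a) z) (Sinv h).
Lemma bil_rq : is_bilinear rq. Proof. by unfold rq; lin. Qed.
Hint Extern 0 (is_bilinear rq) => exact: bil_rq : lin.
Hint Extern 0 (GRing.linear_for _ (rq _)) => exact (lin_bilr bil_rq _) : lin.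
Lemma rqE h a z : rq (h ⊠ a) z = mc_r (mc_l (ρ a) z) (Sinv h).
Proof. by rewrite /rq ksum_pure //; lin. Qed.
Lemma rqM s t z : rq (s * t) z = rq s (rq t z).
Proof.
tind s as h a; tind t as g b.
by rewrite kmulE !rqE amM (mc_lM hC hact) (SinvM hH) (mc_rM hC) -(mc_lr hC hact).
Qed.
Lemma rq1 z : rq 1 z = z.
Proof. by rewrite koneE rqE am1 (Sinv1 hH) (mc_r1 hC) (mc_l1 hC hact). Qed.
Lemma mc_l_rq u t z : mc_l (ρ u) (rq t z) = rq ((1 ⊠ u) * t) z.
Proof. by rewrite rqM rqE (Sinv1 hH) (mc_r1 hC). Qed.
Lemma mc_r_rq v t z : mc_r (rq t z) v = rq ((S v ⊠ 1) * t) z.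
Proof. by rewrite rqM rqE (SK hH) am1 (mc_l1 hC hact). Qed.

Definition meps (z : M ⊗ C) : M := \tsum_(m ⊗ c := z) (bmc_eps c *: m).
Lemma lin_meps : linear meps. Proof. by unfold meps; lin. Qed.
Hint Extern 0 (GRing.linear_for _ meps) => exact: lin_meps : lin.
Lemma mepsE m c : meps (m ⊗ c) = bmc_eps c *: m.
Proof. by rewrite /meps tsum_pure //; lin. Qed.
Lemma meps_r z h : meps (mc_r z h) = eps h *: meps z.
Proof.
by tind z as m c; rewrite (mc_rE hC) !mepsE (bmc_eps_ract hC) mulrC scalerA.
Qed.
Lemma meps_l a z : meps (mc_l (ρ a) z) = act a (meps z).
Proof.
tind z as m c; rewrite mepsE (linZ (lin_bilr bil_act a)).
have -> : act a m = \tsum_(b ⊗ h := ρ a) (eps h *: act b m).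
  rewrite -{1}(rca_counit (bca_right_comodule hA) a).
  rewrite (linear_tsum _ _ (proj1 bil_act m)); apply: eq_tsum => b h.
  by rewrite (linZ (proj1 bil_act m)).
move: (ρ a) => t; tind t as b h; rewrite ksum_pure; last by lin.
by rewrite (mc_lE hC hact) mepsE (bmc_eps_lact hC) scalerA mulrC.
Qed.
Lemma meps_rq t z : meps (rq t z) = act (ε1 t) (meps z).
Proof.
tind t as h a; rewrite rqE meps_r meps_l eplE (eps_Sinv hH).
by rewrite (linZ (proj1 bil_act _)).
Qed.

Section FromHopf.
Variable r : M -> M ⊗ C.
Hypothesis lin_r : linear r.
Hypothesis r_act : forall u m, r (act u m) = rq (λ u) (r m).
Hint Extern 0 (GRing.linear_for _ r) => exact: lin_r : lin.

Definition coactq (m : M) : M ⊗ C := rq (bq A) (r m).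
Lemma lin_coactq : linear coactq. Proof. by rewrite /coactq; lin. Qed.
(** The commutation rule of q rewrites (1 ⊗ u) q; its S(h) becomes the right action of h, and its
    λ(c) enters the coaction of c m. *)
Lemma coactq_compat u m : mc_l (ρ u) (coactq m) = rt act coactq (λ u) m.
Proof.
have linq : linear (rq ^~ (r m)) by case: bil_rq.
rewrite mc_l_rq -(bq_lam hH hA) (linear_tsum _ _ linq); apply: eq_tsum => h c.
by rewrite -mulrA -mc_r_rq rqM -r_act.
Qed.
Lemma rt_coactq m : rt act coactq (bp A) m = r m.
Proof.
have linq : linear (rq ^~ (r m)) by case: bil_rq.
rewrite -[RHS]rq1 -(bp_bq hH hA) (linear_tsum _ _ linq); apply: eq_tsum => h c.
by rewrite -mulrA -mc_r_rq rqM -r_act.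
Qed.
Lemma meps_coactq m : meps (r m) = m -> meps (coactq m) = m.
Proof. by move=> E; rewrite meps_rq (epl_bq hH hA) act1. Qed.
End FromHopf.

Section FromYD.
Variable coact : M -> M ⊗ C.
Hypothesis lin_coact : linear coact.
Hypothesis compat : forall u m, mc_l (ρ u) (coact m) = rt act coact (λ u) m.
Hint Extern 0 (GRing.linear_for _ coact) => exact: lin_coact : lin.

Lemma lin_coact' : linear (coact' act coact).
Proof. exact: (proj2 (bil_rt hC hact lin_coact)). Qed.
Lemma coact'_act u m : coact' act coact (act u m) = rq (λ u) (coact' act coact m).
Proof.
have linr : linear (rt act coact ^~ m) by case: (bil_rt hC hact lin_coact).
rewrite {1}/coact' -[LHS](mc_r1 hC) -(rt_mulr hC hact lin_coact).
rewrite -(bp_lam hH hA) (linear_tsum _ _ linr); apply: eq_tsum => h c.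
by rewrite (rt_mulr hC hact lin_coact) act1 (rt_lam hC hact lin_coact compat).
Qed.
Lemma rq_coact' m : rq (bq A) (coact' act coact m) = coact m.
Proof.
have linr : linear (rt act coact ^~ m) by case: (bil_rt hC hact lin_coact).
transitivity (rt act coact 1 m); last first.
  by rewrite koneE (rtE hC hact lin_coact) act1 (mc_r1 hC).
rewrite -(bq_bp hH hA) (linear_tsum _ _ linr); apply: eq_tsum => h c.
by rewrite (rt_mulr hC hact lin_coact) act1 (rt_lam hC hact lin_coact compat).
Qed.
Lemma meps_coact' : (forall m, meps (coact m) = m) ->
  forall m, meps (coact' act coact m) = m.
Proof.
move=> E m; have bil := bil_rt hC hact lin_coact.
have ER t : meps (rt act coact t m) = act (ε1 t) m.
  have linr : linear (rt act coact ^~ m) by case: bil.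
  tind t as h a; rewrite (rtE hC hact lin_coact) meps_r E eplE.
  by rewrite (linZ (proj1 bil_act _)).
by rewrite ER (epl_bp hH hA) act1.
Qed.
End FromYD.
End InverseCoaction.

(** * Correspondence of the module axioms and of the morphisms *)

Section YDHopf.
Variables (k : fieldType) (H : quasi_hopf_data k) (hH : is_quasi_hopf H).
Variables (A : bicomodule_algebra_data H) (hA : is_bicomodule_algebra A).
Variables (C : bimodule_coalgebra_data H) (hC : is_bimodule_coalgebra C).
Local Notation CL := (bimodule_as_left C).

Section Objects.
Variables (M : lmodType k) (act : A -> M -> M).
Local Notation S := (@antipode k H).
Local Notation Sinv := (@antipode_inv k H).
Local Notation λ := (b_lam hA).
Local Notation ρ := (b_rho hA).
Local Notation lact := (@bmc_lact k H C).
Local Notation ract := (@bmc_ract k H C).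
Let bil_lact : is_bilinear lact. Proof. by case: (bmc_lactP hC). Qed.
Let bil_ract : is_bilinear ract. Proof. by case: (bmc_ractP hC). Qed.
Hypothesis hact : is_left_action act.
Let bil_act : is_bilinear act. Proof. by case: hact. Qed.
Hint Extern 0 (GRing.linear_for _ (@antipode_inv _ _)) => exact: (lin_Sinv hH) : lin.
Hint Extern 0 (is_bilinear act) => exact: bil_act : lin.
Hint Extern 0 (is_bilinear lact) => exact: bil_lact : lin.
Hint Extern 0 (is_bilinear ract) => exact: bil_ract : lin.
Hint Extern 0 (GRing.linear_for _ (act _)) => exact (lin_bilr bil_act _) : lin.
Hint Extern 0 (GRing.linear_for _ (@bmc_lact _ _ _ _)) => exact (lin_bilr bil_lact _) : lin.
Hint Extern 0 (GRing.linear_for _ (@bmc_ract _ _ _ _)) => exact (lin_bilr bil_ract _) : lin.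
Hint Extern 0 (GRing.linear_for _ (@bmc_Delta _ _ _)) =>
  exact (bmc_Delta_linear hC) : lin.
Hint Extern 0 (is_bilinear (@mcc_r _ _ _ _)) => exact: (bil_mcc_r hC M) : lin.
Hint Extern 0 (GRing.linear_for _ (@mcc_l _ _ _ _ _ _ _)) =>
  exact (lin_bilr (bil_mcc_l hC hact) _) : lin.
Hint Extern 0 (GRing.linear_for _ (@mcc_r _ _ _ _ _)) =>
  exact (lin_bilr (bil_mcc_r hC M) _) : lin.
Hint Extern 0 (is_bilinear (@app3 _ _ _ _)) => exact: (bil_app3 C M) : lin.
Hint Extern 0 (GRing.linear_for _ (@mDelta _ _ _ _)) => exact (lin_mDelta hC (M:=M)) : lin.
Hint Extern 0 (is_bilinear (mcc_l _)) => exact: (bil_mcc_l hC hact) : lin.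
Hint Extern 0 (is_bilinear (mc_l _)) => exact: (bil_mc_l hC hact) : lin.
Hint Extern 0 (is_bilinear (@mc_r _ _ _ _)) => exact: (bil_mc_r hC M) : lin.
Hint Extern 0 (GRing.linear_for _ (@mc_l _ _ _ _ _ _ _)) =>
  exact (lin_bilr (bil_mc_l hC hact) _) : lin.
Hint Extern 0 (GRing.linear_for _ (@mc_r _ _ _ _ _)) =>
  exact (lin_bilr (bil_mc_r hC M) _) : lin.

Lemma mDelta_sum (z : M ⊗ C) :
  mDelta z = \tsum_(m0 ⊗ m1 := z) \tsum_(c1 ⊗ c2 := bmc_Delta m1) m0 ⊗ c1 ⊗ c2.
Proof.
rewrite /mDelta; apply: eq_tsum => m c.
move: (bmc_Delta c) => t; tind t as c1 c2.
by rewrite tsum_pure //; lin.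
Qed.

Section Coact.
Variable coact : M -> M ⊗ C.
Hypothesis lin_coact : linear coact.
Hint Extern 0 (GRing.linear_for _ coact) => exact: lin_coact : lin.

Lemma yd_coassoc_lhs m :
  \tsum_(t1 ⊗ t2 ⊗ t3 := bθ A) \tsum_(m0 ⊗ m1 := coact m)
    \tsum_(n0 ⊗ n1 := coact (act t2 m0)) n0 ⊗ ract n1 t1 ⊗ lact t3 m1
  = LL act coact 1 m.
Proof.
rewrite (LL1 hC hact lin_coact) /rt3.
apply: eq_tsum => t1 t; apply: eq_tsum => t2 t3; apply: eq_tsum => m0 m1.
rewrite (rtE hC hact lin_coact); move: (coact _) (lact t3 m1) => z d.
tind z as n0 n1.
by rewrite tsum_pure ?(mc_rE hC) ?app3E //; lin.
Qed.

Lemma yd_coassoc_rhs m :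
  \tsum_(y1 ⊗ y2 ⊗ y3 := rY A) \tsum_(x1 ⊗ x2 ⊗ x3 := bY A)
    \tsum_(n0 ⊗ n1 := coact (act x3 m)) \tsum_(c1 ⊗ c2 := bmc_Delta n1)
      act y1 n0 ⊗ ract (lact y2 c1) x1 ⊗ ract (lact y3 c2) x2
  = RR act coact 1 m.
Proof.
have bil_mcc := bil_mcc_l hC hact; have bil_mcr := bil_mcc_r hC M.
rewrite /RR mulr1 /dt.
move: (bY A) (rY A) => w v; tind v as y1 v; tind v as y2 y3.
tind w as x1 w; tind w as x2 x3.
rewrite !ksum_pure; try by lin.
move: (coact _) => z.

tind z as n c; rewrite (mDeltaE hC) tsum_pure; last by lin.
move: (bmc_Delta c) => t; tind t as c1 c2.
by rewrite tsum_pure ?(mcc_rE hC) ?(mcc_lE hC hact) ?(bmc_actA hC) //; lin.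
Qed.

End Coact.

Lemma rho2_act u (z : M ⊗ C) :
  \tsum_(a ⊗ h := rho2 u) \tsum_(n ⊗ c := z)
    act a n ⊗ (\tsum_(g ⊗ g' := h) ract (lact g' c) g)
  = rq hA act (λ u) z.
Proof.
have linq := lin_bilr (bil_rq hH hA hC hact) (λ u).
tind z as n0 c0.
pose Ξ (t : (A ⊗ (H^c ⊗ H))%type) : M ⊗ C :=
  \tsum_(a ⊗ h := t) \tsum_(n ⊗ c := n0 ⊗ c0)
    act a n ⊗ (\tsum_(g ⊗ g' := h) ract (lact g' c) g).
have linΞ : linear Ξ by rewrite /Ξ; lin.
rewrite -[LHS]/(Ξ (rho2 u)) /rho2 -[blambda u]/(λ u) /rq.
rewrite (linear_tsum _ _ linΞ); apply: eq_tsum => v u0.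
rewrite -[brho u0]/(ρ u0) (linear_tsum _ _ linΞ).
move: (ρ u0) => t; tind t as a h.
rewrite ksum_pure; last by lin.
rewrite /Ξ tsum_pure; last by lin.
by rewrite (mc_lE hC hact) (mc_rE hC) !tsum_pure //; lin.
Qed.

Lemma yd_hopf (r : M -> M ⊗ C) :
  is_yetter_drinfeld (ActCoact act r) ->
  @is_hopf_module k _ (A2 A) CL
    (@ActCoact k (A2 A) CL M act (coact' act r)).
Proof.
case=> _ linr counit coassoc compat.
have {}compat u m : mc_l act (ρ u) (r m) = rt act r (λ u) m by exact: compat.
split.
- by [].
- exact: (lin_coact' hC hact linr).
- move=> m; rewrite [LHS](hopf_coassoc_lhs hH hC hact linr compat m).
  rewrite [RHS](esym (mDelta_sum _)) (mDelta_coact' hH hC hact linr compat).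
  congr sandwich.
  (* Equality at 1 for every element of M spreads to every argument, because right multiplication
     acts the same way on both functions. *)
  have E : LL act r 1 =1 RR act r 1.
    move=> n; rewrite -(yd_coassoc_lhs linr).
    exact: etrans (coassoc n) (yd_coassoc_rhs linr n).
  have {}E w : LL act r w m = RR act r w m.
    have bilL := bil_LL hC hact linr (A := A).
    have bild := bil_dt hC hact linr (A := A).
    rewrite /RR; tind w as x w; tind w as y b; rewrite -/(RR act r _ m).
    have := LL_mulr hC hact linr 1 (x ⊠ y) b m.
    have := RR_mulr hC hact linr 1 (x ⊠ y) b m.
    by rewrite mul1r am_assocE => -> ->; rewrite E.
  by rewrite E /RR -(mcc_lM hC hact) (rXK hA) (mcc_l1 hC hact).
- exact: (meps_coact' hH hA hC hact linr counit).
- by move=> u m; rewrite [LHS](coact'_act hH hC hact linr compat) -rho2_act.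
Qed.

Lemma hopf_yd (r : M -> M ⊗ C) :
  @is_hopf_module k _ (A2 A) CL (@ActCoact k (A2 A) CL M act r) ->
  is_yetter_drinfeld (ActCoact act (coactq hA act r)).
Proof.
case=> _ linr coassoc counit compat; have {}linr : linear r := linr.
have r_act u m : r (act u m) = rq hA act (λ u) (r m).
  by rewrite [LHS]compat -rho2_act.
have linq := lin_coactq hH hA hC hact linr.
have compatq := coactq_compat hH hC hact r_act.
have E m : coact' act (coactq hA act r) m = r m.
  exact: (rt_coactq hH hC hact r_act).
split=> //=.
- by move=> m; apply: (meps_coactq hH hA hC hact); exact: counit.
- move=> m; apply: etrans (etrans _ (esym (yd_coassoc_rhs linq m))).
    exact: (yd_coassoc_lhs linq m).
  apply: (LL_RR hH hC hact linq compatq).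
  rewrite /RR -[LHS](mcc_l1 hC hact) -(rYK hA) (mcc_lM hC hact); congr mcc_l.
  (* Since r is the [coact'] of the candidate coaction, its coassociativity is an equality of two
     sandwiches, and the sandwich can be cancelled. *)
  apply: (sandwich_inj (hH := hH) (hA := hA) hC hact).
  rewrite -(hopf_coassoc_lhs hH hC hact linq compatq).
  rewrite -(mDelta_coact' hH hC hact linq compatq) mDelta_sum.
  have -> : coact' act (coactq hA act r) = r by apply: funext.
  exact: coassoc.
Qed.
End Objects.

Section Morphisms.
Variables (M N : lmodType k) (actM : A -> M -> M) (actN : A -> N -> N).
Hypotheses (hM : is_left_action actM) (hN : is_left_action actN).
Variables (rM : M -> M ⊗ C) (rN : N -> N ⊗ C) (f : M -> N).
Hypotheses (linM : linear rM) (linN : linear rN).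
Hypotheses (linf : linear f) (f_act : forall a m, f (actM a m) = actN a (f m)).
Let tm (z : M ⊗ C) : N ⊗ C := \tsum_(m ⊗ c := z) f m ⊗ c.
Hypothesis f_coact : forall m, rN (f m) = tm (rM m).
Hint Extern 0 (GRing.linear_for _ f) => exact: linf : lin.
Let lin_tm : linear tm. Proof. by unfold tm; lin. Qed.
Hint Extern 0 (GRing.linear_for _ tm) => exact: lin_tm : lin.
Let tmE m c : tm (m ⊗ c) = f m ⊗ c.
Proof. by rewrite /tm tsum_pure //; lin. Qed.
Hint Extern 0 (is_bilinear (@mc_r _ _ _ _)) => exact: (bil_mc_r hC _) : lin.
Hint Extern 0 (GRing.linear_for _ (@mc_r _ _ _ _ _)) =>
  exact (lin_bilr (bil_mc_r hC _) _) : lin.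

Let tm_r z h : tm (mc_r z h) = mc_r (tm z) h.
Proof. by tind z as m c; rewrite (mc_rE hC) !tmE (mc_rE hC). Qed.
Let tm_l s z : tm (mc_l actM s z) = mc_l actN s (tm z).
Proof.
have bM := bil_mc_l hC hM; have bN := bil_mc_l hC hN.
have lM := lin_bilr bM; have lN := lin_bilr bN.
tind z as m c; tind s as a h.
by rewrite (mc_lE hC hM) !tmE (mc_lE hC hN) f_act.
Qed.

Lemma coact'_colinear m : coact' actN rN (f m) = tm (coact' actM rM m).
Proof.
rewrite /coact' /rt (linear_tsum _ _ lin_tm); apply: eq_tsum => h a.
by rewrite tm_r -f_act f_coact.
Qed.
Lemma coactq_colinear m : coactq hA actN rN (f m) = tm (coactq hA actM rM m).
Proof.
rewrite /coactq /rq (linear_tsum _ _ lin_tm); apply: eq_tsum => h a.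
by rewrite tm_r tm_l f_coact.
Qed.
End Morphisms.
End YDHopf.

(** Before F x = x is substituted, f and its image have different types, so the underlying maps are
    compared heterogeneously; the functor laws are then equal as proofs. *)
Lemma ac_functor_id (k : fieldType) (A : kalgType k) (C : lmodType k) (ob : Type)
    (U : ob -> act_coact A C) (F : functor (ac_category U) (ac_category U)) :
  (forall x, F x = x) ->
  (forall (x y : ac_category U) (f : hom x y), JMeq (sval (fmap F f)) (sval f)) ->
  F = functor_id (ac_category U).
Proof.
case: F => F0 F1 Fid Fcomp /= e0; have {}e0 : F0 = id by apply: funext.
move: F1 Fid Fcomp; rewrite {}e0 => F1 Fid Fcomp e1.
have {}e1 : F1 = fun x y f => f.
  apply: functional_extensionality_dep => x; apply: functional_extensionality_dep => y.
  by apply: funext => f; apply: ac_hom_ext; apply: JMeq_eq; apply: e1.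
move: Fid Fcomp; rewrite {}e1 => Fid Fcomp.
by congr Functor; apply: Prop_irrelevance.
Qed.

(** * The mutually inverse functors *)

Section Isomorphism.
Variables (k : fieldType) (H : quasi_hopf_data k) (hH : is_quasi_hopf H).
Variables (A : bicomodule_algebra_data H) (hA : is_bicomodule_algebra A).
Variables (C : bimodule_coalgebra_data H) (hC : is_bimodule_coalgebra C).
Local Notation CL := (bimodule_as_left C).
Local Notation YD := (yd_modules A C).
Local Notation HM := (hopf_modules (A2 A) CL).

Fact hopf_of_yd_subproof (M : YD) :
  is_hopf_module (@ActCoact k (A2 A) CL (sval M) (@ac_act k A C (sval M))
    (coact' (@ac_act k A C (sval M)) (@ac_coact k A C (sval M)))).
Proof. by case: M => -[M act r] hM; apply: (yd_hopf hH hA hC); case: hM. Qed.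
Definition hopf_of_yd (M : YD) : HM := exist _ _ (hopf_of_yd_subproof M).
Fact yd_of_hopf_subproof (M : HM) :
  is_yetter_drinfeld (@ActCoact k A C (sval M) (@ac_act k (A2 A) CL (sval M))
    (coactq hA (@ac_act k (A2 A) CL (sval M)) (@ac_coact k (A2 A) CL (sval M)))).
Proof. by case: M => -[M act r] hM; apply: (hopf_yd hH hA hC) => //; case: hM. Qed.
Definition yd_of_hopf (M : HM) : YD := exist _ _ (yd_of_hopf_subproof M).

Fact hopf_of_yd_hom_subproof (M N : YD) (f : hom M N) :
  is_linear_colinear (A := A2 A) (C := CL) (M := sval (hopf_of_yd M))
    (N := sval (hopf_of_yd N)) (sval f).
Proof.
case: f => f [fl fA fC] /=; split=> // m.
by apply: coact'_colinear.
Qed.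
Fact yd_of_hopf_hom_subproof (M N : HM) (f : hom M N) :
  is_linear_colinear (A := A) (C := C) (M := sval (yd_of_hopf M))
    (N := sval (yd_of_hopf N)) (sval f).
Proof.
case: f => f [fl fA fC] /=; split=> // m.
have [hM _ _ _ _] := svalP M; have [hN _ _ _ _] := svalP N.
exact: (coactq_colinear hA hC hM hN).
Qed.

Definition hopf_of_yd_functor : functor YD HM.
Proof.
refine (@Functor YD HM hopf_of_yd
  (fun M N f => exist _ _ (hopf_of_yd_hom_subproof f)) _ _).
- by move=> M; apply: ac_hom_ext.
- by move=> M N P g f; apply: ac_hom_ext.
Defined.
Definition yd_of_hopf_functor : functor HM YD.
Proof.
refine (@Functor HM YD yd_of_hopf
  (fun M N f => exist _ _ (yd_of_hopf_hom_subproof f)) _ _).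
- by move=> M; apply: ac_hom_ext.
- by move=> M N P g f; apply: ac_hom_ext.
Defined.

Lemma yd_hopf_isomorphic : isomorphic_categories YD HM.
Proof.
(* Carriers, actions and underlying maps are unchanged by both functors, so only the coactions of a
   round trip have to be compared. *)
exists hopf_of_yd_functor, yd_of_hopf_functor; split; apply: ac_functor_id => //.
- case=> -[M act r] hM; apply: eq_exist => /=; congr ActCoact.
  case: hM => hact linr _ _ compat; apply: funext => m.
  exact: (rq_coact' hH hC hact linr).
- case=> -[M act r] hM; apply: eq_exist => /=; congr ActCoact.
  case: hM => hact linr _ _ compat; apply: funext => m.
  apply: (rt_coactq hH hC hact) => u n.
  rewrite -(rho2_act hH hA hC hact); exact: compat.
Qed.
End Isomorphism.

(** * Subspaces, quotients and direct sums of vector spaces *)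

Section Subspaces.
Variable k : fieldType.
Implicit Types V W : lmodType k.

Lemma linN V W (f : V -> W) : linear f -> {morph f : x / - x}.
Proof. by move=> fl x; rewrite -!scaleN1r (linZ fl). Qed.
Lemma linB V W (f : V -> W) : linear f -> {morph f : x y / x - y}.
Proof. by move=> fl x y; rewrite (linD fl) (linN fl). Qed.

Definition is_sub V (K : V -> Prop) : Prop :=
  K 0 /\ forall a x y, K x -> K y -> K (a *: x + y).

Lemma sub0 V (K : V -> Prop) : is_sub K -> K 0. Proof. by case. Qed.
Lemma subZ V (K : V -> Prop) a x : is_sub K -> K x -> K (a *: x).
Proof. by case=> K0 KL Kx; have := KL a x 0 Kx K0; rewrite addr0. Qed.
Lemma subD V (K : V -> Prop) x y : is_sub K -> K x -> K y -> K (x + y).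
Proof. by case=> K0 KL Kx Ky; have := KL 1 x y Kx Ky; rewrite scale1r. Qed.
Lemma subN V (K : V -> Prop) x : is_sub K -> K x -> K (- x).
Proof. by move=> hK Kx; rewrite -scaleN1r; apply: subZ. Qed.
Lemma subB V (K : V -> Prop) x y : is_sub K -> K x -> K y -> K (x - y).
Proof. by move=> hK Kx Ky; apply: subD => //; apply: subN. Qed.

Lemma ker_sub V W (f : V -> W) : linear f -> is_sub (fun x => f x = 0).
Proof.
move=> fl; split=> [|a x y fx fy]; first exact: lin0.
by rewrite fl fx fy scaler0 addr0.
Qed.

Lemma im_sub V W (f : V -> W) : linear f -> is_sub (fun y => exists x, y = f x).
Proof.
move=> fl; split=> [|a _ _ [x ->] [y ->]]; first by exists 0; rewrite lin0.
by exists (a *: x + y); rewrite fl.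
Qed.

Lemma projector V (K : V -> Prop) : is_sub K ->
  exists π : V -> V, [/\ linear π, forall x, K (π x) & forall x, K x -> π x = x].
Proof.
move=> hK.
pose P (D : set V) := (forall a x y, D x -> D y -> D (a *: x + y)) /\
  (forall x, D x -> K x -> x = 0).
have [|D [[DL DK] Dmax]] := @Zorn_bigcup V P.
  move=> F FP Ftot; split=> [a x y [X FX Xx] [Y FY Yy]|x [X FX Xx]].
    have [XY|YX] := Ftot X Y FX FY.
      by exists Y => //; have [YL _] := FP Y FY; apply: YL => //; apply: XY.
    by exists X => //; have [XL _] := FP X FX; apply: XL => //; apply: YX.
  by have [_] := FP X FX; apply.
have D0 : D 0.
  apply: contrapT => nD0.
  have De x : ~ D x by move=> Dx; apply: nD0; have := DL (-1) x x Dx Dx; rewrite scaleN1r addNr.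
  case: (Dmax (fun x => x = 0)); last by split=> [a x y -> ->|x ->] //; rewrite scaler0 addr0.
  by split=> [x /De //|sub]; apply: nD0; apply: sub.
have hD : is_sub D by [].
have dec v : exists d, D d /\ K (v - d).
  apply: contrapT => nv.
  case: (Dmax (fun x => exists a d, D d /\ x = a *: v + d)).
    split=> [d Dd|sub]; first by exists 0, d; rewrite scale0r add0r.
    apply: nv; exists v; rewrite subrr; split; last exact: sub0.
    by apply: sub; exists 1, 0; rewrite scale1r addr0.
  split=> [a _ _ [b [d [Dd ->]]] [c [e [De ->]]]|_ [a [d [Dd ->]]] Kx].
    exists (a * b + c), (a *: d + e); split; first exact: DL.
    by rewrite scalerDr scalerDl scalerA addrACA.
  have [a0|a0] := eqVneq a 0.
    by move: Kx; rewrite a0 scale0r add0r; apply: DK.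
  case: nv; exists (- (a^-1 *: d)); split; first by apply: subN => //; apply: subZ.
  by have := subZ a^-1 hK Kx; rewrite scalerDr scalerA mulVf // scale1r opprK.
have [d dP] := choice dec.
have duniq x e : D e -> K (x - e) -> e = d x.
  move=> De Ke; have [Dd Kd] := dP x; apply/subr0_eq/DK; first exact: subB.
  have -> : e - d x = (x - d x) - (x - e) by rewrite opprB [RHS]addrC addrA subrK.
  exact: subB.
have dl : linear d.
  move=> a x y; have [Dx Kx] := dP x; have [Dy Ky] := dP y.
  apply/esym/duniq; first exact: DL.
  have -> : a *: x + y - (a *: d x + d y) = a *: (x - d x) + (y - d y).
    by rewrite opprD addrACA scalerBr.
  by have [_] := hK; apply.
exists (fun x => x - d x); split.
- by move=> a x y; rewrite dl opprD addrACA scalerBr.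
- by move=> x; have [] := dP x.
- by move=> x Kx; rewrite -(duniq x 0) ?subr0.
Qed.

(** Preimages of the projections to the image are chosen arbitrarily and corrected by the projector
    onto the kernel. The corrected preimage depends only on the image vector, which makes the choice
    linear. *)
Lemma generalized_inverse V W (f : V -> W) : linear f ->
  exists g : W -> V, linear g /\ forall x, f (g (f x)) = f x.
Proof.
move=> fl.
have [π [πl πK πid]] := projector (ker_sub fl).
have [κ [κl κK κid]] := projector (im_sub fl).
have [c cP] := choice κK.
have gE w v : f v = κ w -> c w - π (c w) = v - π v.
  move=> fv; have cv : f (c w - v) = 0 by rewrite linB // -cP fv subrr.
  have := πid _ cv; rewrite linB //; move: (c w) (π (c w)) (π v) => x y z E.
  by rewrite -[x](subrK v) -E addrAC (addrAC y) subrr add0r addrC.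
exists (fun w => c w - π (c w)); split.
  move=> a x y; rewrite (gE _ (a *: c x + c y)); last by rewrite fl κl -!cP.
  by rewrite πl opprD addrACA scalerBr.
move=> x; rewrite (gE _ x); last by apply/esym/κid; exists x.
by rewrite linB // πK subr0.
Qed.

End Subspaces.

Section Fixed.
Variables (k : fieldType) (V : lmodType k) (π : {linear V -> V}).

Record fixed := Fixed { fval :> V; _ : π fval == fval }.
HB.instance Definition _ := [isSub for fval].
HB.instance Definition _ := [Choice of fixed by <:].
Fact fixed_submod : GRing.submod_closed (fun x => π x == x).
Proof.
split=> [|a x y /eqP fx /eqP fy]; first by rewrite unfold_in linear0.
by rewrite unfold_in linearP fx fy.
Qed.
HB.instance Definition _ :=
  GRing.SubChoice_isSubLmodule.Build k V (fun x => π x == x) fixed fixed_submod.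

Lemma fixedP (x : fixed) : π (fval x) = fval x. Proof. by case: x => x /= /eqP. Qed.
Lemma fval_lin : linear fval. Proof. by []. Qed.
Lemma fval_inj : injective fval. Proof. exact: val_inj. Qed.
End Fixed.

Section Retracts.
Variables (k : fieldType) (V : lmodType k).

(* Subspaces and quotients are realized as images of projectors. *)
Lemma retract_lin (π : {linear V -> V}) (W : lmodType k) (g : W -> V) :
  linear g -> (forall x, π (g x) = g x) ->
  exists2 r : W -> fixed π, linear r & forall x, fval (r x) = g x.
Proof.
move=> gl gP; have gP' x : π (g x) == g x by apply/eqP.
exists (fun x => Fixed (gP' x)) => // a x y.
by apply: fval_inj; rewrite fval_lin /= gl.
Qed.

Lemma subspace (K : V -> Prop) : is_sub K ->
  exists (Q : lmodType k) (ι : Q -> V) (r : V -> Q),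
    [/\ linear ι, linear r, cancel ι r, forall q, K (ι q)
      & forall x, K x -> ι (r x) = x].
Proof.
move=> /projector[π [πl πK πid]].
pose πL := HB.pack_for {linear V -> V} π
  (GRing.isLinear.Build k V V *:%R π πl).
have [x|r rl rE] := @retract_lin πL V π πl; first exact: πid.
exists (fixed πL), (@fval _ _ πL), r; split=> //.
- by move=> q; apply: fval_inj; rewrite rE; exact: (fixedP q).
- by move=> q; rewrite -(fixedP q); exact: πK.
- by move=> x /πid; rewrite rE.
Qed.

Lemma quotient (K : V -> Prop) : is_sub K ->
  exists (Q : lmodType k) (p : V -> Q) (s : Q -> V),
    [/\ linear p, linear s, cancel s p & forall x, p x = 0 <-> K x].
Proof.
move=> hK; have [π [πl πK πid]] := projector hK.
have κl : linear (fun x => x - π x).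
  by move=> a x y; rewrite πl opprD addrACA scalerBr.
pose κL := HB.pack_for {linear V -> V} (fun x => x - π x)
  (GRing.isLinear.Build k V V *:%R (fun x => x - π x) κl).
have κid x : κL x = x -> π x = 0 by move=> /= E; rewrite -[π x](subKr x) E subrr.
have [x|p pl pE] := @retract_lin κL V κL κl.
  by rewrite /= linB // (πid (π x)) // !subrr subr0.
exists (fixed κL), p, (@fval _ _ κL); split=> //.
  by move=> q; apply: fval_inj; rewrite pE; exact: (fixedP q).
move=> x; split=> [/(congr1 (@fval _ _ _))|Kx].
  by rewrite pE /= => /subr0_eq ->.
by apply: fval_inj; rewrite pE /= πid // subrr.
Qed.
End Retracts.

(** * Direct sums over an arbitrary index type *)

Section DirectSum.
Local Open Scope quotient_scope.
Variables (k : fieldType) (I : Type) (M : I -> lmodType k).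

Local Notation fsum := {classic (seq {i & M i})}.
Definition fsum_eval (U : lmodType k) (u : forall i, M i -> U) (s : fsum) : U :=
  \sum_(p <- s) u (projT1 p) (projT2 p).

(* Formal sums are identified when every family of linear maps evaluates them
   to the same vector. *)
Definition dsum_rel (s t : fsum) : bool :=
  `[< forall (U : lmodType k) (u : forall i, M i -> U),
        (forall i, linear (u i)) -> fsum_eval u s = fsum_eval u t >].

Fact dsum_rel_refl : reflexive dsum_rel.
Proof. by move=> s; apply/asboolP. Qed.
Fact dsum_rel_sym : symmetric dsum_rel.
Proof.
by move=> s t; apply/idP/idP => /asboolP st; apply/asboolP => U u ul; rewrite st.
Qed.
Fact dsum_rel_trans : transitive dsum_rel.
Proof.
move=> t s r /asboolP st /asboolP tr; apply/asboolP => U u ul.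
by rewrite st // tr.
Qed.
Canonical dsum_equiv :=
  EquivRel dsum_rel dsum_rel_refl dsum_rel_sym dsum_rel_trans.
Definition dsum : Type := {eq_quot dsum_rel}.
HB.instance Definition _ := Choice.on dsum.

Definition dpi (s : fsum) : dsum := \pi_{eq_quot dsum_rel} s.
Definition drepr (x : dsum) : fsum := repr (x : {eq_quot dsum_rel}).
Definition dsum_eval (U : lmodType k) (u : forall i, M i -> U) (x : dsum) : U :=
  fsum_eval u (drepr x).

Lemma dpiK x : dpi (drepr x) = x. Proof. exact: reprK. Qed.
Lemma dsum_eval_pi (U : lmodType k) (u : forall i, M i -> U) s :
  (forall i, linear (u i)) -> dsum_eval u (dpi s) = fsum_eval u s.
Proof.
move=> ul; have : dpi (drepr (dpi s)) = dpi s by rewrite dpiK.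
by move/eqP; rewrite eqmodE => /asboolP E; rewrite /dsum_eval E.
Qed.
Lemma dpi_eq s t :
  (forall (U : lmodType k) (u : forall i, M i -> U),
    (forall i, linear (u i)) -> fsum_eval u s = fsum_eval u t) -> dpi s = dpi t.
Proof. by move=> st; apply/eqP; rewrite eqmodE; apply/asboolP. Qed.

Definition fscale (a : k) (s : fsum) : fsum :=
  [seq existT (fun i => M i) (projT1 p) (a *: projT2 p) | p <- s].
Definition dadd (x y : dsum) : dsum := dpi (drepr x ++ drepr y).
Definition dzero : dsum := dpi [::].
Definition dscale a (x : dsum) : dsum := dpi (fscale a (drepr x)).

Section Eval.
Variables (U : lmodType k) (u : forall i, M i -> U).
Hypothesis ul : forall i, linear (@u i).
Let fsum_evalZ a s : fsum_eval (@u) (fscale a s) = a *: fsum_eval (@u) s.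
Proof.
rewrite /fsum_eval big_map scaler_sumr; apply: eq_bigr => p _ /=.
by rewrite (linZ (@ul _)).
Qed.
Lemma eval_dadd x y : dsum_eval (@u) (dadd x y) = dsum_eval (@u) x + dsum_eval (@u) y.
Proof. by rewrite /dadd dsum_eval_pi // /fsum_eval big_cat. Qed.
Lemma eval_dzero : dsum_eval (@u) dzero = 0.
Proof. by rewrite /dzero dsum_eval_pi // /fsum_eval big_nil. Qed.
Lemma eval_dscale a x : dsum_eval (@u) (dscale a x) = a *: dsum_eval (@u) x.
Proof. by rewrite /dscale dsum_eval_pi. Qed.
End Eval.
Let evalE := (eval_dadd, eval_dzero, eval_dscale).

Lemma dsum_eq x y :
  (forall (U : lmodType k) (u : forall i, M i -> U),
    (forall i, linear (u i)) -> dsum_eval u x = dsum_eval u y) -> x = y.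
Proof. by move=> xy; rewrite -(dpiK x) -(dpiK y); apply: dpi_eq. Qed.

Fact daddA : associative dadd.
Proof. by move=> x y z; apply: dsum_eq => U u ul; rewrite !evalE // addrA. Qed.
Fact daddC : commutative dadd.
Proof. by move=> x y; apply: dsum_eq => U u ul; rewrite !evalE // addrC. Qed.
Fact dadd0 : left_id dzero dadd.
Proof. by move=> x; apply: dsum_eq => U u ul; rewrite !evalE // add0r. Qed.
Fact daddN : left_inverse dzero (dscale (-1)) dadd.
Proof.
by move=> x; apply: dsum_eq => U u ul; rewrite !evalE // scaleN1r addNr.
Qed.
HB.instance Definition _ := GRing.isZmodule.Build dsum daddA daddC dadd0 daddN.
Fact dscaleA a b x : dscale a (dscale b x) = dscale (a * b) x.
Proof. by apply: dsum_eq => U u ul; rewrite !evalE // scalerA. Qed.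
Fact dscale1 : left_id 1 dscale.
Proof. by move=> x; apply: dsum_eq => U u ul; rewrite !evalE // scale1r. Qed.
Fact dscaleDr : right_distributive dscale +%R.
Proof. by move=> a x y; apply: dsum_eq => U u ul; rewrite !evalE // scalerDr. Qed.
Fact dscaleDl x : {morph dscale^~ x : a b / a + b}.
Proof. by move=> a b; apply: dsum_eq => U u ul; rewrite !evalE // scalerDl. Qed.
HB.instance Definition _ :=
  GRing.Zmodule_isLmodule.Build k dsum dscaleA dscale1 dscaleDr dscaleDl.

Definition dinj i (m : M i) : dsum := dpi [:: existT (fun i => M i) i m].

Lemma dsum_eval_lin (U : lmodType k) (u : forall i, M i -> U) :
  (forall i, linear (u i)) -> linear (dsum_eval u).
Proof. by move=> ul a x y; rewrite eval_dadd // eval_dscale. Qed.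

Lemma dsum_evalE (U : lmodType k) (u : forall i, M i -> U) :
  (forall i, linear (u i)) -> forall i m, dsum_eval u (dinj m) = u i m.
Proof. by move=> ul i m; rewrite /dinj dsum_eval_pi // /fsum_eval big_seq1. Qed.

Lemma dinj_lin i : linear (@dinj i).
Proof.
move=> a x y; apply: dsum_eq => U u ul.
by rewrite (dsum_eval_lin ul) !dsum_evalE // ul.
Qed.

Lemma dsumE x : exists s : seq {i & M i}, x = \sum_(p <- s) dinj (projT2 p).
Proof.
exists (drepr x); apply: dsum_eq => U u ul.
rewrite [RHS](big_morph _ (linD (dsum_eval_lin ul)) (lin0 (dsum_eval_lin ul))).
by apply: eq_bigr => p _; rewrite dsum_evalE.
Qed.

Lemma dsum_ind (P : dsum -> Prop) : P 0 -> (forall x y, P x -> P y -> P (x + y)) ->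
  (forall i (m : M i), P (dinj m)) -> forall x, P x.
Proof.
by move=> P0 PD Pi x; have [s ->] := dsumE x; apply: (big_ind P) => // p _; apply: Pi.
Qed.

Lemma dsum_ext (U : lmodType k) (f g : dsum -> U) : linear f -> linear g ->
  (forall i (m : M i), f (dinj m) = g (dinj m)) -> f =1 g.
Proof.
move=> fl gl fg; apply: dsum_ind => // [|x y fx fy]; first by rewrite !lin0.
by rewrite !linD // fx fy.
Qed.
End DirectSum.

(** * Separation of tensors by functionals on the second factor *)

Section Separation.
Variables (k : fieldType) (V C : lmodType k).

Definition pairing (ξ : C -> k) (t : V ⊗ C) : V := \tsum_(v ⊗ c := t) ξ c *: v.

Lemma pairing_bil (ξ : C -> k) : scalar ξ ->
  is_bilinear (fun (v : V) (c : C) => ξ c *: v).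
Proof.
move=> ξl; split=> [c a v w|v a c d].
  by rewrite scalerDr !scalerA mulrC.
by rewrite ξl scalerDl scalerA.
Qed.

Lemma pairing_lin ξ : scalar ξ -> linear (pairing ξ).
Proof. by move=> ξl; apply/tsum_linear/pairing_bil. Qed.

Lemma pairingE ξ v c : scalar ξ -> pairing ξ (v ⊗ c) = ξ c *: v.
Proof. by move=> ξl; rewrite /pairing tsum_pure //; apply: pairing_bil. Qed.

(** A generalized inverse of the map from k^n to C given by the second components c_i yields
    functionals ξ_i with c_j = ∑ ξ_i(c_j) c_i for all j, even if the c_i are dependent. Hence t = ∑
    pairing(ξ_i, t) ⊗ c_i. *)
Lemma pairing_eq0 (t : V ⊗ C) : (forall ξ, scalar ξ -> pairing ξ t = 0) -> t = 0.
Proof.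
move=> t0; pose s := trepr t.
have tE : t = \sum_(p <- s) (p.1 ⊗ p.2) by exact: tpureE.
pose x0 : V * C := (0, 0); pose n := size s.
pose f (u : 'rV[k]_n) : C := \sum_(i < n) u ord0 i *: (nth x0 s i).2.
have fl : linear f.
  move=> a u v; rewrite /f scaler_sumr -big_split; apply: eq_bigr => i _ /=.
  by rewrite !mxE scalerDl scalerA.
have [g [gl fgf]] := generalized_inverse fl.
have fd i : f (delta_mx ord0 i) = (nth x0 s i).2.
  rewrite /f (bigD1 i) //= mxE !eqxx scale1r big1 ?addr0 // => j ji.
  by rewrite mxE eqxx (negPf ji) scale0r.
pose ξ i c : k := g c ord0 i.
have ξl i : scalar (ξ i) by move=> a c d; rewrite /ξ gl !mxE.
rewrite tE; transitivity (\sum_(i < n) (pairing (ξ i) t ⊗ (nth x0 s i).2)); last first.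
  by rewrite big1 // => i _; rewrite t0 // (lin0 (proj1 (tpure_bilinear V C) _)).
have pl c := proj1 (tpure_bilinear V C) c; have pr v := proj2 (tpure_bilinear V C) v.
transitivity (\sum_(p <- s) \sum_(i < n) ((ξ i p.2 *: p.1) ⊗ (nth x0 s i).2)).
  rewrite !(big_nth x0) !big_mkord; apply: eq_bigr => j _.
  rewrite -{1}fd -fgf fd /f.
  rewrite (big_morph _ (linD (pr _)) (lin0 (pr _))); apply: eq_bigr => i _.
  by rewrite (linZ (pr _)) (linZ (pl _)).
rewrite exchange_big; apply: eq_bigr => i _ /=.
by rewrite -(big_morph _ (linD (pl _)) (lin0 (pl _))).
Qed.

Lemma pairing_inj (s t : V ⊗ C) :
  (forall ξ, scalar ξ -> pairing ξ s = pairing ξ t) -> s = t.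
Proof.
move=> st; apply/subr0_eq/pairing_eq0 => ξ ξl.
by rewrite (linB (pairing_lin ξl)) st // subrr.
Qed.
End Separation.

(** * Spaces with an action and a coaction *)

Section Operators.
Variables (k : fieldType) (A : kalgType k) (C : lmodType k).
Implicit Types M N : act_coact A C.

Definition tmap (V W : lmodType k) (f : V -> W) (t : V ⊗ C) : W ⊗ C :=
  \tsum_(v ⊗ c := t) f v ⊗ c.

Lemma tmap_lin (V W : lmodType k) (f : V -> W) : linear f -> linear (tmap f).
Proof. by move=> fl; rewrite /tmap; lin. Qed.

Lemma pairing_tmap (V W : lmodType k) (f : V -> W) (ξ : C -> k) t :
  linear f -> scalar ξ -> pairing ξ (tmap f t) = f (pairing ξ t).
Proof.
move=> fl ξl; rewrite /tmap (linear_tsum _ _ (pairing_lin ξl)).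
rewrite [in RHS]/pairing (linear_tsum _ _ fl); apply: eq_tsum => v c.
by rewrite pairingE // (linZ fl).
Qed.

Definition letter := (A + {ξ : C -> k | scalar ξ})%type.

Definition op M (o : letter) (m : M) : M :=
  match o with inl a => ac_act a m | inr ξ => pairing (sval ξ) (ac_coact m) end.

Definition is_linear M : Prop :=
  (forall a, linear (@ac_act k A C M a)) /\ linear (@ac_coact k A C M).

Lemma op_lin M o : is_linear M -> linear (@op M o).
Proof.
case: o => [a|[ξ ξl]] [al cl]; first exact: al.
by apply: (lin_comp (pairing_lin ξl)).
Qed.

(* Colinearity can be tested against linear functionals on C, so that comodule
   maps become maps commuting with operators. *)
Lemma linear_colinearP M N (f : M -> N) : is_linear_colinear f <->
  linear f /\ forall o m, f (op o m) = op o (f m).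
Proof.
split=> [[fl fA fC]|[fl fO]].
  split=> // -[a|[ξ ξl]] m /=; first exact: fA.
  by rewrite -pairing_tmap // fC.
split=> // [a m|m]; first exact: (fO (inl a)).
apply: pairing_inj => ξ ξl; rewrite pairing_tmap //.
by rewrite (fO (inr (exist _ ξ ξl))).
Qed.

Section Transport.
Variables (M : act_coact A C) (Q : lmodType k) (i : Q -> M) (r : M -> Q).
Hypotheses (il : linear i) (rl : linear r) (hM : is_linear M).

(** The operators of M compressed to a retract. They commute with [i] when its image is stable, and
    with [r] when its kernel is. *)
Definition transport : act_coact A C :=
  @ActCoact k A C Q (fun a q => r (ac_act a (i q))) (fun q => tmap r (ac_coact (i q))).

Lemma transport_op o (q : transport) : op o q = r (op o (i q)).
Proof. by case: o => [a|[ξ ξl]] //=; rewrite pairing_tmap. Qed.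

Lemma transport_linear : is_linear transport.
Proof.
have [al cl] := hM; split=> [a|]; first exact: (lin_comp rl (lin_comp (al a) il)).
exact: (lin_comp (tmap_lin rl) (lin_comp cl il)).
Qed.
End Transport.

Section DsumAc.
Variables (I : Type) (X : I -> act_coact A C).
Hypothesis Xl : forall i, is_linear (X i).
Local Notation D := (@dsum k I (fun j => ac_mod (X j))).
Local Notation inj i := (@dinj k I (fun j => ac_mod (X j)) i).

Definition dsum_ac : act_coact A C :=
  @ActCoact k A C D
    (fun a => dsum_eval (fun i m => inj i (ac_act a m)))
    (dsum_eval (fun i m => tmap (inj i) (ac_coact m))).

Let act_inj_lin a i : linear (fun m : X i => inj i (ac_act a m)).
Proof. by have [al _] := Xl i; exact: (lin_comp (@dinj_lin _ _ _ i) (al a)). Qed.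
Let coact_inj_lin i : linear (fun m : X i => tmap (inj i) (ac_coact m)).
Proof.
by have [_ cl] := Xl i; exact: (lin_comp (tmap_lin (@dinj_lin _ _ _ i)) cl).
Qed.

Lemma dsum_ac_linear : is_linear dsum_ac.
Proof. by split=> [a|]; apply: dsum_eval_lin. Qed.

Lemma dsum_ac_op o i (m : X i) : op o (inj i m : dsum_ac) = inj i (op o m).
Proof.
case: o => [a|[ξ ξl]] /=; first by rewrite dsum_evalE.
by rewrite dsum_evalE // pairing_tmap //; exact: dinj_lin.
Qed.
End DsumAc.

End Operators.

(** * Categories of spaces with an action and a coaction *)

Section Category.
Variables (k : fieldType) (A : kalgType k) (C : lmodType k).

(* Such a class is closed under subobjects, quotients and coproducts. *)
Record closed_class (P : act_coact A C -> Prop) : Prop := {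
  cc_linear : forall M, P M -> is_linear M;
  cc_sub : forall (M N : act_coact A C) (f : M -> N),
    is_linear_colinear f -> injective f -> P N -> P M;
  cc_generated : forall N : act_coact A C, is_linear N ->
    (forall Q : N -> Prop, Q 0 -> (forall x y, Q x -> Q y -> Q (x + y)) ->
      (forall (M : act_coact A C) (f : M -> N) m,
        P M -> is_linear_colinear f -> Q (f m)) ->
      forall n, Q n) ->
    P N
}.

Variable P : act_coact A C -> Prop.
Hypothesis hP : closed_class P.
Local Notation cat := (ac_category (fun M : {M : act_coact A C | P M} => sval M)).
Implicit Types x y z : cat.
Local Notation "'letter'" := (letter A C).

Let obl x : is_linear (sval x). Proof. exact: (cc_linear hP (svalP x)). Qed.
Let opl x o : linear (@op k A C (sval x) o). Proof. exact/op_lin/obl. Qed.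

Lemma hom_lin x y (f : hom x y) : linear (sval f).
Proof. by have [] := svalP f. Qed.
Lemma hom_op x y (f : hom x y) o m : sval f (op o m) = op o (sval f m).
Proof. by have [/linear_colinearP []] := conj (svalP f) I. Qed.
Lemma hom_eq x y (f g : hom x y) : sval f =1 sval g -> f = g.
Proof. by move=> fg; apply: ac_hom_ext; apply: funext. Qed.
Lemma hom_mk x y (f : sval x -> sval y) : linear f ->
  (forall o m, f (op o m) = op o (f m)) -> exists h : hom x y, sval h =1 f.
Proof.
move=> fl fO; have fP : is_linear_colinear f by apply/linear_colinearP.
by exists (exist _ f fP).
Qed.
Lemma hom_cut x y z (f : hom y z) (g : hom x z) :
  injective (sval f) -> (forall m, exists n, sval g m = sval f n) ->
  exists h : hom x y, f ⊚ h = g.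
Proof.
move=> fi /choice[h hv].
have [||h' h'E] := @hom_mk x y h.
- by move=> a m n; apply: fi; rewrite (hom_lin f) -!hv (hom_lin g).
- by move=> o m; apply: fi; rewrite hom_op -!hv hom_op.
by exists h'; apply: hom_eq => m; rewrite /= h'E -hv.
Qed.
Lemma hom_factor x y z (f : hom x y) (g : hom x z) :
  (forall n, exists m, n = sval f m) -> (forall m, sval f m = 0 -> sval g m = 0) ->
  exists h : hom y z, h ⊚ f = g.
Proof.
move=> /choice[s sP] fg.
have fg' m n : sval f m = sval f n -> sval g m = sval g n.
  move=> E; apply/subr0_eq; rewrite -(linB (hom_lin g)) fg //.
  by rewrite (linB (hom_lin f)) E subrr.
have [||h hE] := @hom_mk y z (fun n => sval g (s n)).
- move=> a m n; rewrite -(hom_lin g); apply: fg'.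
  by rewrite (hom_lin f) -!sP.
- by move=> o m; rewrite -hom_op; apply: fg'; rewrite hom_op -!sP.
by exists h; apply: hom_eq => m; rewrite /= hE; apply: fg'; rewrite -sP.
Qed.

Lemma subobject x (K : sval x -> Prop) : is_sub K ->
  (forall o m, K m -> K (op o m)) ->
  exists y (i : hom y x), injective (sval i) /\ forall m, K m <-> exists n, m = sval i n.
Proof.
move=> hK KO; have [Q [i [r [il rl rK iK Ki]]]] := subspace hK.
pose Y := transport i r.
have iP : @is_linear_colinear k A C Y (sval x) i.
  apply/linear_colinearP; split=> // o q.
  by rewrite transport_op // Ki //; apply: KO.
have i_inj : injective i by exact: can_inj rK.
exists (exist P Y (cc_sub hP iP i_inj (svalP x))), (exist _ i iP); split=> // m.
by split=> [/Ki <-|[n ->]] //; exists (r m).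
Qed.

Lemma quotient_object x (K : sval x -> Prop) : is_sub K ->
  (forall o m, K m -> K (op o m)) ->
  exists y (p : hom x y), (forall n, exists m, n = sval p m)
    /\ forall m, sval p m = 0 <-> K m.
Proof.
move=> hK KO; have [Q [p [s [pl sl sK pK]]]] := quotient hK.
pose Y := transport s p.
have pP : @is_linear_colinear k A C (sval x) Y p.
  apply/linear_colinearP; split=> // o m.
  rewrite transport_op //; apply/subr0_eq; rewrite -(linB pl) -(linB (@opl x o)).
  by apply/pK/KO/pK; rewrite (linB pl) sK subrr.
have psurj n : exists m, n = p m by exists (s n).
have PY : P Y.
  apply: (cc_generated hP) => [|R _ _ RM n]; first exact: transport_linear.
  by have [m ->] := psurj n; exact: RM (svalP x) pP.
by exists (exist P Y PY), (exist _ p pP); split.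
Qed.

(** The last two clauses keep track of the underlying space: it is spanned by the images and extends
    families of merely linear maps, as needed for cofree objects and for colimits. *)
Lemma coproduct (I : small) (X : I -> cat) :
  exists Q (i : forall j, hom (X j) Q),
    [/\ is_coproduct i,
        forall n : sval Q, exists s : seq {j & sval (X j)},
          n = \sum_(p <- s) sval (i (projT1 p)) (projT2 p)
      & forall (U : lmodType k) (u : forall j, sval (X j) -> U),
          (forall j, linear (u j)) -> exists2 v : sval Q -> U, linear v
            & forall j m, v (sval (i j) m) = u j m].
Proof.
pose D := dsum_ac (fun j => sval (X j)).
have Dl : is_linear D by apply: dsum_ac_linear.
have iP j : is_linear_colinear (dinj (M := fun j => sval (X j)) (i := j) : _ -> D).
  apply/linear_colinearP; split=> [|o m]; first exact: dinj_lin.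
  by rewrite dsum_ac_op.
have PD : P D.
  apply: (cc_generated hP) => // R R0 RD RM; apply: dsum_ind => // j m.
  exact: RM (svalP (X j)) (iP j).
exists (exist P D PD), (fun j => exist _ _ (iP j)); split; last 2 first.
- exact: dsumE.
- move=> U u ul; exists (dsum_eval u); first exact: dsum_eval_lin.
  by move=> j m; rewrite /= dsum_evalE.
move=> Y u; have ul j := hom_lin (u j).
have [||h hE] := @hom_mk (exist P D PD) Y (dsum_eval (fun j => sval (u j))).
- exact: dsum_eval_lin.
- move=> o; apply: dsum_ext => [||j m].
  + exact: lin_comp (dsum_eval_lin ul) (op_lin o Dl).
  + exact: lin_comp (@opl Y o) (dsum_eval_lin ul).
  by rewrite dsum_ac_op // !dsum_evalE // hom_op.
have hi j : h ⊚ (exist _ _ (iP j) : hom (X j) (exist P D PD)) = u j.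
  by apply: hom_eq => m; rewrite /= hE dsum_evalE.
exists h; split=> // h' h'P; apply: hom_eq; apply: dsum_ext => [||j m].
- exact: (hom_lin h).
- exact: (hom_lin h').
by have /(congr1 (fun f => sval f m)) := etrans (hi j) (esym (h'P j)).
Qed.

Lemma coproducts : has_small_coproducts cat.
Proof. by move=> I X; have [Q [i [iP _ _]]] := coproduct X; exists Q, i. Qed.

End Category.

(** * Abelian structure, read off on elements *)

Section AbelianCategory.
Variables (k : fieldType) (A : kalgType k) (C : lmodType k).
Variables (P : act_coact A C -> Prop) (hP : closed_class P).
Local Notation cat := (ac_category (fun M : {M : act_coact A C | P M} => sval M)).
Implicit Types x y z w : cat.

Let opl x o : linear (@op k A C (sval x) o).
Proof. exact/op_lin/(cc_linear hP)/(svalP x). Qed.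

Fact hom_zeroP x y : is_linear_colinear (fun _ : sval x => 0 : sval y).
Proof.
apply/linear_colinearP; split=> [|o m]; first exact: lin_zero.
by rewrite (lin0 (@opl y o)).
Qed.
Definition hom_zero x y : hom x y := exist _ _ (hom_zeroP x y).
Fact hom_addP x y (f g : hom x y) : is_linear_colinear (fun m => sval f m + sval g m).
Proof.
apply/linear_colinearP; split=> [|o m]; first exact: lin_add (hom_lin f) (hom_lin g).
by rewrite (linD (@opl y o)) !hom_op.
Qed.
Definition hom_add x y (f g : hom x y) : hom x y := exist _ _ (hom_addP f g).
Fact hom_oppP x y (f : hom x y) : is_linear_colinear (fun m => - sval f m).
Proof.
apply/linear_colinearP; split=> [|o m]; first exact: lin_opp (hom_lin f).
by rewrite (linN (@opl y o)) hom_op.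
Qed.
Definition hom_opp x y (f : hom x y) : hom x y := exist _ _ (hom_oppP f).

Definition cat_preadditive : preadditive cat.
Proof.
refine (@Preadditive cat hom_add hom_zero hom_opp _ _ _ _ _ _).
- by move=> x y f g h; apply: hom_eq => m /=; rewrite addrA.
- by move=> x y f g; apply: hom_eq => m /=; rewrite addrC.
- by move=> x y f; apply: hom_eq => m /=; rewrite add0r.
- by move=> x y f; apply: hom_eq => m /=; rewrite addNr.
- by move=> x y z g h f; apply: hom_eq.
- by move=> x y z g h f; apply: hom_eq => m /=; rewrite (linD (hom_lin g)).
Defined.
Local Notation Pre := cat_preadditive.

Lemma hom_eqE x y (f g : hom x y) m : f = g -> sval f m = sval g m.
Proof. by move=> ->. Qed.

Lemma ker_stable x y (f : hom x y) o m : sval f m = 0 -> sval f (op o m) = 0.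
Proof. by move=> fm; rewrite hom_op fm (lin0 (@opl y o)). Qed.
Lemma im_stable x y (f : hom x y) o n :
  (exists m, n = sval f m) -> exists m, op o n = sval f m.
Proof. by move=> [m ->]; exists (op o m); rewrite hom_op. Qed.

Lemma kernel_object x y (f : hom x y) : exists z (i : hom z x),
  injective (sval i) /\ forall m, sval f m = 0 <-> exists n, m = sval i n.
Proof.
exact: (subobject hP (ker_sub (hom_lin f)) (fun o m => @ker_stable x y f o m)).
Qed.
Lemma cokernel_object x y (f : hom x y) : exists z (p : hom y z),
  (forall n, exists m, n = sval p m)
  /\ forall m, sval p m = 0 <-> exists n, m = sval f n.
Proof.
exact: (quotient_object hP (im_sub (hom_lin f)) (fun o m => @im_stable x y f o m)).
Qed.

(** A monomorphism identifies the inclusion of its concrete kernel with the zero map, so that kernel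
    vanishes. *)
Lemma mono_injP x y (f : hom x y) : mono f <-> injective (sval f).
Proof.
split=> [fm|fi z g h /hom_eqE E]; last by apply: hom_eq => m; apply/fi/E.
have [z [i [_ iP]]] := kernel_object f.
have i0 : i = hom_zero z x.
  apply: fm; apply: hom_eq => n /=; rewrite (lin0 (hom_lin f)).
  by apply/iP; exists n.
move=> m n E; apply/subr0_eq.
have /iP[p ->] : sval f (m - n) = 0 by rewrite (linB (hom_lin f)) E subrr.
by rewrite i0.
Qed.

Lemma epi_surj x y (f : hom x y) : epi f -> forall n, exists m, n = sval f m.
Proof.
move=> fe; have [z [p [_ pP]]] := cokernel_object f.
have p0 : p = hom_zero y z.
  by apply: fe; apply: hom_eq => m /=; apply/pP; exists m.
by move=> n; apply/pP; rewrite p0.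
Qed.

Lemma is_kernelP x y z (f : hom x y) (i : hom z x) : is_kernel Pre f i <->
  injective (sval i) /\ forall m, sval f m = 0 <-> exists n, m = sval i n.
Proof.
split=> [[fi0 fiP]|[ii iP]]; last first.
  split=> [|w g /hom_eqE fg].
    by apply: hom_eq => n /=; apply/iP; exists n.
  have [|h hE] := @hom_cut _ _ _ _ w z x i g ii.
    by move=> m; apply/iP; exact: fg.
  exists h; split=> // h' h'E; apply: hom_eq => n; apply: ii.
  exact: (hom_eqE n (etrans hE (esym h'E))).
split=> [|m]; last first.
  split=> [fm|[n ->]]; last exact: (hom_eqE n fi0).
  have [y' [j [_ jP]]] := kernel_object f.
  have [|u [uE _]] := fiP y' j; first by apply: hom_eq => n /=; apply/jP; exists n.
  by have [n ->] := (jP m).1 fm; exists (sval u n); rewrite -(hom_eqE n uE).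
apply/mono_injP => w g h E.
have [|u [_ uE]] := fiP w (i ⊚ g).
  by apply: hom_eq => n /=; exact: (hom_eqE (sval g n) fi0).
by rewrite -(uE g) // -(uE h).
Qed.

Lemma is_cokernelP x y z (f : hom x y) (p : hom y z) : is_cokernel Pre f p <->
  (forall n, exists m, n = sval p m)
  /\ forall m, sval p m = 0 <-> exists n, m = sval f n.
Proof.
split=> [[pf0 pfP]|[ps pP]]; last first.
  split=> [|w g /hom_eqE gf].
    by apply: hom_eq => n /=; apply/pP; exists n.
  have [|h hE] := @hom_factor _ _ _ _ y z w p g ps.
    by move=> m /pP[n ->]; exact: gf.
  exists h; split=> // h' h'E; apply: hom_eq => n; have [m ->] := ps n.
  exact: (hom_eqE m (etrans hE (esym h'E))).
split=> [|m]; last first.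
  split=> [pm|[n ->]]; last exact: (hom_eqE n pf0).
  have [q [j [_ jP]]] := cokernel_object f.
  have [|u [uE _]] := pfP q j; first by apply: hom_eq => n /=; apply/jP; exists n.
  apply/jP; rewrite -(hom_eqE m uE) /= pm; exact: (lin0 (hom_lin u)).
apply: epi_surj => w g h E.
have [|u [_ uE]] := pfP w (g ⊚ p).
  by apply: hom_eq => n; exact: etrans (congr1 (sval g) (hom_eqE n pf0)) (lin0 (hom_lin g)).
by rewrite -(uE g) // -(uE h).
Qed.

Lemma short_exactP x y z (f : hom x y) (g : hom y z) : short_exact Pre f g <->
  [/\ injective (sval f), forall n, exists m, n = sval g m
    & forall m, sval g m = 0 <-> exists n, m = sval f n].
Proof.
split=> [[/is_kernelP[fi E] /is_cokernelP[gs _]]|[fi gs E]]; first by [].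
by split; [apply/is_kernelP|apply/is_cokernelP].
Qed.

Lemma cat_zero_object : exists z : cat, zero_object z.
Proof.
have [Q [i [_ Qi _]]] := coproduct hP (fun j : void => of_void cat j).
have Q0 (n : sval Q) : n = 0.
  by have [s ->] := Qi n; apply: big1 => -[[]].
exists Q => x; split.
  exists (hom_zero Q x); split=> // f _; apply: hom_eq => n.
  by rewrite [n]Q0; exact: esym (lin0 (hom_lin f)).
by exists (hom_zero x Q); split=> // f _; apply: hom_eq => n; rewrite [RHS]Q0.
Qed.

Lemma cat_biproduct x y : exists b i1 i2 p1 p2, @is_biproduct cat Pre x y b i1 i2 p1 p2.
Proof.
pose X (b : bool) := if b then x else y.
have [Q [i [iP _ _]]] := coproduct hP X.
pose u1 b : hom (X b) x := if b as b return hom (X b) x then idm x else hom_zero y x.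
pose u2 b : hom (X b) y := if b as b return hom (X b) y then hom_zero x y else idm y.
have [p1 [p1E _]] := iP x u1; have [p2 [p2E _]] := iP y u2.
exists Q, (i true), (i false), p1, p2; split.
- exact: (p1E true).
- exact: (p2E false).
- exact: (p1E false).
- exact: (p2E true).
(* The identity and the sum of the two idempotents agree on both summands, so uniqueness identifies
   them. *)
have [h [_ hU]] := iP Q i.
rewrite -(hU (idm Q)); last by move=> j; exact: comp_idl_.
apply/esym/hU => j; apply: hom_eq => m.
have /= := hom_eqE m (p1E j); have /= := hom_eqE m (p2E j) => -> ->.
case: j m => m /=; first by rewrite (lin0 (hom_lin (i false))) addr0.
by rewrite (lin0 (hom_lin (i true))) add0r.
Qed.

Lemma cat_abelian : abelian Pre.
Proof.
split.
- exact: cat_zero_object.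
- exact: cat_biproduct.
- by move=> x y f; have [z [i iP]] := kernel_object f; exists z, i; apply/is_kernelP.
- by move=> x y f; have [z [p pP]] := cokernel_object f; exists z, p; apply/is_cokernelP.
- move=> x y f /mono_injP fi; have [z [p [_ pP]]] := cokernel_object f.
  by exists z, p; apply/is_kernelP.
- move=> x y f /epi_surj fs; have [z [i [_ iP]]] := kernel_object f.
  by exists z, i; apply/is_cokernelP.
Qed.
End AbelianCategory.

(** * A generator, cofree objects and injectives *)

Section GeneratorsInjectives.
Variables (k : fieldType) (A : kalgType k) (C : lmodType k).
Variables (P : act_coact A C -> Prop) (hP : closed_class P).
Local Notation cat := (ac_category (fun M : {M : act_coact A C | P M} => sval M)).
Implicit Types x y z : cat.
Local Notation Pre := (cat_preadditive hP).

Let opl x o : linear (@op k A C (sval x) o).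
Proof. exact/op_lin/(cc_linear hP)/(svalP x). Qed.

Definition word := seq (letter A C).
Definition wop (M : act_coact A C) (s : word) (m : M) : M := foldr (@op k A C M) m s.

Lemma wop_lin x s : linear (@wop (sval x) s).
Proof. by elim: s => [|o s IHs] //=; exact: lin_comp (@opl x o) IHs. Qed.
Lemma hom_wop x y (f : hom x y) s m : sval f (wop s m) = wop s (sval f m).
Proof. by elim: s => //= o s <-; rewrite hom_op. Qed.
Lemma wop_op (M : act_coact A C) s o (m : M) : wop s (op o m) = wop (rcons s o) m.
Proof. by rewrite /wop foldr_rcons. Qed.

Definition word_space : lmodType k := dsum (fun _ : word => k^o : lmodType k).
Local Notation F := word_space.

(* The objects generated by one element are quotients of [word_space], hence
   isomorphic to one whose underlying space is the image of a projector of
   [word_space]; this makes their isomorphism classes a small family. *)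
Definition cyclic_index : Type :=
  {π : {linear F -> F} &
    {s : (A -> fixed π -> fixed π) * (fixed π -> fixed π ⊗ C)
      | P (@ActCoact k A C (fixed π) s.1 s.2)}}.
Definition cyclic (i : cyclic_index) : cat :=
  let: existT π (exist s hs) := i in exist P (@ActCoact k A C (fixed π) s.1 s.2) hs.

Lemma cyclic_cover x (n : sval x) :
  exists (i : cyclic_index) (φ : hom (cyclic i) x) (g : sval (cyclic i)),
    sval φ g = n.
Proof.
have ul s : linear (fun a : k^o => a *: wop s n).
  by move=> a b c; rewrite scalerDl scalerA.
(* The image of [e] is the subobject generated by n; a generalized inverse realizes it inside the
   fixed space of a projector of [word_space]. *)
pose e : F -> sval x := dsum_eval (fun s (a : k^o) => a *: wop s n).
have el : linear e by exact: dsum_eval_lin.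
have [g [gl ege]] := generalized_inverse el.
have πl : linear (fun u => g (e u)) by exact: lin_comp gl el.
pose π := HB.pack_for {linear F -> F} (fun u => g (e u))
  (GRing.isLinear.Build k F F *:%R (fun u => g (e u)) πl).
have [m|r rl rE] := @retract_lin _ F π (sval x) _ (lin_comp πl gl).
  by rewrite /= ege.
pose ι (q : fixed π) : sval x := e (fval q).
have ιl : linear ι by exact: lin_comp el (@fval_lin _ _ π).
have rK : cancel ι r by move=> q; apply: fval_inj; rewrite rE /ι ege; exact: (fixedP q).
have e_op o u : exists v, op o (e u) = e v.
  move: u; apply: dsum_ind => [|u u' [v uv] [v' uv']|s a].
  - by exists 0; rewrite !(lin0 el) (lin0 (@opl x o)).
  - by exists (v + v'); rewrite !(linD el) (linD (@opl x o)) uv uv'.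
  exists (dinj (i := o :: s) a).
  by rewrite /e !dsum_evalE // (linZ (@opl x o)).
pose Y := transport ι r.
have ιP : @is_linear_colinear k A C Y (sval x) ι.
  apply/linear_colinearP; split=> // o q; rewrite transport_op // /ι rE.
  by have [v ->] := e_op o (fval q); rewrite !ege.
have PY : P Y by exact: (cc_sub hP ιP (can_inj rK) (svalP x)).
exists (existT _ π (exist _ (@ac_act k A C Y, @ac_coact k A C Y) PY)).
exists (exist _ ι ιP), (r n).
have -> : n = e (dinj (M := fun _ : word => k^o) (i := [::]) 1).
  by rewrite /e dsum_evalE // scale1r.
by rewrite /= /ι rE !ege.
Qed.

Lemma hom_single (I : Type) (X : I -> cat) i y (φ : hom (X i) y) :
  exists u : forall j, hom (X j) y, u i = φ.
Proof.
exists (fun j => match pselect (i = j) with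
  | left e => eq_rect i (fun j => hom (X j) y) φ j e
  | right _ => hom_zero hP (X j) y end).
by case: pselect => // e; rewrite (Prop_irrelevance e erefl).
Qed.

Lemma cat_generator : exists G : cat, is_generator G.
Proof.
have [G [i [iP _ _]]] := coproduct hP cyclic.
exists G => x y f g fg; apply: hom_eq => n.
have [j [φ [m <-]]] := cyclic_cover n.
have [u ui] := hom_single φ; have [h [hE _]] := iP x u.
rewrite -ui -(hE j); exact: (hom_eqE (sval (i j) m) (fg h)).
Qed.

(* The value at [N] of the right adjoint of the forgetful functor to vector
   spaces. *)
Lemma cofree (N : lmodType k) : exists (R : cat) (e : sval R -> N),
  [/\ linear e,
      forall x (f : sval x -> N), linear f ->
        exists h : hom x R, forall m, e (sval h m) = f m
    & forall x (g h : hom x R), (forall m, e (sval g m) = e (sval h m)) -> g = h].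
Proof.
(* All linear maps from cyclic objects to N are taken at once; the induced [Φ] from the coproduct G
   to N is linear but not a morphism. *)
pose I : Type := {i : cyclic_index & {f : sval (cyclic i) -> N | linear f}}.
pose X (i : I) := cyclic (projT1 i).
have [G [ι [_ _ ιP]]] := coproduct hP X.
have [|Φ Φl Φι] := ιP N (fun i => sval (projT2 i)).
  by move=> i; exact: (svalP (projT2 i)).
(* The divisor is the largest subobject inside the kernel of [Φ]. Elements of the quotient are then
   determined by the values of [e] on all words applied to them, which forces uniqueness of
   lifts. *)
have [R [p [ps pK]]] : exists R (p : hom G R), (forall n, exists m, n = sval p m)
    /\ forall m, sval p m = 0 <-> forall s, Φ (wop s m) = 0.
  apply: (quotient_object hP); last by move=> o m Km s; rewrite wop_op Km.
  split=> [s|a u v Ku Kv s]; first by rewrite (lin0 (@wop_lin G s)) (lin0 Φl).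
  by rewrite (@wop_lin G s) Φl Ku Kv scaler0 addr0.
have [s sP] := choice ps; pose e r := Φ (s r).
have eE m : e (sval p m) = Φ m.
  apply/subr0_eq; rewrite -(linB Φl).
  by apply: ((pK _).1 _ [::]); rewrite (linB (hom_lin p)) -sP subrr.
have el : linear e.
  move=> a r r'; rewrite (sP r) (sP r') -(hom_lin p) !eE.
  exact: Φl.
have e0 r r' : (forall w, e (wop w r) = e (wop w r')) -> r = r'.
  move=> E; apply/subr0_eq; rewrite (sP r) (sP r') -(linB (hom_lin p)).
  apply/pK => w; rewrite -eE hom_wop (linB (hom_lin p)) -!sP.
  by rewrite (linB (@wop_lin R w)) (linB el) E subrr.
exists R, e; split=> // [x f fl|x g h gh]; last first.
  by apply: hom_eq => m; apply: e0 => w; rewrite -!hom_wop gh.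
have lift m : exists r, forall w, e (wop w r) = f (wop w m).
  have [i [φ [g <-]]] := cyclic_cover m.
  have fφ : linear (fun m => f (sval φ m)) by exact: lin_comp fl (hom_lin φ).
  pose j : I := existT _ i (exist _ _ fφ).
  exists (sval p (sval (ι j) g)) => w.
  by rewrite -!hom_wop eE Φι.
have [h hE] := choice lift.
have [||h' h'E] := @hom_mk _ _ _ _ x R h.
- move=> a m n; apply: e0 => w.
  by rewrite hE (@wop_lin x w) fl -!hE (@wop_lin R w) el.
- by move=> o m; apply: e0 => w; rewrite hE !wop_op hE.
by exists h' => m; rewrite h'E; exact: (hE m [::]).
Qed.

Lemma cat_enough_injectives : enough_injectives cat.
Proof.
move=> x; have [R [e [el eP eU]]] := cofree (sval x).
have [h hE] := eP x id (fun _ _ _ => erefl).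
exists R, h; split; last by apply/(mono_injP hP) => m n E; rewrite -(hE m) E hE.
move=> y z f /(mono_injP hP) fi g.
(* A linear map to the underlying space of x extends along an injection by a linear retraction;
   cofreeness turns this extension into a morphism. *)
have [r [rl frf]] := generalized_inverse (hom_lin f).
have rf : cancel (sval f) r by move=> m; apply: fi; rewrite frf.
have [|h' h'E] := eP z (fun m => e (sval g (r m))).
  exact: lin_comp el (lin_comp (hom_lin g) rl).
by exists h'; apply: eU => m; rewrite /= h'E rf.
Qed.
End GeneratorsInjectives.

(** * Filtered colimits computed on elements *)

Lemma eq_big_In (T : Type) (V : nmodType) (s : seq T) (F G : T -> V) :
  (forall p, List.In p s -> F p = G p) -> \sum_(p <- s) F p = \sum_(p <- s) G p.
Proof.
elim: s => [|p s IHs] FG; first by rewrite !big_nil.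
rewrite !big_cons FG; last by left.
by rewrite IHs // => q qs; apply: FG; right.
Qed.

Lemma In_map (T U : Type) (f : T -> U) s p :
  List.In p s -> List.In (f p) [seq f q | q <- s].
Proof. by elim: s => //= q s IHs [->|/IHs]; [left|right]. Qed.

Lemma ccompA (J : category) (x y z w : J) (h : hom z w) (g : hom y z) (f : hom x y) :
  h ⊚ (g ⊚ f) = h ⊚ g ⊚ f.
Proof. exact: comp_assoc_. Qed.

Lemma filtered_coequalize (J : category) : filtered J ->
  forall (l : J) (s : seq {i : J & hom i l}), exists l' (r : hom l l'),
    forall i (f g : hom i l), List.In (existT _ i f) s -> List.In (existT _ i g) s ->
      r ⊚ f = r ⊚ g.
Proof.
move=> [_ _ coeq] l; elim=> [|[i0 f0] s [l1 [r rP]]]; first by exists l, (idm l).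
have [l2 [r' r'P]] : exists l2 (r' : hom l1 l2),
    forall g, List.In (existT _ i0 g) s -> r' ⊚ r ⊚ f0 = r' ⊚ r ⊚ g.
  (* One comparison suffices: [r] already identifies all earlier arrows parallel to [f0]. *)
  have [[g0 g0s]|ng0] := pselect (exists g, List.In (existT _ i0 g) s).
    have [l2 [r' r'P]] := coeq _ _ (r ⊚ f0) (r ⊚ g0).
    by exists l2, r' => g gs; rewrite -!ccompA r'P (rP _ _ _ g0s gs).
  by exists l1, (idm l1) => g gs; case: ng0; exists g.
exists l2, (r' ⊚ r) => i f g [fE|fs] [gE|gs].
- have /= ii := congr1 (fun p => projT1 p) fE; move: ii f g fE gE => <- f g fE gE.
  by rewrite -(inj_pair2 _ _ _ _ _ fE) -(inj_pair2 _ _ _ _ _ gE).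
- have /= ii := congr1 (fun p => projT1 p) fE; move: ii f g fE gs => <- f g fE gs.
  by rewrite -(inj_pair2 _ _ _ _ _ fE); exact: r'P.
- have /= ii := congr1 (fun p => projT1 p) gE; move: ii f g gE fs => <- f g gE fs.
  by rewrite -(inj_pair2 _ _ _ _ _ gE); apply/esym/r'P.
by rewrite -!ccompA (rP _ _ _ fs gs).
Qed.

Section FilteredColimits.
Variables (k : fieldType) (A : kalgType k) (C : lmodType k).
Variables (P : act_coact A C -> Prop) (hP : closed_class P).
Local Notation cat := (ac_category (fun M : {M : act_coact A C | P M} => sval M)).
Local Notation Pre := (cat_preadditive hP).
Variables (I : small) (Jon : category_on I).
Local Notation J := (Category Jon).
Hypothesis hJ : filtered J.

Let opl (x : cat) o : linear (@op k A C (sval x) o).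
Proof. exact/op_lin/(cc_linear hP)/(svalP x). Qed.

Section OneDiagram.
Variables (G : functor J cat) (L : cat) (i : forall j, hom (G j) L).
Hypothesis hi : is_colimit i.

Let G_comp (j l m : J) (f : hom l m) (g : hom j l) n :
  sval (fmap G (f ⊚ g)) n = sval (fmap G f) (sval (fmap G g) n).
Proof. exact: (hom_eqE n (fmap_comp G f g)). Qed.
Let G_id (j : J) n : sval (fmap G (idm j)) n = n.
Proof. exact: (hom_eqE n (fmap_id G j)). Qed.
Let i_nat (j l : J) (f : hom j l) n : sval (i l) (sval (fmap G f) n) = sval (i j) n.
Proof. by have [ic _] := hi; exact: (hom_eqE n (ic _ _ f)). Qed.

(** The elements coming from a stage form a subobject, by directedness. The projection modulo it and
    the zero map agree on every stage, so they are equal. *)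
Lemma colimit_surj (n : sval L) : exists j m, n = sval (i j) m.
Proof.
have [[j0] directed _] := hJ; have [ic iU] := hi.
have hK : is_sub (fun n : sval L => exists j m, n = sval (i j) m).
  split=> [|a _ _ [j [m ->]] [j' [m' ->]]].
    by exists j0, 0; rewrite (lin0 (hom_lin (i j0))).
  have [l [[f] [g]]] := directed j j'.
  exists l, (a *: sval (fmap G f) m + sval (fmap G g) m').
  by rewrite (hom_lin (i l)) !i_nat.
have [|Q [p [_ pK]]] := quotient_object hP hK.
  by move=> o _ [j [m ->]]; exists j, (op o m); rewrite hom_op.
apply/pK.
have [|h [_ hU]] := iU Q (fun j => hom_zero hP (G j) Q).
  by move=> j l f; apply: hom_eq.
rewrite -(hU p) => [|j]; last by apply: hom_eq => m; apply/pK; exists j, m.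
rewrite (hU (hom_zero hP L Q)) // => j; exact: hom_eq.
Qed.

Let fam l := seq {j : J & (hom j l * sval (G j))%type}.
Let total l (s : fam l) : sval (G l) :=
  \sum_(p <- s) sval (fmap G (projT2 p).1) (projT2 p).2.
Let push l l' (r : hom l l') (s : fam l) : fam l' :=
  [seq existT (fun j : J => (hom j l' * sval (G j))%type) (projT1 p)
    (r ⊚ (projT2 p).1, (projT2 p).2) | p <- s].
Let totalM l l' (r : hom l l') s : total (push r s) = sval (fmap G r) (total s).
Proof.
rewrite /total big_map (big_morph _ (linD (hom_lin _)) (lin0 (hom_lin _))).
by apply: eq_bigr => p _; rewrite G_comp.
Qed.

(* In the quotient of the coproduct of the [G j] by the finite sums of elements
   that cancel at a common stage, an element vanishes only if it vanishes at a
   later stage; and this quotient receives a map from the colimit. *)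
Lemma colimit_eq0 j (m : sval (G j)) : sval (i j) m = 0 ->
  exists l (f : hom j l), sval (fmap G f) m = 0.
Proof.
have [[j0] directed _] := hJ; have [ic iU] := hi.
have [Q [ι [_ _ ιP]]] := coproduct hP (fun j : I => G j).
pose inc l (s : fam l) : sval Q := \sum_(p <- s) sval (ι (projT1 p)) (projT2 p).2.
have incM l l' (r : hom l l') s : inc l' (push r s) = inc l s by rewrite /inc big_map.
pose Z x := exists l (s : fam l), x = inc l s /\ total s = 0.
pose act l (f : forall j, sval (G j) -> sval (G j)) (s : fam l) : fam l :=
  [seq existT (fun j : J => (hom j l * sval (G j))%type) (projT1 p)
    ((projT2 p).1, f _ (projT2 p).2) | p <- s].
have inc_act l (f : forall j, sval (G j) -> sval (G j)) (φ : sval Q -> sval Q) s :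
    linear φ -> (forall j m, sval (ι j) (f j m) = φ (sval (ι j) m)) ->
    inc l (act l f s) = φ (inc l s).
  move=> φl fφ; rewrite /inc (big_morph _ (linD φl) (lin0 φl)) big_map.
  by apply: eq_bigr => p _; rewrite fφ.
have total_act l (f : forall j, sval (G j) -> sval (G j)) s :
    linear (f l) -> (forall j (g : hom j l) m, sval (fmap G g) (f j m)
      = f l (sval (fmap G g) m)) ->
    total (act l f s) = f l (total s).
  move=> fl fG; rewrite /total (big_morph _ (linD fl) (lin0 fl)) big_map.
  by apply: eq_bigr => p _; rewrite fG.
have scale_lin (x : cat) a : linear (fun m : sval x => a *: m).
  by move=> b m1 n; rewrite scalerDr !scalerA mulrC.
have hZ : is_sub Z.
  split=> [|a _ _ [l [s [-> s0]]] [l' [s' [-> s'0]]]].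
    by exists j0, [::]; rewrite /inc /total !big_nil.
  have [l2 [[f] [f']]] := directed l l'.
  exists l2, (act l2 (fun j m => a *: m) (push f s) ++ push f' s'); split.
    rewrite -(incM _ _ f s) -(incM _ _ f' s') [RHS]big_cat; congr (_ + _).
    apply/esym/(inc_act _ (fun j m => a *: m) (fun m => a *: m)) => // j1 m1.
    exact: (linZ (hom_lin _)).
  transitivity (a *: total (push f s) + total (push f' s')).
    rewrite [LHS]big_cat; congr (_ + _).
    apply: (total_act _ (fun j m => a *: m)) => // j1 g m1.
    exact: (linZ (hom_lin _)).
  by rewrite !totalM s0 s'0 !(lin0 (hom_lin _)) scaler0 addr0.
have ZO o x : Z x -> Z (op o x).
  move=> [l [s [-> s0]]]; exists l, (act l (fun j m => op o m) s); split.
    apply/esym/(inc_act _ (fun j m => op o m) (op o)) => // j1 m1.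
    exact: hom_op.
  rewrite (total_act _ (fun j m => op o m)) ?s0 ?(lin0 (@opl _ o)) // => j1 g m1.
  exact: hom_op.
have [R [p [_ pZ]]] := quotient_object hP hZ ZO.
have [|h [hE _]] := iU R (fun j => p ⊚ ι j).
  (* Modulo [Z] the inclusions form a cocone: n at stage l and its image at stage l' differ by a
     family cancelling at l'. *)
  move=> l l' f; apply: hom_eq => n; apply/subr0_eq.
  rewrite /= -(linB (hom_lin p)); apply/pZ.
  exists l', [:: existT (fun j : J => (hom j l' * sval (G j))%type) l'
      (idm l', sval (fmap G f) n); existT _ l (f, - n)].
  rewrite /inc /total !big_cons !big_nil /= !addr0 G_id.
  by rewrite !(linN (hom_lin _)) subrr.
move=> im0.
have /pZ[l [s [sE s0]]] : sval p (sval (ι j) m) = 0.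
  by rewrite -[LHS](hom_eqE m (hE j)) /= im0 (lin0 (hom_lin h)).
have [l1 [[f1] [g1]]] := directed j l.
(* The extra entry has value 0 and serves only to list [f1] among the arrows to be coequalized. *)
pose s1 : fam l1 := existT _ j (f1, 0) :: push g1 s.
pose arrows := [seq existT (fun j : J => hom j l1) (projT1 p) (projT2 p).1 | p <- s1].
have [l2 [r rP]] := filtered_coequalize hJ arrows.
(* A linear map on the coproduct allows one arrow per index, whereas [s1] may list several; after
   composing with [r] they agree, so any choice will do, and unlisted indices get 0. *)
pose τ (j : J) : hom (G j) (G l2) :=
  match pselect (exists f, List.In (existT _ j f) arrows) with
  | left E => fmap G (r ⊚ projT1 (cid E))
  | right _ => hom_zero hP (G j) (G l2) end.
have τE (p0 : {j : J & (hom j l1 * sval (G j))%type}) : List.In p0 s1 ->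
    τ (projT1 p0) = fmap G (r ⊚ (projT2 p0).1).
  move=> p0s; have p0a : List.In (existT _ (projT1 p0) (projT2 p0).1) arrows.
    exact: (In_map (fun p => existT (fun j : J => hom j l1) (projT1 p) (projT2 p).1) p0s).
  rewrite /τ; case: pselect => [E|[]]; last by exists (projT2 p0).1.
  by rewrite (rP _ _ _ (projT2 (cid E)) p0a).
have [|v vl vE] := ιP _ (fun j => sval (τ j)); first by move=> j'; exact: hom_lin.
exists l2, (r ⊚ f1).
have <- : τ j = fmap G (r ⊚ f1) by apply: (τE (existT _ j (f1, 0))); left.
rewrite -vE sE -(incM _ _ g1) /inc (big_morph _ (linD vl) (lin0 vl)).
transitivity (\sum_(p <- push g1 s) sval (fmap G (r ⊚ (projT2 p).1)) (projT2 p).2).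
  by apply: eq_big_In => q qs; rewrite vE τE //; right.
transitivity (sval (fmap G r) (total (push g1 s))).
  rewrite /total (big_morph _ (linD (hom_lin _)) (lin0 (hom_lin _))).
  by apply: eq_bigr => q _; rewrite G_comp.
by rewrite totalM s0 !(lin0 (hom_lin _)).
Qed.
End OneDiagram.
End FilteredColimits.

Lemma cat_exact_filtered_colimits (k : fieldType) (A : kalgType k) (C : lmodType k)
    (P : act_coact A C -> Prop) (hP : closed_class P) :
  exact_filtered_colimits (cat_preadditive hP).
Proof.
move=> I Jon J hJ F G K a b an bn ab LF LG LK iF iG iK hF hG hK la lb laE lbE.
have ai j : injective (sval (a j)) by have /short_exactP[] := ab j.
have bs j n : exists m, n = sval (b j) m.
  by have /short_exactP[_ /(_ n)] := ab j.
have abE j m : sval (b j) m = 0 <-> exists n, m = sval (a j) n.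
  by have /short_exactP[_ _ /(_ m)] := ab j.
have laE' j m := hom_eqE m (laE j); have lbE' j m := hom_eqE m (lbE j).
have an' j l f m := hom_eqE m (an j l f); have bn' j l f m := hom_eqE m (bn j l f).
have [[icF _] [icG _]] := (hF, hG).
apply/short_exactP; split.
- move=> m n E; apply/subr0_eq.
  have : sval la (m - n) = 0 by rewrite (linB (hom_lin la)) E subrr.
  have [j [u ->]] := colimit_surj hP hJ hF (m - n).
  rewrite [sval la _]laE' => /(colimit_eq0 hP hJ hG)[l [f fu]].
  rewrite -(hom_eqE u (icF _ _ f)) /=.
  have -> : sval (fmap F f) u = 0; last exact: (lin0 (hom_lin _)).
  apply: ai; rewrite (lin0 (hom_lin (a l))) -fu; exact: esym (an' _ _ f u).
- move=> n; have [j [u ->]] := colimit_surj hP hJ hK n.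
  have [v ->] := bs j u; exists (sval (iG j) v); exact: esym (lbE' j v).
move=> n; split=> [|[m ->]].
  have [j [u ->]] := colimit_surj hP hJ hG n.
  rewrite [sval lb _]lbE' => /(colimit_eq0 hP hJ hK)[l [f fu]].
  have /abE[v vE] : sval (b l) (sval (fmap G f) u) = 0.
    by rewrite -fu; exact: esym (bn' _ _ f u).
  exists (sval (iF l) v); rewrite [RHS]laE' /= -vE.
  exact: esym (hom_eqE u (icG _ _ f)).
have [j [u ->]] := colimit_surj hP hJ hF m.
rewrite [sval la _]laE' [LHS]lbE' /=.
have -> : sval (b j) (sval (a j) u) = 0 by apply/abE; exists u.
exact: (lin0 (hom_lin _)).
Qed.

(** * Yetter-Drinfeld modules as a closed class *)

Lemma tsum_tmap (k : fieldType) (V W C U : lmodType k) (f : V -> W) (t : V ⊗ C)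
    (F : W -> C -> U) : linear f -> is_bilinear F ->
  tsum (tmap f t) F = \tsum_(v ⊗ c := t) F (f v) c.
Proof.
move=> fl [Fl Fr]; rewrite /tmap (linear_tsum _ _ (tsum_linear (conj Fl Fr))).
by apply: eq_tsum => v c; rewrite tsum_pure.
Qed.

Lemma tmap_inj (k : fieldType) (V W C : lmodType k) (f : V -> W) :
  linear f -> injective f -> injective (@tmap k C V W f).
Proof.
move=> fl fi; have [r [rl frf]] := generalized_inverse fl.
have rf : cancel f r by move=> v; apply: fi; rewrite frf.
apply: (can_inj (g := tmap r)) => t.
have [tl tr] := tpure_bilinear V C.
rewrite [LHS]tsum_tmap //; last by lin.
by rewrite [RHS]tpureE; apply: eq_tsum => v c; rewrite rf.
Qed.

Section YDClass.
Variables (k : fieldType) (H : quasi_bialgebra_data k).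
Variables (A : bicomodule_algebra_data H) (C : bimodule_coalgebra_data H).
Hypothesis hC : is_bimodule_coalgebra C.

Let bil_lact : is_bilinear (@bmc_lact k H C). Proof. by case: (bmc_lactP hC). Qed.
Let bil_ract : is_bilinear (@bmc_ract k H C). Proof. by case: (bmc_ractP hC). Qed.
Let lin_lact h : linear (@bmc_lact k H C h). Proof. by case: bil_lact. Qed.
Let lin_ract c : linear (@bmc_ract k H C c). Proof. by case: bil_ract. Qed.
Hint Extern 0 (is_bilinear (@bmc_lact _ _ _)) => exact: bil_lact : lin.
Hint Extern 0 (is_bilinear (@bmc_ract _ _ _)) => exact: bil_ract : lin.
Hint Extern 0 (GRing.linear_for _ (@bmc_lact _ _ _ _)) => exact: lin_lact : lin.
Hint Extern 0 (GRing.linear_for _ (@bmc_ract _ _ _ _)) => exact: lin_ract : lin.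
Hint Extern 0 (GRing.linear_for _ (@bmc_Delta _ _ _)) =>
  exact: (bmc_Delta_linear hC) : lin.

Section Sides.
Variables (M : act_coact A C) (hM : is_linear M).
Let act_lin a : linear (@ac_act k A C M a). Proof. by case: hM. Qed.
Let coact_lin : linear (@ac_coact k A C M). Proof. by case: hM. Qed.
Hint Extern 0 (GRing.linear_for _ (@ac_act _ _ _ _ _)) => exact: act_lin : lin.
Hint Extern 0 (GRing.linear_for _ (@ac_coact _ _ _ _)) => exact: coact_lin : lin.

Definition coassoc_l (m : M) : M ⊗ C ⊗ C :=
  \tsum_(t1 ⊗ t2 ⊗ t3 := inverse (Phi_lambda_rho A))
    \tsum_(m0 ⊗ m1 := ac_coact m) \tsum_(n0 ⊗ n1 := ac_coact (ac_act t2 m0))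
      n0 ⊗ bmc_ract n1 t1 ⊗ bmc_lact t3 m1.
Definition coassoc_r (m : M) : M ⊗ C ⊗ C :=
  \tsum_(y1 ⊗ y2 ⊗ y3 := inverse (Phi_rho A))
    \tsum_(x1 ⊗ x2 ⊗ x3 := inverse (Phi_lambda A))
    \tsum_(n0 ⊗ n1 := ac_coact (ac_act x3 m)) \tsum_(c1 ⊗ c2 := bmc_Delta n1)
      ac_act y1 n0
      ⊗ bmc_ract (bmc_lact y2 c1) x1
      ⊗ bmc_ract (bmc_lact y3 c2) x2.
Definition compat_l (u : A) (m : M) : M ⊗ C :=
  \tsum_(u0 ⊗ u1 := brho u) \tsum_(m0 ⊗ m1 := ac_coact m)
    ac_act u0 m0 ⊗ bmc_lact u1 m1.
Definition compat_r (u : A) (m : M) : M ⊗ C :=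
  \tsum_(v ⊗ u0 := blambda u) \tsum_(n0 ⊗ n1 := ac_coact (ac_act u0 m))
    n0 ⊗ bmc_ract n1 v.

Lemma coassoc_l_lin : linear coassoc_l. Proof. by unfold coassoc_l; lin. Qed.
Lemma coassoc_r_lin : linear coassoc_r. Proof. by unfold coassoc_r; lin. Qed.
Lemma compat_l_lin u : linear (compat_l u). Proof. by unfold compat_l; lin. Qed.
Lemma compat_r_lin u : linear (compat_r u). Proof. by unfold compat_r; lin. Qed.
End Sides.

Section Naturality.
Variables (M N : act_coact A C) (hN : is_linear N).
Variables (f : M -> N) (hf : is_linear_colinear f).
Let fl : linear f. Proof. by case: hf. Qed.
Let fA a m : f (ac_act a m) = ac_act a (f m). Proof. by case: hf. Qed.
Let fC m : ac_coact (f m) = tmap f (ac_coact m). Proof. by case: hf. Qed.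
Let act_lin a : linear (@ac_act k A C N a). Proof. by case: hN. Qed.
Let coact_lin : linear (@ac_coact k A C N). Proof. by case: hN. Qed.
Hint Extern 0 (GRing.linear_for _ (@ac_act _ _ _ N _)) => exact: act_lin : lin.
Hint Extern 0 (GRing.linear_for _ (@ac_coact _ _ _ N)) => exact: coact_lin : lin.
Hint Extern 0 (GRing.linear_for _ f) => exact: fl : lin.
Hint Extern 0 (GRing.linear_for _ (tmap f)) => exact: (tmap_lin fl) : lin.
Let tl (D : lmodType k) := tmap_lin (C := D) fl.

Let tmapE (D : lmodType k) (m : M) (d : D) : tmap f (m ⊗ d) = f m ⊗ d.
Proof. by rewrite /tmap tsum_pure //; lin. Qed.

Lemma coassoc_l_nat m : coassoc_l (f m) = tmap f (coassoc_l m).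
Proof.
rewrite /coassoc_l (linear_tsum _ _ (@tl _)); apply: eq_tsum => t1 t.
rewrite (linear_tsum _ _ (@tl _)); apply: eq_tsum => t2 t3.
rewrite fC tsum_tmap //; last by lin.
rewrite (linear_tsum _ _ (@tl _)); apply: eq_tsum => m0 m1.
rewrite -fA fC tsum_tmap //; last by lin.
by rewrite (linear_tsum _ _ (@tl _)); apply: eq_tsum => n0 n1; rewrite tmapE.
Qed.
Lemma coassoc_r_nat m : coassoc_r (f m) = tmap f (coassoc_r m).
Proof.
rewrite /coassoc_r; do 4! (rewrite (linear_tsum _ _ (@tl _)); apply: eq_tsum => ? ?).
rewrite -fA fC tsum_tmap //; last by lin.
do 2! (rewrite (linear_tsum _ _ (@tl _)); apply: eq_tsum => ? ?).
by rewrite tmapE fA.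
Qed.
Lemma compat_l_nat u m : compat_l u (f m) = tmap f (compat_l u m).
Proof.
rewrite /compat_l (linear_tsum _ _ (@tl _)); apply: eq_tsum => u0 u1.
rewrite fC tsum_tmap //; last by lin.
by rewrite (linear_tsum _ _ (@tl _)); apply: eq_tsum => n0 n1; rewrite tmapE fA.
Qed.
Lemma compat_r_nat u m : compat_r u (f m) = tmap f (compat_r u m).
Proof.
rewrite /compat_r (linear_tsum _ _ (@tl _)); apply: eq_tsum => u0 u1.
rewrite -fA fC tsum_tmap //; last by lin.
by rewrite (linear_tsum _ _ (@tl _)); apply: eq_tsum => n0 n1; rewrite tmapE.
Qed.
End Naturality.

Lemma yd_linear (M : act_coact A C) : is_yetter_drinfeld M -> is_linear M.
Proof. by case=> -[[_ al] _ _] cl _ _ _; split. Qed.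

(** The coassociativity and compatibility axioms equate linear maps natural in M, with values in M ⊗
    C ⊗ C and M ⊗ C. An injective f reflects such equalities since f ⊗ id is injective too;
    conversely they hold on images of Yetter-Drinfeld modules, hence on everything these
    generate. *)
Lemma yd_closed : closed_class (@is_yetter_drinfeld k H A C).
Proof.
have eps_lin : scalar (@bmc_eps k H C) := bmc_eps_linear hC.
split; first exact: yd_linear.
- move=> M N f hf fi hN; have lN := yd_linear hN.
  have [[[actl actr] act1 actM] coactl counit coassoc compat] := hN.
  have [fl fA fC'] := hf; have fC m : ac_coact (f m) = tmap f (ac_coact m) := fC' m.
  have ti D := @tmap_inj k _ _ D f fl fi.
  split.
  + split; first split=> [m a b c|a b m n].
    * by apply: fi; rewrite fl !fA actl.
    * by apply: fi; rewrite fl !fA fl actr.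
    * by move=> m; apply: fi; rewrite fA act1.
    by move=> a b m; apply: fi; rewrite !fA actM.
  + move=> a m n; apply: (ti C).
    have := tmap_lin (C := C) fl a (ac_coact m) (ac_coact n) => /= ->.
    by rewrite -!fC fl coactl.
  + move=> m; apply: fi; rewrite -[RHS]counit -[LHS]/(f (pairing bmc_eps _)).
    by rewrite -pairing_tmap // -fC.
  + move=> m; apply: (ti (C ⊗ C)%type).
    by rewrite -[LHS](coassoc_l_nat lN hf) -[RHS](coassoc_r_nat lN hf); exact: coassoc.
  + move=> u m; apply: (ti C).
    by rewrite -[LHS](compat_l_nat lN hf) -[RHS](compat_r_nat hf); exact: compat.
move=> N lN gen; have [al cl] := lN.
have gen_eq (U : lmodType k) (L R : N -> U) : linear L -> linear R ->
    (forall (M : act_coact A C) (f : M -> N) m,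
      is_yetter_drinfeld M -> is_linear_colinear f -> L (f m) = R (f m)) -> L =1 R.
  move=> Ll Rl; apply: gen => [|x y Ex Ey]; first by rewrite !lin0.
  by rewrite !linD // Ex Ey.
split=> //.
- split; first split=> // m a b c.
  + move: m; apply: (gen_eq _ (ac_act (a *: b + c))
      (fun m => a *: ac_act b m + ac_act c m)) => [||M f m hM [fl fA _]]; first exact: al.
      by move=> d m n; rewrite !al !scalerDr !scalerA mulrC [d * a]mulrC addrACA.
    by have [[[hl _] _ _] _ _ _ _] := hM; rewrite -!fA hl fl.
  + apply: (gen_eq _ (ac_act 1) id) => [||M f m hM [fl fA _]] //.
    by have [[_ h1 _] _ _ _ _] := hM; rewrite -fA h1.
  move=> a b; apply: (gen_eq _ (ac_act (a * b)) (fun m => ac_act a (ac_act b m)))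
    => [||M f m hM [fl fA _]]; [exact: al | exact: lin_comp (al a) (al b) |].
  by have [[_ _ hm] _ _ _ _] := hM; rewrite -!fA hm.
- apply: gen_eq => [||M f m hM hf] //.
    exact: lin_comp (pairing_lin eps_lin) cl.
  have [fl _ fC'] := hf; have fC n : ac_coact (f n) = tmap f (ac_coact n) := fC' n.
  have [_ _ counit _ _] := hM.
  rewrite -[LHS]/(pairing bmc_eps _) fC pairing_tmap //; congr f; exact: counit.
- apply: gen_eq => [||M f m hM hf]; [exact: coassoc_l_lin|exact: coassoc_r_lin|].
  rewrite -[LHS]/(coassoc_l _) -[RHS]/(coassoc_r _).
  rewrite (coassoc_l_nat lN hf) (coassoc_r_nat lN hf).
  by have [_ _ _ E _] := hM; congr tmap; exact: E.
- move=> u; apply: gen_eq => [||M f m hM hf]; [exact: compat_l_lin|exact: compat_r_lin|].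
  rewrite -[LHS]/(compat_l _ _) -[RHS]/(compat_r _ _).
  rewrite (compat_l_nat lN hf) (compat_r_nat hf).
  by have [_ _ _ _ E] := hM; congr tmap; exact: E.
Qed.

Lemma yd_grothendieck : grothendieck (yd_modules A C).
Proof.
exists (cat_preadditive yd_closed); split.
- exact: cat_abelian.
- exact: (coproducts yd_closed).
- exact: cat_exact_filtered_colimits.
- exact: (cat_generator yd_closed).
Qed.

Lemma yd_enough_injectives : enough_injectives (yd_modules A C).
Proof. exact: (cat_enough_injectives yd_closed). Qed.
End YDClass.

Theorem theorem3p8 (k : fieldType) (H : quasi_hopf_data k)
    (A : bicomodule_algebra_data H) (C : bimodule_coalgebra_data H)
    (hH : is_quasi_hopf H) (hA : is_bicomodule_algebra A)
    (hC : is_bimodule_coalgebra C) :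
  isomorphic_categories (yd_modules A C)
    (hopf_modules (A2 A) (bimodule_as_left C))
  /\ grothendieck (yd_modules A C)
  /\ enough_injectives (yd_modules A C).
Proof.
split; first exact: yd_hopf_isomorphic.
by split; [exact: yd_grothendieck | exact: yd_enough_injectives].
Qed.
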